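(* For every $a\ge h^*$, as $t\to\infty$, $$P_a\big[|\mathcal C_o^{h^*}\cap\mathbb T^+|>t\big]=C_1\chi(a)\,t^{-1/2}(1+o(1)),\qquad P_a\big[|\mathcal C_o^{h^*}|>t\big]=C_1\frac{d+1}{d}\chi(a)\,t^{-1/2}(1+o(1)),$$ where $$C_1=\frac1{\Gamma(1/2)}\sqrt{\frac{2d}{d-1}\cdot\frac{\langle 1,\chi\rangle_\nu}{\langle\chi,\chi^2\rangle_\nu}}$$ and $\langle\cdot,\cdot\rangle_\nu$ is the scalar product of $L^2(\nu)$.
   Context: Let $d\ge 2$ and let $\mathbb T$ be the infinite $(d+1)$-regular tree rooted at $o$, $\bar o$ a fixed neighbour of $o$, $\mathbb T^+:=\{x:\bar o\text{ not on the geodesic from }o\text{ to }x\}$. Let $\phi$ be the Gaussian free field on $\mathbb T$ (centred Gaussian, covariance equal to the Green function $g(x,y)=\frac1{d+1}\mathbb E_x[\sum_{k\ge0}1_{X_k=y}]$ of simple random walk), law $P$, and $P_a:=P[\cdot\mid\phi_o=a]$; equivalently under $P_a$, $\phi_o=a$ and $\phi_x=\frac1d\phi_{\bar x}+Y_x$ for $x\neq o$ ($\bar x$ the parent of $x$ towards $o$, $(Y_x)$ i.i.d. $\mathcal N(0,\frac{d+1}d)$). $\mathcal C_o^h$ is the connected component of $o$ in $\{x:\phi_x\ge h\}$, and $h^*:=\inf\{h:P[|\mathcal C_o^h|=\infty]=0\}$. Spectral objects: $\sigma_\nu^2=\frac d{d-1}$, $\sigma_Y^2=\frac{d+1}d$,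 $\nu=\mathcal N(0,\sigma_\nu^2)$, $\rho_Y$ the density of $\mathcal N(0,\sigma_Y^2)$. For $h\in\mathbb R$ the operator $L_h$ on $L^2(\nu)$ is $L_h[f](a)=1_{[h,\infty)}(a)\,d\int_h^\infty f(x)\rho_Y(x-\frac ad)\,dx$. It is known that $L_h$ is self-adjoint, nonnegative and Hilbert–Schmidt, its norm $\lambda_h$ is a simple eigenvalue with a unique eigenfunction $\chi_h\ge0$ of unit $L^2(\nu)$-norm, which is continuous, strictly positive on $[h,\infty)$ and zero on $(-\infty,h)$, and $h^*$ is the unique $h$ with $\lambda_h=1$. Write $\chi:=\chi_{h^*}$. *)

(* Defs.v *)
From HB Require Import structures.
From mathcomp Require Import all_boot all_order all_algebra.
From mathcomp Require Import all_classical all_reals all_analysis.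
Set Implicit Arguments. Unset Strict Implicit. Unset Printing Implicit Defensive.
Import Order.TTheory GRing.Theory Num.Theory.
Import numFieldNormedType.Exports.
Local Open Scope classical_set_scope.
Local Open Scope ring_scope.

(* ---------- the (d+1)-regular tree ----------
   A vertex is a word (seq nat) listed from the vertex back to the root:
   the root o is [::], the parent of (i :: s) is s.  The root has the d+1
   children [:: i] (i < d+1), every other vertex has the d children i :: s
   (i < d).  The fixed neighbour obar of o is [:: 0]. *)
Fixpoint vtx (d : nat) (s : seq nat) : bool :=
  match s with
  | [::] => true
  | [:: i] => (i < d.+1)%N
  | i :: s' => (i < d)%N && vtx d s'
  end.

(* T^+ : vertices whose geodesic to o does not pass through obar = [:: 0],
   i.e. the root and all words whose last letter (first step from o) is not 0 *)
Definition Tplus : set (seq nat) := [set s | last 1%N s != 0%N].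

Section Field.
Context {R : realType}.

Fixpoint phi (d : nat) (r : R) (w : seq nat -> R) (x : seq nat) : R :=
  match x with
  | [::] => r
  | i :: s => phi d r w s / d%:R + w (i :: s)
  end.

Fixpoint path_above (d : nat) (h r : R) (w : seq nat -> R) (x : seq nat) : bool :=
  match x with
  | [::] => h <= r
  | i :: s => (h <= phi d r w (i :: s)) && path_above d h r w s
  end.

(* C_o^h: the connected component of o in {phi >= h} (in a tree, x is in it
   iff the whole geodesic from o to x lies in {phi >= h}) *)
Definition tcluster (d : nat) (h r : R) (w : seq nat -> R) : set (seq nat) :=
  [set x | vtx d x /\ path_above d h r w x].

Definition vcard (A : set (seq nat)) : \bar R := (\esum_(x in A) 1)%E.

Definition sigma_nu (d : nat) : R := Num.sqrt (d%:R / (d%:R - 1)).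
Definition sigma_Y (d : nat) : R := Num.sqrt ((d%:R + 1) / d%:R).
Definition rho_nu (d : nat) (x : R) : R := normal_pdf 0 (sigma_nu d) x.
Definition rho_Y (d : nat) (x : R) : R := normal_pdf 0 (sigma_Y d) x.

Definition nu_int (d : nat) (f : R -> R) : R :=
  Rintegral lebesgue_measure setT (fun x => f x * rho_nu d x).

Definition L2nu (d : nat) (f : R -> R) : Prop :=
  measurable_fun setT f /\
  lebesgue_measure.-integrable setT (fun x => (f x ^+ 2 * rho_nu d x)%:E).

Definition Lop (d : nat) (h : R) (f : R -> R) (a : R) : R :=
  if h <= a then
    d%:R * Rintegral lebesgue_measure `[h, +oo[ (fun x => f x * rho_Y d (x - a / d%:R))
  else 0.

Definition lambda (d : nat) (h : R) : \bar R :=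
  ereal_sup [set (Num.sqrt (nu_int d (fun a => Lop d h f a ^+ 2)))%:E
            | f in [set f | L2nu d f /\ nu_int d (fun x => f x ^+ 2) <= 1]].

Definition Gamma (s : R) : R :=
  Rintegral lebesgue_measure `]0, +oo[ (fun x => x `^ (s - 1) * expR (- x)).

Definition C1 (d : nat) (chi : R -> R) : R :=
  (Gamma (1 / 2))^-1 *
  Num.sqrt ((2 * d%:R / (d%:R - 1)) * (nu_int d chi / nu_int d (fun x => chi x ^+ 3))).

End Field.

Definition mutually_independent {dT : measure_display} {Omega : measurableType dT}
  {R : realType} (P : probability Omega R) {I : eqType} (dom : I -> bool)
  (X : I -> Omega -> R) : Prop :=
  forall (J : seq I) (B : I -> set R), uniq J -> all dom J ->
    (forall i, measurable (B i)) ->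
    P (\bigcap_(i in [set j | j \in J]) (X i @^-1` B i)) =
    (\prod_(i <- J) P (X i @^-1` B i))%E.
Arguments vcard {R} A.

(* Main.v *)
(** Let [N] be the cluster size under [P_a] and [w_z(a) = 1 - E_a z^N].  Exploring the tree
    generation by generation gives [w = 1 - z (1 - L w / d)^d] on [[h, oo)], where
    [L = Lop d h].

    The value [lam = 1]: pairing this equation with [chi] at a level slightly above [hs],
    [lam > 1] keeps [w_z] away from [0] as [z -> 1], so clusters are infinite with positive
    probability above [hs]; if [lam < 1], then [L chi] extended slightly below [hs] is still
    strictly superharmonic and forces [w_z -> 0], so clusters are finite below [hs].

    At [lam = 1], a Harnack inequality, the Lyapunov functions [exp (k a)] and a minorization
    give a spectral gap, whence [w_z = c_z chi + O(c_z^2)] with [c_z = <w_z, chi>].  Pairing the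
    equation with [chi] once more and using
    [1 - (1 - y)^d = d y - d (d - 1) y^2 / 2 + O(y^3)], the linear terms cancel and
    [c_z^2 / (1 - z)] tends to [2 d / (d - 1) * <1, chi> / <chi, chi^2>].  Since
    [w_z(a) / (1 - z) = sum_t P_a(N > t) z^t], the tail follows from Karamata's Tauberian
    theorem for nonincreasing coefficients, proved by comparison with [t^(-1/2)] and
    Weierstrass approximation.  The root of the full tree has [d + 1] subtrees instead of [d],
    which gives the factor [(d + 1) / d]. *)

Require Import Defs.
From HB Require Import structures.
From mathcomp Require Import all_boot all_order all_algebra.
From mathcomp Require Import all_classical all_reals all_analysis.
From mathcomp Require Import measurable_realfun.
From mathcomp Require Import ring lra.
Set Implicit Arguments. Unset Strict Implicit. Unset Printing Implicit Defensive.
Import Order.TTheory GRing.Theory Num.Theory.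
Import numFieldNormedType.Exports.
Local Open Scope classical_set_scope.
Local Open Scope ring_scope.

(** * Gaussian integrals and independence *)

(** [chi] is given as an eigenfunction for the operator norm [lam], and [hs] as a percolation
    threshold; [lam = 1] is the link between the two and has to be derived first. The main obstacle
    is that [hs, oo) is not compact. What replaces compactness is that a child has mean field
    [a / d] with [d >= 2], so [L] makes [exp (k a)] much smaller for large [a]. Hence all estimates
    are weighted: [w] is controlled by [exp a], the quadratic remainder by [exp (2 a)], the cubic
    errors by [exp (4 a)], all integrable against [chi nu]. The working space is [L^1] of [chi nu],
    with the functional [J f = <f, chi>]: [L] multiplies [J] by [lam], and the Harnack inequality
    turns a bound on [J f] into a local pointwise bound on [L f]. The factor [2 d / (d - 1)] is the
    inverse of [d (d - 1) / 2 * (1 / d)^2], because the expansion is taken at [y = L w / d], which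
    is close to [c_z chi / d]. In the Tauberian step the indicator of Karamata's argument is
    replaced by Lipschitz tents, so that the quantitative Bernstein estimate is enough. *)

Section normal_density.
Context {R : realType}.
Local Notation mu := (@lebesgue_measure R).
Local Open Scope ereal_scope.

Lemma ge0_integral_shift (f : R -> \bar R) (b : R) :
  measurable_fun setT f -> (forall x, 0 <= f x) ->
  \int[mu]_x f (b + x)%R = \int[mu]_x f x.
Proof.
move=> mf f0.
have mT : measurable_fun [set: R] (fun x : R => b + x)%R.
  by apply: measurable_funD => //.
transitivity (\int[pushforward mu (fun x => b + x : measurableTypeR R)%R]_x f x).
  by rewrite ge0_integral_pushforward.
apply: eq_measure_integral => /= A mA _.
apply/esym/lebesgue_measure_unique => //= _ [[u v]] _ <-.
rewrite /pushforward /=.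
have -> : (fun x : R => (b + x)%R) @^-1` `]u, v] = `](u - b)%R, (v - b)%R]%classic.
  apply/seteqP; split=> x /=; rewrite !in_itv/=; lra.
rewrite !lebesgue_measure_itv/= !lte_fin ltrD2r.
by case: ifP => // _; rewrite -!EFinB; congr EFin; lra.
Qed.

Lemma ge0_integral_normal_prob (m s : R) (f : R -> \bar R) :
  measurable_fun setT f -> (forall x, 0 <= f x <= 1) ->
  \int[normal_prob m s]_x f x = \int[mu]_x (f x * (normal_pdf m s x)%:E).
Proof.
move=> mf f01.
have intf : (normal_prob m s).-integrable setT f.
  apply/integrableP; split => //.
  apply: (@le_lt_trans _ _ (\int[normal_prob m s]_x cst 1 x)).
    apply: ge0_le_integral => //=; first exact: measurableT_comp.
    by move=> x _; case/andP: (f01 x) => f0 f1; rewrite gee0_abs.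
  by rewrite integral_cst//= mul1e probability_setT ltry.
(* The abstract derivative of [normal_prob] is then identified almost everywhere with [normal_pdf],
   both having the same integral over every measurable set. *)
rewrite -(Radon_Nikodym_change_of_variables (normal_prob_dominates m s))//=.
apply: ae_eq_integral => //.
- apply: emeasurable_funM => //; apply: (measurable_int mu).
  by apply: Radon_Nikodym_integrable; exact: normal_prob_dominates.
- apply: emeasurable_funM => //=; apply/measurable_EFinP.
  exact: measurable_normal_pdf.
- apply: ae_eqe_mul2l => /=.
  rewrite Radon_NikodymE//=; first exact: normal_prob_dominates.
  move=> abmu; case: cid => /= h [h1 h2 h3].
  apply: integral_ae_eq => //=.
  + by apply/measurable_EFinP; exact: measurable_normal_pdf.
  + by move=> E E01 mE; rewrite -h3.
Qed.

Lemma integral_normal_prob_shift (s b : R) (f : R -> \bar R) :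
  measurable_fun setT f -> (forall x, 0 <= f x <= 1) ->
  \int[normal_prob 0 s]_y f (b + y)%R =
  \int[mu]_x (f x * (normal_pdf 0 s (x - b))%:E).
Proof.
move=> mf f01.
have mfb : measurable_fun setT (fun y => f (b + y)%R).
  by apply: measurableT_comp => //; apply: measurable_funD.
rewrite (@ge0_integral_normal_prob 0 s (fun y => f (b + y)%R) mfb (fun y => f01 (b + y)%R)).
have mg : measurable_fun setT (fun x => f x * (normal_pdf 0 s (x - b))%:E).
  apply: emeasurable_funM => //; apply/measurable_EFinP.
  apply: measurableT_comp; first exact: measurable_normal_pdf.
  exact: measurable_funB.
have g0 x : 0 <= f x * (normal_pdf 0 s (x - b))%:E.
  case/andP: (f01 x) => f0 _; rewrite mule_ge0// lee_fin; exact: normal_pdf_ge0.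
rewrite -(ge0_integral_shift b mg g0).
by apply: eq_integral => x _; rewrite addrAC subrr add0r.
Qed.

End normal_density.

(** * Integrating out one independent variable *)

Section peeling.
Context {R : realType} {dT : measure_display} {Omega : measurableType dT}.
Variables (P : probability Omega R) (I : eqType) (dom : I -> bool).
Variable X : I -> Omega -> R.
Hypothesis mX : forall i, measurable_fun setT (X i).
Hypothesis indX : mutually_independent P dom X.
Local Open Scope ereal_scope.

(** A pi-system of events that do not look at [X k]; it generates the sigma-algebra of all the other
    variables in [dom]. *)
Definition cylinders (k : I) : set (set Omega) :=
  [set A | exists J B, [/\ uniq J, all dom J, k \notin J,
     (forall i, measurable (B i)) &
     A = \bigcap_(i in [set j | j \in J]) (X i @^-1` B i)]].

Lemma cylinders_setI k : setI_closed (cylinders k).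
Proof.
move=> _ _ [J1 [B1 [u1 a1 k1 m1 ->]]] [J2 [B2 [u2 a2 k2 m2 ->]]].
exists (undup (J1 ++ J2)), (fun i =>
  (if i \in J1 then B1 i else setT) `&` (if i \in J2 then B2 i else setT)).
split.
- exact: undup_uniq.
- by apply/allP => i; rewrite mem_undup mem_cat => /orP[] /allP; exact.
- by rewrite mem_undup mem_cat negb_or k1.
- by move=> i; apply: measurableI; case: ifP.
- apply/seteqP; split => w /=.
    move=> [h1 h2] i /=; rewrite mem_undup mem_cat => _.
    by split; case: ifP => // ij; [exact: h1|exact: h2].
  move=> h; split=> i /= ij.
    by have /= := h i; rewrite mem_undup mem_cat ij => -[].
  by have /= := h i; rewrite mem_undup mem_cat ij orbT => /(_ isT)[].
Qed.

Lemma cylinders_measurable k : cylinders k `<=` measurable.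
Proof.
move=> _ [J [B [_ _ _ mB ->]]].
apply: fin_bigcap_measurable; first exact: finite_seq.
by move=> i _; rewrite -[_ @^-1` _]setTI; exact: mX.
Qed.

(** Both sides are finite measures of [A]: [P] restricted to the event that [X k] lies in [B], and
    [P] scaled by the probability of that event. They agree on [cylinders k] by mutual independence,
    hence on the generated sigma-algebra. *)
Lemma peel_independent k A B : dom k -> <<s cylinders k >> A -> measurable B ->
  P (A `&` X k @^-1` B) = P A * P (X k @^-1` B).
Proof.
move=> domk sA mB.
have mkB : measurable (X k @^-1` B) by rewrite -[_ @^-1` _]setTI; exact: mX.
have fB : P (X k @^-1` B) \is a fin_num by exact: fin_num_measure.
have r0 : (0 <= fine (P (X k @^-1` B)))%R by exact: fine_ge0.
pose m1 : {measure set Omega -> \bar R} := mrestr P mkB.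
pose m2 : {measure set Omega -> \bar R} := mscale (NngNum r0) P.
suff : m1 A = m2 A.
  by rewrite /m1 /m2 /= /mrestr /mscale /= => ->; rewrite fineK// muleC.
apply: (@g_sigma_algebra_measure_unique _ R Omega (cylinders k) _ (fun=> setT)) => //.
- exact: cylinders_measurable.
- move=> _; exists [::], (fun=> setT); split => //.
  by apply/seteqP; split.
- by apply/seteqP; split => // w _; exists 0%N.
- exact: cylinders_setI.
- move=> _ [J [C [uJ aJ kJ mC ->]]].
  rewrite /m1 /m2 /= /mrestr /mscale /= fineK//.
  have := @indX (k :: J) (fun i => if i == k then B else C i).
  rewrite /= kJ uJ domk aJ => /(_ isT isT) h.
  have {}h : P (\bigcap_(i in [set j | j \in k :: J])
      (X i @^-1` (if i == k then B else C i))) =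
      \prod_(i <- k :: J) P (X i @^-1` (if i == k then B else C i)).
    by apply: h => i; case: ifP.
  rewrite big_cons eqxx in h.
  rewrite (_ : (\big[mule/1%E]_(_ <- _) _) = \prod_(i <- J) P (X i @^-1` C i)) in h; last first.
    apply: eq_big_seq => i iJ; case: ifPn => // /eqP ik.
    by rewrite -ik iJ in kJ.
  rewrite (indX uJ aJ mC) -h; congr (P _).
  apply/seteqP; split => w /=.
    move=> [h1 h2] i /=; rewrite inE => /predU1P[->|iJ]; first by rewrite eqxx.
    case: ifPn => [/eqP ik|_]; last exact: h1.
    by rewrite -ik iJ in kJ.
  move=> h1; split.
    move=> i iJ; have := h1 i; rewrite /= inE iJ orbT => /(_ isT).
    by case: ifPn => // /eqP ik; rewrite -ik iJ in kJ.
  by have := h1 k; rewrite /= inE eqxx; apply.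
- by move=> _; rewrite /m1 /= /mrestr setTI (le_lt_trans (probability_le1 P mkB))// ltry.
Qed.

Local Notation T' k := (g_sigma_algebraType (cylinders k)).

Lemma measurable_peel_id k :
  measurable_fun setT (id : Omega -> T' k).
Proof.
move=> _ A mA; rewrite setTI preimage_id.
exact: (smallest_sub (@sigma_algebra_measurable _ Omega) (@cylinders_measurable k)) mA.
Qed.

Lemma measurable_peel k j : dom j -> j != k ->
  measurable_fun setT (X j : T' k -> R).
Proof.
move=> dj jk _ B mB; rewrite setTI.
apply: sub_sigma_algebra; exists [:: j], (fun=> B); split => //=.
- by rewrite dj.
- by rewrite inE eq_sym.
- apply/seteqP; split => w /=.
    by move=> h i /=; rewrite inE => /eqP ->.
  by apply; rewrite /= inE.
Qed.

(** [T' k] is [Omega] with the sigma-algebra of the other variables, so measurability of [Phi] on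
    the product says that its first argument does not see [X k]. The pair formed by the identity and
    [X k] then has a product law, and Tonelli applies. *)
Lemma peel k (mk : probability (measurableTypeR R) R) (Phi : T' k * measurableTypeR R -> \bar R) :
  dom k -> (forall B, measurable B -> P (X k @^-1` B) = mk B) ->
  measurable_fun setT Phi -> (forall x, 0 <= Phi x) ->
  \int[P]_w Phi (w, X k w) = \int[P]_w \int[mk]_y Phi (w, y).
Proof.
move=> domk Xk mPhi Phi0.
pose idk : Omega -> T' k := id.
have mid : measurable_fun setT idk := @measurable_peel_id k.
pose idm : {mfun Omega >-> T' k} := HB.pack idk (isMeasurableFun.Build _ _ _ _ _ mid).
pose idX := fun w => (idm w, X k w : measurableTypeR R).
have mXk : measurable_fun setT (X k : Omega -> measurableTypeR R) := mX k.
have midX : measurable_fun setT idX by apply/measurable_fun_pair.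
pose idXm : {mfun Omega >-> (T' k * measurableTypeR R)%type} :=
  HB.pack idX (isMeasurableFun.Build _ _ _ _ _ midX).
pose P' : probability (T' k) R := distribution P idm.
pose PX : probability (T' k * measurableTypeR R)%type R := distribution P idXm.
transitivity (\int[PX]_x Phi x).
  by rewrite /PX /distribution ge0_integral_pushforward.
transitivity (\int[P' \x mk]_x Phi x).
  apply: eq_measure_integral => /= A mA _.
  apply/esym/(@product_measure_unique _ _ _ _ _ P' mk PX) => //= B C mB mC.
  rewrite /P' /PX /= /distribution /pushforward /= preimage_id -Xk//.
  by rewrite -peel_independent.
rewrite fubini_tonelli1 //= /P' /distribution ge0_integral_pushforward //=.
- exact: measurable_fun_fubini_tonelli_F.
- by move=> x _; exact: integral_ge0.
Qed.

End peeling.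

(** * Generations of the tree *)

Section tree.
Implicit Types (rc : seq nat) (d n : nat) (s : seq nat).

(* [rc] lists the first steps allowed from the root: [iota 1 d] for T^+ and
   [iota 0 d.+1] for the whole tree *)
Definition tchildren rc d s := if s is [::] then rc else iota 0 d.

Fixpoint tgen rc d n : seq (seq nat) :=
  if n is m.+1 then [seq i :: s | s <- tgen rc d m, i <- tchildren rc d s]
  else [:: [::]].

Lemma vtx_behead d i s : vtx d (i :: s) -> vtx d s.
Proof. by case: s => [//|j s] /= /andP[]. Qed.

Lemma tgen_size rc d n s : s \in tgen rc d n -> size s = n.
Proof.
elim: n s => [|n ih] s /=; first by rewrite inE => /eqP ->.
by move=> /allpairsPdep[t [i [tn _ ->]]] /=; rewrite ih.
Qed.

Lemma tgen_vtx rc d n s : all (fun i => i < d.+1)%N rc ->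
  s \in tgen rc d n -> vtx d s.
Proof.
move=> /allP rcd; elim: n s => [|n ih] s /=; first by rewrite inE => /eqP ->.
move=> /allpairsPdep[t [i [tn it ->]]]; have := ih _ tn.
case: t tn it => [_ /rcd //|j t tn]; rewrite /tchildren mem_iota /= add0n => id.
by move=> vt; apply/andP.
Qed.

Lemma tgen_uniq rc d n : uniq rc -> uniq (tgen rc d n).
Proof.
move=> urc; elim: n => [//|n ih] /=; apply: allpairs_uniq_dep => //.
  by move=> s _; case: s => [//|? ?]; exact: iota_uniq.
by move=> [s i] [t j] _ _ /= [-> ->].
Qed.

Lemma mem_tgen rc d s : vtx d s -> (s == [::]) || (last 0%N s \in rc) ->
  s \in tgen rc d (size s).
Proof.
elim: s => [//|i s ih] vs.
rewrite /= => lrc; apply/allpairsPdep; exists s, i; split => //.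
  apply: ih; first exact: vtx_behead vs.
  by case: s lrc {vs} => //= j s ->.
case: s vs lrc {ih} => [//|j s /andP[id _] _].
by rewrite /tchildren mem_iota.
Qed.

Lemma size_tchildren rc d n s : s \in tgen rc d n ->
  size (tchildren rc d s) = if n is 0 then size rc else d.
Proof.
move=> /tgen_size; case: s => [<-//|j s /= <-].
by rewrite size_iota.
Qed.

End tree.

Section generations.
Context {R : realType} (d : nat) {dT : measure_display} {Omega : measurableType dT}.
Variables (P : probability Omega R) (W : seq nat -> Omega -> R).
Hypothesis W_meas : forall x, measurable_fun setT (W x).
Hypothesis W_Y : forall x, vtx d x -> x != [::] -> forall B, measurable B ->
  P (W x @^-1` B) = normal_prob 0 (sigma_Y d) B.
Hypothesis W_indep : mutually_independent P (vtx d) W.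
Variable h : R.
(** The field at o is a parameter: the constant [a] gives [P_a], and [W [::]] gives [P]. The second
    measurability assumption says that it survives peeling off any other vertex. *)
Variable root : Omega -> R.
Local Notation T' k := (g_sigma_algebraType (cylinders (vtx d) W k)).
Hypothesis mroot : measurable_fun setT root.
Hypothesis mroot' : forall k, k != [::] -> measurable_fun setT (root : T' k -> R).

Definition fld s w := phi d (root w) (W ^~ w) s.
Definition abv s w := path_above d h (root w) (W ^~ w) s.

(** The measurable space is arbitrary so that one statement serves for [Omega] and for the smaller
    sigma-algebras [T' k]; [Q] marks the labels that may be read, and [drop m s] runs over the
    vertex and its ancestors. *)
Lemma measurable_fld_abv (dT' : measure_display) (Om : measurableType dT')
  (r : Om -> R) (V : seq nat -> Om -> R) (Q : seq nat -> bool) s :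
  measurable_fun setT r -> (forall j, j != [::] -> Q j -> measurable_fun setT (V j)) ->
  (forall m, Q (drop m s)) ->
  measurable_fun setT (fun w => phi d (r w) (V ^~ w) s) /\
  measurable_fun setT (fun w => path_above d h (r w) (V ^~ w) s).
Proof.
move=> mr mV; elim: s => [|i s ih] Qs.
  by split => //; apply: measurable_fun_ler => //; exact: measurable_cst.
have {ih}[m1 m2] := ih (fun m => Qs m.+1).
have mis : measurable_fun setT (fun w => phi d (r w) (V ^~ w) (i :: s)).
  rewrite /=; apply: measurable_funD; first by apply: measurable_funM.
  by apply: mV => //; exact: (Qs 0%N).
split => //; apply: measurable_and => //.
by apply: measurable_fun_ler => //; exact: measurable_cst.
Qed.

Lemma measurable_abv s : measurable_fun setT (abv s).
Proof.
by have [] := @measurable_fld_abv _ Omega root W (fun=> true) s mroot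
  (fun j _ _ => W_meas j) (fun=> isT).
Qed.

Lemma vtx_drop m s : vtx d s -> vtx d (drop m s).
Proof.
elim: m s => [|m ih] s; first by rewrite drop0.
by case: s => [//|i s] /vtx_behead /ih.
Qed.

(** A vertex other than [k] and not deeper than [k] has no ancestor equal to [k], so [W k] never
    enters its field. *)
Lemma measurable_fld_peel k s : k != [::] -> vtx d s ->
  (size s <= size k)%N -> s != k ->
  measurable_fun setT (fld s : T' k -> R) /\
  measurable_fun setT (abv s : T' k -> bool).
Proof.
move=> k0 vs sk nsk.
apply: (@measurable_fld_abv _ (T' k) root W (fun j => vtx d j && (j != k)) s).
- exact: mroot'.
- by move=> j _ /andP[vj jk]; exact: measurable_peel.
- move=> m; rewrite vtx_drop//=; case: m => [|m]; first by rewrite drop0.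
  apply/eqP => e; have : (size (drop m.+1 s) < size k)%N.
    case: s vs sk nsk e => [_ _ _ e|i s vs sk nsk _]; first by rewrite -e in k0.
    rewrite /= size_drop; rewrite /= in sk; apply: leq_trans sk; rewrite ltnS; exact: leq_subr.
  by rewrite e ltnn.
Qed.

Variable z : R.
Hypothesis z01 : 0 <= z <= 1.
Variable rc : seq nat.
Hypothesis rc_uniq : uniq rc.
Hypothesis rc_lt : all (fun i => i < d.+1)%N rc.
Local Notation gen n := (tgen rc d n).

(** Below [h] a vertex is cut off together with its descendants and contributes the neutral factor
    1. *)
Definition fcut (u : R -> R) x := if h <= x then u x else 1.

Definition fkernel (u : R -> R) a : R :=
  Rintegral (normal_prob 0 (sigma_Y d)) setT (fun y => fcut u (a / d%:R + y)).

Definition prefixz n w := \prod_(k < n) \prod_(s <- gen k) (if abv s w then z else 1).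

(** The state of the backward recursion: generations before [n] are counted exactly by powers of
    [z], while [u] stands for the generating function of the whole subtree at a vertex of generation
    [n], as a function of its field. *)
Definition gprod n (u : R -> R) w :=
  prefixz n w * \prod_(s <- gen n) (if abv s w then u (fld s w) else 1).

Definition in01 (u : R -> R) := forall x, 0 <= u x <= 1.

Lemma fcut_in01 u : in01 u -> in01 (fcut u).
Proof. by move=> u01 x; rewrite /fcut; case: ifP => // _; rewrite ler01 lexx. Qed.

Lemma measurable_fcut u : measurable_fun setT u -> measurable_fun setT (fcut u).
Proof.
move=> mu; apply: measurable_fun_ifT => //.
by apply: measurable_fun_ler => //; exact: measurable_cst.
Qed.

Lemma in01_integral (u : R -> R) b : measurable_fun setT u -> in01 u ->
  (\int[normal_prob 0 (sigma_Y d)]_y (u (b + y))%:E)%E =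
  (Rintegral (normal_prob 0 (sigma_Y d)) setT (fun y => u (b + y)))%:E.
Proof.
move=> mu u01; rewrite /Rintegral fineK// ge0_fin_numE; last first.
  by apply: integral_ge0 => x _; rewrite lee_fin; case/andP: (u01 (b + x)).
apply: (@le_lt_trans _ _ (\int[normal_prob 0 (sigma_Y d)]_x cst 1%E x)%E).
  apply: ge0_le_integral => //=.
  - by move=> x _; rewrite lee_fin; case/andP: (u01 (b + x)).
  - apply/measurable_EFinP; apply: measurableT_comp => //; exact: measurable_funD.
  - by move=> x _; rewrite lee_fin; case/andP: (u01 (b + x)).
by rewrite integral_cst//= mul1e probability_setT ltry.
Qed.

Lemma fkernelE u a : measurable_fun setT u -> in01 u ->
  (\int[normal_prob 0 (sigma_Y d)]_y (fcut u (a / d%:R + y))%:E)%E = (fkernel u a)%:E.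
Proof.
move=> mu u01; rewrite in01_integral//; [exact: measurable_fcut|exact: fcut_in01].
Qed.

Lemma fkernel_in01 u : measurable_fun setT u -> in01 u -> in01 (fkernel u).
Proof.
move=> mu u01 a; rewrite -!lee_fin -fkernelE//; apply/andP; split.
  by apply: integral_ge0 => x _; rewrite lee_fin; case/andP: (fcut_in01 u01 (a / d%:R + x)).
have -> : 1%:E = (\int[normal_prob 0 (sigma_Y d)]_x cst 1%E x)%E :> \bar R.
  by rewrite integral_cst//= mul1e probability_setT.
apply: ge0_le_integral => //=.
- by move=> x _; rewrite lee_fin; case/andP: (fcut_in01 u01 (a / d%:R + x)).
- apply/measurable_EFinP; apply: measurableT_comp; [exact: measurable_fcut|exact: measurable_funD].
- by move=> x _; rewrite lee_fin; case/andP: (fcut_in01 u01 (a / d%:R + x)).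
Qed.

Lemma measurable_fkernel u : measurable_fun setT u -> in01 u ->
  measurable_fun setT (fkernel u).
Proof.
move=> mu u01.
suff : measurable_fun setT (EFin \o fkernel u) by move/measurable_EFinP.
rewrite (_ : EFin \o fkernel u = fubini_F (normal_prob 0 (sigma_Y d))
   (fun p : R * R => (fcut u (p.1 / d%:R + p.2))%:E)); last first.
  by apply/funext => a; rewrite /fubini_F /= fkernelE.
apply: measurable_fun_fubini_tonelli_F.
- apply/measurable_EFinP; apply: measurableT_comp; first exact: measurable_fcut.
  apply: measurable_funD; last exact: measurable_snd.
  by apply: measurable_funM => //; exact: measurable_fst.
- by move=> p; rewrite lee_fin; case/andP: (fcut_in01 u01 (p.1 / d%:R + p.2)).
Qed.

(** The factor of the vertex [k] in terms of the field of its parent, before ([glast]) and after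
    ([gint]) averaging over [W k]. It is 1 as soon as the parent is outside the cluster. *)
Definition glast (u : R -> R) k w := if k is i :: s then
  (if abv s w then fcut u (fld s w / d%:R + W k w) else 1) else 1.

Definition gint (u : R -> R) k w := if k is _ :: s then
  (if abv s w then fkernel u (fld s w) else 1) else 1.

Lemma glastE u i s w :
  (if abv (i :: s) w then u (fld (i :: s) w) else 1) = glast u (i :: s) w.
Proof.
rewrite /glast /abv /= /fcut -/(fld s w) -/(abv s w).
by case: (abv s w) => /=; [rewrite andbT|rewrite andbF].
Qed.

Lemma if_in01 (b : bool) (x : R) : 0 <= x <= 1 -> 0 <= (if b then x else 1) <= 1.
Proof. by case: b => // _; rewrite ler01 lexx. Qed.

Lemma prod_in01 (I : eqType) (l : seq I) (F : I -> R) :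
  (forall i, i \in l -> 0 <= F i <= 1) -> 0 <= \prod_(i <- l) F i <= 1.
Proof.
move=> F01; rewrite big_seq; elim/big_ind : _ => [|x y /andP[x0 x1] /andP[y0 y1]|//].
  by rewrite ler01 lexx.
by rewrite mulr_ge0//= mulr_ile1.
Qed.

Lemma prefixz_in01 n w : 0 <= prefixz n w <= 1.
Proof. by apply: prod_in01 => k _; apply: prod_in01 => s _; exact: if_in01. Qed.

Lemma glast_in01 u k w : in01 u -> 0 <= glast u k w <= 1.
Proof.
move=> u01; case: k => [|i s] /=; first by rewrite ler01 lexx.
by apply: if_in01; exact: fcut_in01.
Qed.

Lemma gint_in01 u k w : measurable_fun setT u -> in01 u -> 0 <= gint u k w <= 1.
Proof.
move=> mu u01; case: k => [|i s] /=; first by rewrite ler01 lexx.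
by apply: if_in01; exact: fkernel_in01.
Qed.

Lemma measurable_prod_seq (dT' : measure_display) (Om : measurableType dT')
  (I : eqType) (l : seq I) (F : I -> Om -> R) :
  (forall i, i \in l -> measurable_fun setT (F i)) ->
  measurable_fun setT (fun w => \prod_(i <- l) F i w).
Proof.
elim: l => [|i l ih] mF.
  by under eq_fun do rewrite big_nil; exact: measurable_cst.
under eq_fun do rewrite big_cons.
apply: measurable_funM; first by apply: mF; rewrite mem_head.
by apply: ih => j jl; apply: mF; rewrite inE jl orbT.
Qed.

Lemma measurable_prefixz_peel n k : size k = n.+1 ->
  measurable_fun setT (prefixz n.+1 : T' k -> R).
Proof.
move=> sk; apply: measurable_prod_seq => i _.
apply: measurable_prod_seq => s sg.
have ss := tgen_size sg.
apply: measurable_fun_ifT => //.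
have [] // := @measurable_fld_peel k s.
- by case: (k) sk.
- exact: tgen_vtx sg.
- by rewrite ss sk ltnW.
- by apply/eqP => e; have := ltn_ord i; rewrite -[X in (X < _)%N]ss e sk ltnn.
Qed.

Lemma measurable_tail_peel k i s : size (i :: s) = size k -> vtx d (i :: s) ->
  measurable_fun setT (fld s : T' k -> R) /\
  measurable_fun setT (abv s : T' k -> bool).
Proof.
move=> sk vs; apply: measurable_fld_peel.
- by case: (k) sk.
- exact: vtx_behead vs.
- by rewrite -sk /=.
- by apply/eqP => e; move: sk; rewrite -e /=; apply/eqP; rewrite neq_ltn ltnSn orbT.
Qed.

Lemma measurable_gint_peel u k j : measurable_fun setT u -> in01 u ->
  size j = size k -> vtx d j -> measurable_fun setT (gint u j : T' k -> R).
Proof.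
move=> mu u01; case: j => [|i s] sk vj; first exact: measurable_cst.
have [m1 m2] := measurable_tail_peel sk vj.
apply: measurable_fun_ifT => //.
by apply: measurableT_comp m1; exact: measurable_fkernel.
Qed.

Lemma measurable_glast_peel u k j : measurable_fun setT u -> j != k ->
  size j = size k -> vtx d j -> measurable_fun setT (glast u j : T' k -> R).
Proof.
move=> mu jk; case: j jk => [|i s] jk sk vj; first exact: measurable_cst.
have [m1 m2] := measurable_tail_peel sk vj.
apply: measurable_fun_ifT => //.
apply: measurableT_comp; first exact: measurable_fcut.
apply: measurable_funD; first by apply: measurable_funM.
exact: measurable_peel.
Qed.

(** The vertices in [l1] have been averaged, those in [l2] not yet; the induction on [l2] moves them
    over one at a time. *)
Lemma peel_last u n l1 l2 : measurable_fun setT u -> in01 u ->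
  gen n.+1 = l1 ++ l2 ->
  (\int[P]_w (prefixz n.+1 w * \prod_(k <- l1) gint u k w *
              \prod_(k <- l2) glast u k w)%:E =
   \int[P]_w (prefixz n.+1 w * \prod_(k <- gen n.+1) gint u k w)%:E)%E.
Proof.
move=> mu u01; elim: l2 l1 => [|k l2 ih] l1 gE.
  rewrite cats0 in gE; rewrite gE.
  by apply: eq_integral => w _; rewrite big_nil mulr1.
rewrite -(ih (rcons l1 k)); last by rewrite cat_rcons.
have ing j : j \in l1 ++ k :: l2 -> size j = n.+1 /\ vtx d j.
  by rewrite -gE => jg; split; [exact: tgen_size jg|exact: tgen_vtx jg].
have [sk vk] : size k = n.+1 /\ vtx d k.
  by apply: ing; rewrite mem_cat mem_head orbT.
have : uniq (l1 ++ k :: l2) by rewrite -gE; exact: tgen_uniq.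
rewrite cat_uniq => /and3P[_ _ /= /andP[kl2 _]].
have k0 : k != [::] by case: (k) sk.
case: k k0 ih gE ing sk vk kl2 => // i s k0 ih gE ing sk vk kl2.
pose k := i :: s; rewrite -/k in k0 sk vk kl2 *.
(* Everything except the factor of [k]. It does not see [W k]: earlier generations are shorter
   words, averaged factors use only parents, and the other pending factors of the same generation
   carry other labels. *)
pose A (w : T' k) := prefixz n.+1 w * \prod_(j <- l1) gint u j w *
  \prod_(j <- l2) glast u j w.
have mA : measurable_fun setT A.
  apply: measurable_funM; first apply: measurable_funM.
  - exact: measurable_prefixz_peel.
  - apply: measurable_prod_seq => j jl.
    have [|sj vj] := ing j; first by rewrite mem_cat jl.
    by apply: measurable_gint_peel => //; rewrite sj.
  - apply: measurable_prod_seq => j jl.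
    have [|sj vj] := ing j; first by rewrite mem_cat inE jl !orbT.
    apply: measurable_glast_peel => //; last by rewrite sj.
    by apply/eqP => e; rewrite -e jl in kl2.
have A0 w : 0 <= A w.
  apply: mulr_ge0; first apply: mulr_ge0.
  - by case/andP: (prefixz_in01 n.+1 w).
  - by have /andP[] := @prod_in01 _ l1 (gint u ^~ w) (fun j _ => gint_in01 j w mu u01).
  - by have /andP[] := @prod_in01 _ l2 (glast u ^~ w) (fun j _ => glast_in01 j w u01).
have [ms ma] := @measurable_tail_peel k i s erefl vk.
pose Phi (p : T' k * measurableTypeR R) : \bar R :=
  (A p.1 * (if abv s p.1 then fcut u (fld s p.1 / d%:R + p.2) else 1))%:E.
transitivity (\int[P]_w Phi (w, W k w))%E.
  by apply: eq_integral => w _; rewrite big_cons /Phi /A /=; congr EFin; ring.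
rewrite (@peel _ _ _ P _ (vtx d) W W_meas W_indep k
  (normal_prob 0 (sigma_Y d))) //; last 3 first.
- by move=> B mB; rewrite W_Y.
- apply/measurable_EFinP; apply: measurable_funM.
    by apply: measurableT_comp mA _; exact: measurable_fst.
  apply: measurable_fun_ifT => //.
    by apply: measurableT_comp ma _; exact: measurable_fst.
  apply: measurableT_comp; first exact: measurable_fcut.
  apply: measurable_funD; last exact: measurable_snd.
  apply: measurable_funM => //.
  by apply: measurableT_comp ms _; exact: measurable_fst.
- move=> p; rewrite lee_fin mulr_ge0//.
  by have /andP[] := if_in01 (abv s p.1) (fcut_in01 u01 (fld s p.1 / d%:R + p.2)).
apply: eq_integral => w _; rewrite /Phi /=.
under eq_integral do rewrite EFinM.
rewrite ge0_integralZl //=; last 3 first.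
- apply/measurable_EFinP; case: (abv s w) => //.
  apply: measurableT_comp; first exact: measurable_fcut.
  exact: measurable_funD.
- move=> x _; rewrite lee_fin.
  by have /andP[] := if_in01 (abv s w) (fcut_in01 u01 (fld s w / d%:R + x)).
- by rewrite lee_fin.
rewrite big_rcons /= /A; set g := gint u (i :: s) w.
have -> : (\int[normal_prob 0 (sigma_Y d)]_y
   (if abv s w then fcut u (fld s w / d%:R + y) else 1)%:E = g%:E)%E.
  rewrite /g /=; case: (abv s w); first by rewrite fkernelE.
  by rewrite integral_cst//= mul1e probability_setT.
by rewrite -EFinM -[if _ then _ else _]/g; congr EFin; ring.
Qed.

(** After averaging, all children of a vertex give the same factor, so their product is a power
    whose exponent is the number of children; the [z] counting the vertex itself is absorbed into
    the new [u]. *)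
Lemma gprod_step n u : measurable_fun setT u -> in01 u ->
  (\int[P]_w (gprod n.+1 u w)%:E = \int[P]_w (gprod n (fun a =>
     (z * fkernel u a ^+ (if n is 0 then size rc else d))%R) w)%:E)%E.
Proof.
move=> mu u01; transitivity
    (\int[P]_w (prefixz n.+1 w * \prod_(k <- gen n.+1) gint u k w)%:E)%E.
  rewrite -(@peel_last u n [::] (gen n.+1))//; apply: eq_integral => w _.
  congr EFin; rewrite /gprod big_nil mulr1; congr (_ * _).
  apply: eq_big_seq => k /tgen_size; case: k => // i s _; exact: glastE.
apply: eq_integral => w _; congr EFin.
rewrite /gprod /prefixz big_ord_recr /= -mulrA; congr (_ * _).
rewrite big_allpairs_dep /= -big_split; apply: eq_big_seq => s sg /=.
rewrite -(size_tchildren sg) big_const_seq count_predT.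
case: (abv s w); last first.
  by rewrite mul1r; elim: (size _) => //= m ->; rewrite mul1r.
by congr (_ * _); elim: (size _) => [|m /= ->]; rewrite ?expr0 // exprS.
Qed.

(** [E z^N] for a cluster vertex of given field together with its descendants up to [n] generations,
    when every vertex has [d] children. *)
Fixpoint fiter n : R -> R :=
  if n is m.+1 then (fun a => z * fkernel (fiter m) a ^+ d) else cst z.

Lemma fiter_measurable_in01 n : measurable_fun setT (fiter n) /\ in01 (fiter n).
Proof.
elim: n => [|n [mn n01]] /=; first by split=> [|x] /=.
split; first by apply: measurable_funM => //; apply: measurable_funX; exact: measurable_fkernel.
move=> x; have /andP[k0 k1] := fkernel_in01 mn n01 x.
case/andP: z01 => z0 z1.
by rewrite mulr_ge0 ?exprn_ge0//= mulr_ile1 ?exprn_ge0 ?exprn_ile1.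
Qed.

Definition vcount n w := (\sum_(k < n.+1) \sum_(s <- gen k) abv s w)%N.

Lemma expz_vcount n w : z ^+ vcount n w = gprod n (cst z) w.
Proof.
rewrite /vcount expr_sum big_ord_recr /=; congr (_ * _).
  apply: eq_bigr => k _; rewrite expr_sum; apply: eq_bigr => s _.
  by case: (abv s w).
by rewrite expr_sum; apply: eq_bigr => s _; case: (abv s w).
Qed.

Lemma expectation_vcount n :
  (\int[P]_w (z ^+ vcount n.+1 w)%:E = \int[P]_w
     (if h <= root w then z * fkernel (fiter n) (root w) ^+ size rc else 1)%:E)%E.
Proof.
under eq_integral do rewrite expz_vcount.
have [m0 i0] := fiter_measurable_in01 0.
transitivity (\int[P]_w (gprod 1 (fiter n) w)%:E)%E; last first.
  have [mn i_n] := fiter_measurable_in01 n.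
  rewrite gprod_step //; apply: eq_integral => w _; congr EFin.
  by rewrite /gprod /prefixz big_ord0 mul1r big_seq1.
(* One generation fewer is traded for one more iteration of [fiter], until only the children of the
   root are left; their number is [size rc] instead of [d]. *)
suff : forall m k, (\int[P]_w (gprod m.+1 (fiter k) w)%:E =
                    \int[P]_w (gprod 1 (fiter (m + k)) w)%:E)%E.
  by move=> /(_ n 0%N); rewrite addn0.
elim=> [//|m ih] k.
have [mk ik] := fiter_measurable_in01 k.
rewrite (gprod_step _ mk ik) addSnnS; exact: (ih k.+1).
Qed.

End generations.

(** * Tails and generating functions *)

Lemma cvgr_sum {R : realType} {T I : Type} {F : set_system T} {FF : Filter F}
  (r : seq I) (f : I -> T -> R) (l : I -> R) :
  (forall i, f i x @[x --> F] --> l i) ->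
  \sum_(i <- r) f i x @[x --> F] --> \sum_(i <- r) l i.
Proof.
move=> fl; elim: r => [|i r ih].
  rewrite big_nil; under eq_fun do rewrite big_nil; exact: cvg_cst.
by rewrite big_cons; under eq_fun do rewrite big_cons; exact: cvgD.
Qed.

Section tail_series.
Context {R : realType} {dT : measure_display} {Omega : measurableType dT}.
Variables (P : probability Omega R) (N : nat -> Omega -> nat) (B : nat -> nat).
Hypothesis mN : forall n t, measurable [set w | (t < N n w)%N].
Hypothesis ndN : forall n w, (N n w <= N n.+1 w)%N.
Hypothesis bN : forall n w, (N n w <= B n)%N.

Definition tail_at n t : R := fine (P [set w | (t < N n w)%N]).
(** The tail of the limit of the nondecreasing counts, which may be infinite. *)
Definition tail t : R := fine (P (\bigcup_n [set w | (t < N n w)%N])).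

Lemma mtail t : measurable (\bigcup_n [set w | (t < N n w)%N]).
Proof. by apply: bigcup_measurable. Qed.

Lemma fine_P_le (A C : set Omega) : measurable A -> measurable C -> A `<=` C ->
  fine (P A) <= fine (P C).
Proof.
move=> mA mC AC; apply: fine_le; try exact: fin_num_measure.
by apply: le_measure; rewrite ?inE.
Qed.

Lemma tail_at_le n t : tail_at n t <= tail t.
Proof. by apply: fine_P_le => // [|w tw]; [exact: mtail|exists n]. Qed.

Lemma tail_ge0 t : 0 <= tail t.
Proof. exact: fine_ge0. Qed.

Lemma tail_le1 t : tail t <= 1.
Proof.
rewrite -lee_fin fineK; last exact: (fin_num_measure P _ (mtail t)).
exact: (probability_le1 P (mtail t)).
Qed.

Lemma tail_noninc t t' : (t <= t')%N -> tail t' <= tail t.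
Proof.
move=> tt'; apply: fine_P_le; [exact: mtail|exact: mtail|].
by move=> w [n _ /= h]; exists n => //=; exact: leq_ltn_trans h.
Qed.

Lemma tail_at_cvg t : tail_at n t @[n --> \oo] --> tail t.
Proof.
apply: fine_cvg; rewrite fineK; last exact: (fin_num_measure P _ (mtail t)).
apply: nondecreasing_cvg_mu => //; first exact: mtail.
apply/nondecreasing_seqP => n; rewrite subsetEset => w /= h.
exact: leq_trans h (ndN n w).
Qed.

Variable z : R.
Hypothesis z01 : 0 <= z < 1.

Definition pgf n : R := fine (\int[P]_w (z ^+ N n w)%:E)%E.

(** The geometric sum [1 - z^N = (1 - z) (1 + ... + z^(N-1))], extended by indicators to a
    deterministic number of terms so that it can be integrated termwise. *)
Lemma expz_sum n w : z ^+ N n w +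
  \sum_(t < B n) (1 - z) * z ^+ t * \1_[set w | (t < N n w)%N] w = 1.
Proof.
have -> : \sum_(t < B n) (1 - z) * z ^+ t * \1_[set w | (t < N n w)%N] w =
          (1 - z) * \sum_(t < N n w) z ^+ t.
  rewrite mulr_sumr (big_ord_widen _ (fun t => (1 - z) * z ^+ t) (bN n w)).
  rewrite [RHS]big_mkcond /=.
  apply: eq_bigr => t _; rewrite indicE.
  case: ifPn => [h|h]; first by rewrite mem_set ?mulr1.
  by rewrite memNset ?mulr0//; apply/negP.
by rewrite -[1 - z]opprB mulNr -subrX1; ring.
Qed.

Lemma measurable_expz n : measurable_fun setT (fun w => z ^+ N n w).
Proof.
rewrite (_ : (fun w => z ^+ N n w) = fun w => 1 -
  \sum_(t < B n) (1 - z) * z ^+ t * \1_[set w | (t < N n w)%N] w); last first.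
  by apply/funext => w; rewrite -[X in X - _](expz_sum n w) addrK.
apply: measurable_funB => //.
by apply: measurable_sum => t; apply: measurable_funM.
Qed.

Lemma pgf_fin_num n : (\int[P]_w (z ^+ N n w)%:E)%E \is a fin_num.
Proof.
case/andP: z01 => z0 z1.
rewrite ge0_fin_numE; last by apply: integral_ge0 => w _; rewrite lee_fin exprn_ge0.
apply: (@le_lt_trans _ _ (\int[P]_x cst 1%E x)%E); last first.
  by rewrite integral_cst//= mul1e probability_setT ltry.
apply: ge0_le_integral => //=.
- by move=> w _; rewrite lee_fin exprn_ge0.
- by apply/measurable_EFinP; exact: measurable_expz.
- by move=> w _; rewrite lee_fin exprn_ile1// ltW.
Qed.

Lemma pgf_sum n : (1 - z) * \sum_(t < B n) tail_at n t * z ^+ t = 1 - pgf n.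
Proof.
case/andP: (z01) => z0 z1; have z1' : 0 <= 1 - z by rewrite subr_ge0 ltW.
have c0 t : 0 <= (1 - z) * z ^+ t by rewrite mulr_ge0 ?exprn_ge0.
have mi (t : 'I_(B n)) : measurable_fun setT (fun w => ((1 - z) * z ^+ t *
    \1_[set w | (t < N n w)%N] w)%:E).
  apply/measurable_EFinP; apply: measurable_funM => //; exact: measurable_indic.
suff : (1%:E = (pgf n + (1 - z) * \sum_(t < B n) tail_at n t * z ^+ t)%:E)%E.
  by move=> [e]; lra.
have -> : 1%:E = (\int[P]_w (z ^+ N n w +
    \sum_(t < B n) (1 - z) * z ^+ t * \1_[set w | (t < N n w)%N] w)%:E)%E.
  under eq_integral do rewrite expz_sum.
  by rewrite integral_cst//= mul1e probability_setT.
under eq_integral do rewrite EFinD.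
rewrite ge0_integralD //; last 4 first.
- by move=> w _; rewrite lee_fin exprn_ge0.
- by apply/measurable_EFinP; exact: measurable_expz.
- by move=> w _; rewrite lee_fin sumr_ge0// => t _; rewrite mulr_ge0.
- under eq_fun do rewrite -sumEFin; exact: emeasurable_sum.
rewrite EFinD /pgf fineK ?pgf_fin_num //; congr (_ + _)%E.
under eq_integral do rewrite -sumEFin.
rewrite ge0_integral_sum //; last by move=> t w _; rewrite lee_fin mulr_ge0.
rewrite mulr_sumr -sumEFin; apply: eq_bigr => t _.
under eq_integral do rewrite EFinM.
rewrite ge0_integralZl //; last 2 first.
- by apply/measurable_EFinP; exact: measurable_indic.
- by rewrite lee_fin.
rewrite integral_indic// setIT /tail_at.
rewrite -[X in (_ * X)%E](@fineK _ (P _)); last exact: fin_num_measure.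
by rewrite -EFinM; congr EFin; ring.
Qed.

Lemma tail_at_eq0 n t : (B n <= t)%N -> tail_at n t = 0.
Proof.
move=> Bt; rewrite /tail_at (_ : [set _ | _] = set0) ?measure0//.
apply/seteqP; split=> // w /= tN.
by have := leq_trans tN (leq_trans (bN n w) Bt); rewrite ltnn.
Qed.

Lemma tail_at_sum_le n M : (1 - z) * \sum_(t < M) tail_at n t * z ^+ t <= 1 - pgf n.
Proof.
case/andP: (z01) => z0 z1; have z1' : 0 <= 1 - z by rewrite subr_ge0 ltW.
rewrite -pgf_sum ler_wpM2l//.
apply: (@le_trans _ _ (\sum_(t < maxn M (B n)) tail_at n t * z ^+ t)).
  rewrite (big_ord_widen _ (fun t => tail_at n t * z ^+ t) (leq_maxl M (B n))).
  rewrite big_mkcond /=; apply: ler_sum => t _; case: ifP => // _.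
  by rewrite mulr_ge0 ?exprn_ge0//; exact: fine_ge0.
rewrite [leRHS](big_ord_widen _ (fun t => tail_at n t * z ^+ t) (leq_maxr M (B n))).
rewrite [leRHS]big_mkcond /=; apply: ler_sum => t _; case: ifPn => // h.
by rewrite tail_at_eq0 ?mul0r// leqNgt.
Qed.

(** Two limits are exchanged by monotonicity. For fixed [M] the first [M] terms converge as [n]
    grows, which bounds every partial sum; conversely each finite [n] gives at most the full series
    because [tail_at n t <= tail t]. *)
Lemma tail_series_cvg (v : R) : pgf n @[n --> \oo] --> 1 - v ->
  series (fun t => tail t * z ^+ t) @ \oo --> v / (1 - z).
Proof.
move=> pv; case/andP: (z01) => z0 z1; have z1' : 0 < 1 - z by rewrite subr_gt0.
pose u := series (fun t => tail t * z ^+ t).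
have uE M : u M = \sum_(t < M) tail t * z ^+ t by rewrite /u /series /= big_mkord.
have qv : 1 - pgf n @[n --> \oo] --> v.
  rewrite (_ : v = 1 - (1 - v)); last by ring.
  by apply: cvgB => //; exact: cvg_cst.
have ub M : u M <= v / (1 - z).
  rewrite ler_pdivlMr// mulrC uE.
  apply: (@ler_cvg_to _ _ _ _ (fun n => (1 - z) * \sum_(t < M) tail_at n t * z ^+ t) _ _ _ _ qv).
    apply: cvgM; first exact: cvg_cst.
    apply: cvgr_sum => t; apply: cvgM; [exact: tail_at_cvg|exact: cvg_cst].
  by apply: nearW => n; exact: tail_at_sum_le.
have nd : nondecreasing_seq u.
  apply/nondecreasing_seqP => M; rewrite !uE big_ord_recr /= lerDl.
  by rewrite mulr_ge0 ?tail_ge0 ?exprn_ge0.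
have cu : cvgn u.
  apply: nondecreasing_is_cvgn => //; exists (v / (1 - z)) => _ [M _ <-]; exact: ub.
suff <- : limn u = v / (1 - z) by [].
apply/eqP; rewrite eq_le; apply/andP; split.
  by apply: limr_le => //; exact: nearW.
rewrite ler_pdivrMr// mulrC.
apply: (@ler_cvg_to _ _ _ _ _ _ _ _ qv (cvg_cst _)).
apply: nearW => n; rewrite -pgf_sum ler_wpM2l ?(ltW z1')//.
apply: (@le_trans _ _ (u (B n))); last exact: nondecreasing_cvgn_le.
rewrite uE; apply: ler_sum => t _; rewrite ler_wpM2r ?exprn_ge0//.
exact: tail_at_le.
Qed.

End tail_series.

(** * Cluster sizes *)

Section vcard_count.
Context {R : realType}.
Variables (rc : seq nat) (d : nat) (rc_uniq : uniq rc) (ab : pred (seq nat)).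
Local Notation gen n := (tgen rc d n).

Definition tcount n := (\sum_(k < n.+1) \sum_(s <- gen k) ab s)%N.

Definition tlist n := [seq s <- flatten [seq gen k | k <- iota 0 n.+1] | ab s].

Lemma mem_tlist n s : (s \in tlist n) = [&& ab s, (size s <= n)%N & s \in gen (size s)].
Proof.
rewrite mem_filter; congr (_ && _); apply/flatten_mapP/andP => [[k]|[sn sg]].
  by rewrite mem_iota add0n ltnS /= => kn sk; rewrite (tgen_size sk).
by exists (size s) => //; rewrite mem_iota /= add0n ltnS.
Qed.

Lemma uniq_tlist n : uniq (tlist n).
Proof.
apply: filter_uniq; elim: n.+1 0%N => [//|m ih] j /=.
rewrite cat_uniq tgen_uniq//= ih andbT; apply/hasPn => s.
move=> /flatten_mapP[k]; rewrite mem_iota => /andP[jk _] sk.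
apply/negP => /tgen_size sj; have := tgen_size sk; rewrite sj => jk'.
by rewrite jk' ltnn in jk.
Qed.

Lemma size_tlist n : size (tlist n) = tcount n.
Proof.
rewrite /tlist /tcount size_filter count_flatten -map_comp sumnE big_map.
rewrite -[RHS](big_mkord xpredT (fun k => \sum_(s <- gen k) ab s)%N).
rewrite /index_iota subn0; apply: eq_bigr => k _ /=.
by rewrite -sumn_count sumnE big_map; apply: eq_bigr.
Qed.

Lemma tcount_leS n : (tcount n <= tcount n.+1)%N.
Proof. by rewrite /tcount [leqRHS]big_ord_recr /= leq_addr. Qed.

Lemma tcount_le n : (tcount n <= \sum_(k < n.+1) size (gen k))%N.
Proof.
apply: leq_sum => k _; rewrite -sum1_size; apply: leq_sum => s _.
by case: (ab s).
Qed.

Definition tvertices : set (seq nat) := [set s | s \in gen (size s) /\ ab s].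

Lemma vcard_gtP (t : R) :
  (t%:E < vcard (R := R) tvertices)%E <-> exists n, t < (tcount n)%:R.
Proof.
have sum1 (l : seq (seq nat)) : (\sum_(x <- l) 1%:E = (size l)%:R%:E :> \bar R)%E.
  by rewrite big_const_seq count_predT; elim: (size l) => //= m ->; rewrite -natr1 addrC.
split.
- rewrite /vcard /esum => /ereal_sup_gt[_ [X [fX XA] <-]].
  have [l ul XE] : exists2 l : seq (seq nat), uniq l & X = [set` l].
    move/finite_seqP : fX => [l ->]; exists (undup l); first exact: undup_uniq.
    by apply/seteqP; split=> s /=; rewrite mem_undup.
  rewrite XE -fsbig_seq // sum1 lte_fin => tl.
  (* [esum] is a supremum over finite sets, and a finite set of cluster vertices lies within the
     generations up to its deepest element. *)
  exists (\max_(s <- l) size s)%N; apply: lt_le_trans tl _.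
  rewrite ler_nat -size_tlist; apply: uniq_leq_size => // s sl.
  have [|sg ss] := XA s; first by rewrite XE.
  by rewrite mem_tlist ss sg andbT /=; exact: leq_bigmax_seq.
- move=> [n tn]; apply: (@lt_le_trans _ _ (tcount n)%:R%:E); first by rewrite lte_fin.
  apply: esum_ge; exists [set` tlist n].
    split; first exact: finite_seq.
    by move=> s /=; rewrite mem_tlist => /and3P[].
  by rewrite -fsbig_seq ?uniq_tlist// sum1 size_tlist.
Qed.

Lemma vcard_tail (t : R) (n : nat) : n%:R <= t < n.+1%:R ->
  (t%:E < vcard (R := R) tvertices)%E <-> exists m, (n < tcount m)%N.
Proof.
move=> /andP[nt tn]; rewrite vcard_gtP; split => -[m h]; exists m.
  by rewrite -(@ltr_nat R); exact: le_lt_trans h.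
by apply: lt_le_trans tn _; rewrite ler_nat.
Qed.

Lemma vcard_infP :
  (vcard (R := R) tvertices = +oo)%E <-> forall n, exists m, (n < tcount m)%N.
Proof.
split=> [voo n|h].
  apply/(@vcard_tail n%:R); first by rewrite lexx ltr_nat ltnSn.
  by rewrite voo ltry.
apply/eqP; rewrite eq_le leey /= leNgt; apply/negP => vlt.
have v0 : (0%:E <= vcard (R := R) tvertices)%E by apply: esum_ge0.
have vf : vcard (R := R) tvertices \is a fin_num by rewrite ge0_fin_numE.
pose v := fine (vcard (R := R) tvertices).
have v0' : 0 <= v by apply: fine_ge0.
have [m tm] := h (Num.trunc v).
suff : (v%:E < vcard (R := R) tvertices)%E by rewrite /v fineK// ltxx.
by apply/(@vcard_tail v (Num.trunc v)); [exact: truncn_itv|exists m].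
Qed.

End vcard_count.

Lemma all_iota0 d : all (fun i => i < d.+1)%N (iota 0 d.+1).
Proof. by apply/allP => i; rewrite -[X in _ \in X]/(iota 0 d.+1) mem_iota add0n. Qed.

Lemma all_iota1 d : all (fun i => i < d.+1)%N (iota 1 d).
Proof. by apply/allP => i; rewrite mem_iota add1n => /andP[]. Qed.

Section clusters.
Context {R : realType}.
Variables (d : nat) (h r : R) (V : seq nat -> R).

Lemma tcluster_tvertices :
  tcluster d h r V = tvertices (iota 0 d.+1) d (path_above d h r V).
Proof.
apply/seteqP; split => s /= [vs ps]; split => //.
  apply: mem_tgen => //; apply/orP; case: s vs {ps} => [|i s vs]; [by left|right].
  have -> : (last 0%N (i :: s) \in iota 0 d.+1) = (last i s < d.+1)%N.
    by rewrite mem_iota add0n.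
  by elim: s i vs => [//|j s ih] i /vtx_behead /ih.
by apply: tgen_vtx vs; exact: all_iota0.
Qed.

Lemma last_tgen rc n s : s \in tgen rc d n -> s != [::] -> last 0%N s \in rc.
Proof.
elim: n s => [|n ih] s /=; first by rewrite inE => ->.
move=> /allpairsPdep[t [i [tn it ->]]] _; case: t tn it => [//|j t tn _] /=.
exact: (ih (j :: t)).
Qed.

Lemma tcluster_Tplus_tvertices :
  tcluster d h r V `&` Tplus = tvertices (iota 1 d) d (path_above d h r V).
Proof.
rewrite tcluster_tvertices; apply/seteqP; split => s.
  move=> [[sg ps] ls]; split => //; apply: mem_tgen.
    by apply: tgen_vtx sg; exact: all_iota0.
  have := last_tgen sg; case: s ls {sg ps} => [//|i s] /=.
  rewrite /Tplus /= => l0 /(_ isT).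
  rewrite -[X in _ \in X -> _]/(iota 0 d.+1) !mem_iota add0n add1n => /andP[_ ->].
  by rewrite lt0n l0.
move=> [sg ps]; have ls := last_tgen sg; split.
  split=> //; apply: mem_tgen.
    by apply: tgen_vtx sg; exact: all_iota1.
  case: s ls {sg ps} => [//|i s] /= /(_ isT).
  by rewrite -[X in _ -> _ \in X]/(iota 0 d.+1) !mem_iota add1n add0n => /andP[_ ->].
case: s ls {sg ps} => [//|i s] /= /(_ isT).
by rewrite /Tplus /= mem_iota lt0n => /andP[].
Qed.

End clusters.

(** * The Gaussian kernel *)

Section gaussian.
Context {R : realType} (d : nat).
Hypothesis hd : (2 <= d)%N.
Local Notation mu := (@lebesgue_measure R).
Local Notation rY := (@rho_Y R d).
Local Notation rN := (@rho_nu R d).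
Local Notation sY := (@sigma_Y R d).
Local Notation sN := (@sigma_nu R d).

Lemma d_ge2 : 2 <= d%:R :> R. Proof. by rewrite ler_nat. Qed.
Lemma d_gt0 : 0 < d%:R :> R. Proof. by rewrite ltr0n; exact: leq_trans hd. Qed.

(** [qY] and [qN] are the exponents [1 / (2 sigma^2)] of the step law and of [nu]. *)
Definition qY : R := d%:R / (2 * (d%:R + 1)).
Definition qN : R := (d%:R - 1) / (2 * d%:R).

Lemma qY_gt0 : 0 < qY.
Proof. have := d_gt0 => d0; rewrite /qY divr_gt0// mulr_gt0//; lra. Qed.

Lemma sigma_Y2 : sY ^+ 2 = (d%:R + 1) / d%:R.
Proof. have := d_gt0 => d0; rewrite /sigma_Y sqr_sqrtr// divr_ge0//; lra. Qed.

Lemma sigma_nu2 : sN ^+ 2 = d%:R / (d%:R - 1).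
Proof. have := d_ge2 => d0; rewrite /sigma_nu sqr_sqrtr// divr_ge0//; lra. Qed.

Lemma sigma_Y_neq0 : sY != 0.
Proof.
have := d_gt0 => d0; rewrite gt_eqF// /sigma_Y sqrtr_gt0 divr_gt0//; lra.
Qed.

Lemma sigma_nu_neq0 : sN != 0.
Proof.
have := d_ge2 => d0; rewrite gt_eqF// /sigma_nu sqrtr_gt0 divr_gt0//; lra.
Qed.

Local Notation pY := (normal_peak sY).
Local Notation pN := (normal_peak sN).

Lemma rho_YE x : rY x = pY * expR (- (qY * x ^+ 2)).
Proof.
rewrite /rho_Y normal_pdfE ?sigma_Y_neq0// /normal_fun subr0 sigma_Y2 /qY.
have := d_gt0 => d0; congr (_ * expR _); rewrite -mulr_natr; field; lra.
Qed.

Lemma rho_nuE x : rN x = pN * expR (- (qN * x ^+ 2)).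
Proof.
rewrite /rho_nu normal_pdfE ?sigma_nu_neq0// /normal_fun subr0 sigma_nu2 /qN.
have := d_ge2 => d0; congr (_ * expR _); rewrite -mulr_natr; field.
by apply/andP; split; lra.
Qed.

Lemma pY_gt0 : 0 < pY. Proof. exact/normal_peak_gt0/sigma_Y_neq0. Qed.
Lemma pN_gt0 : 0 < pN. Proof. exact/normal_peak_gt0/sigma_nu_neq0. Qed.

Lemma rho_Y_gt0 x : 0 < rY x.
Proof. by rewrite rho_YE mulr_gt0 ?pY_gt0 ?expR_gt0. Qed.
Lemma rho_nu_gt0 x : 0 < rN x.
Proof. by rewrite rho_nuE mulr_gt0 ?pN_gt0 ?expR_gt0. Qed.
Lemma rho_Y_ge0 x : 0 <= rY x. Proof. exact/ltW/rho_Y_gt0. Qed.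
Lemma rho_nu_ge0 x : 0 <= rN x. Proof. exact/ltW/rho_nu_gt0. Qed.

Lemma rho_Y_le x : rY x <= pY.
Proof. exact/normal_pdf_ub/sigma_Y_neq0. Qed.
Lemma rho_nu_le x : rN x <= pN.
Proof. exact/normal_pdf_ub/sigma_nu_neq0. Qed.

Lemma measurable_rho_Y : measurable_fun setT rY.
Proof. exact: measurable_normal_pdf. Qed.
Lemma measurable_rho_nu : measurable_fun setT rN.
Proof. exact: measurable_normal_pdf. Qed.

Lemma measurable_rho_Y_shift (b : R) : measurable_fun setT (fun x : R => rY (x - b)).
Proof. by apply: measurableT_comp; [exact: measurable_rho_Y|exact: measurable_funB]. Qed.

(* the Gaussian kernel is reversible with respect to [nu] *)
Lemma rho_sym a x : rN a * rY (x - a / d%:R) = rN x * rY (a - x / d%:R).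
Proof.
rewrite !rho_YE !rho_nuE mulrACA [RHS]mulrACA -!expRD; congr (_ * expR _).
have := d_gt0 => d0; rewrite /qY /qN; field.
by apply/andP; split; lra.
Qed.

Lemma rho_Y_compare u v M : v ^+ 2 - u ^+ 2 <= M -> rY u <= expR (qY * M) * rY v.
Proof.
move=> h; rewrite !rho_YE [leRHS]mulrCA ler_wpM2l ?(ltW pY_gt0)// -expRD ler_expR.
by have := ler_wpM2l (ltW qY_gt0) h; lra.
Qed.

Lemma rho_Y_lower u M : u ^+ 2 <= M -> pY * expR (- (qY * M)) <= rY u.
Proof.
move=> h; rewrite rho_YE ler_wpM2l ?(ltW pY_gt0)// ler_expR lerN2.
by rewrite ler_wpM2l ?(ltW qY_gt0).
Qed.

(** Completing the square: an exponential tilt translates the mean. *)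
Lemma expR_normal_pdf (m s k x : R) : s != 0 ->
  expR (k * x) * normal_pdf m s x =
  expR (k * m + k ^+ 2 * s ^+ 2 / 2) * normal_pdf (m + k * s ^+ 2) s x.
Proof.
move=> s0; rewrite !normal_pdfE// /normal_fun mulrCA [RHS]mulrCA -!expRD.
by congr (_ * expR _); rewrite -[s ^+ 2 *+ 2]mulr_natr; field.
Qed.

Lemma rho_Y_shiftE b x : rY (x - b) = normal_pdf b sY x.
Proof.
by rewrite /rho_Y !normal_pdfE ?sigma_Y_neq0// /normal_fun subr0.
Qed.

Definition vexp (k x : R) := expR (k * x).

Lemma integral_vexp_rho_Y k b :
  (\int[mu]_x (vexp k x * rY (x - b))%:E =
   (expR (k * b + k ^+ 2 * sY ^+ 2 / 2))%:E)%E.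
Proof.
under eq_integral do rewrite rho_Y_shiftE expR_normal_pdf ?sigma_Y_neq0// EFinM.
rewrite ge0_integralZl//; last 2 first.
- by apply/measurable_EFinP; exact: measurable_normal_pdf.
- by move=> x _; rewrite lee_fin normal_pdf_ge0.
by rewrite integral_normal_pdf mule1.
Qed.

Lemma integral_vexp_rho_nu k :
  (\int[mu]_x (vexp k x * rN x)%:E = (expR (k ^+ 2 * sN ^+ 2 / 2))%:E)%E.
Proof.
under eq_integral do rewrite expR_normal_pdf ?sigma_nu_neq0// EFinM mulr0 !add0r.
rewrite ge0_integralZl//; last 2 first.
- by apply/measurable_EFinP; exact: measurable_normal_pdf.
- by move=> x _; rewrite lee_fin normal_pdf_ge0.
by rewrite integral_normal_pdf mule1.
Qed.

Lemma measurable_vexp k : measurable_fun setT (vexp k).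
Proof. by apply: measurableT_comp => //; exact: measurable_funM. Qed.

Lemma ge0_integrable (D : set R) (f : R -> R) : measurable D -> measurable_fun D f ->
  (forall x, D x -> 0 <= f x) -> (\int[mu]_(x in D) (f x)%:E < +oo)%E ->
  mu.-integrable D (EFin \o f).
Proof.
move=> mD mf f0 foo; apply/integrableP; split; first exact/measurable_EFinP.
rewrite (le_lt_trans _ foo)// ge0_le_integral//=.
- by apply/measurable_EFinP; exact: measurableT_comp.
- exact/measurable_EFinP.
- by move=> x Dx; rewrite lee_fin ger0_norm ?f0.
Qed.

Lemma integrable_vexp_rho_nu k : mu.-integrable setT (fun x => (vexp k x * rN x)%:E).
Proof.
apply: ge0_integrable => //.
- by apply: measurable_funM; [exact: measurable_vexp|exact: measurable_rho_nu].
- by move=> x _; rewrite mulr_ge0 ?expR_ge0 ?rho_nu_ge0.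
- by rewrite integral_vexp_rho_nu ltry.
Qed.

Lemma integrable_vexp_rho_Y k b : mu.-integrable setT (fun x => (vexp k x * rY (x - b))%:E).
Proof.
apply: ge0_integrable => //.
- by apply: measurable_funM; [exact: measurable_vexp|exact: measurable_rho_Y_shift].
- by move=> x _; rewrite mulr_ge0 ?expR_ge0 ?rho_Y_ge0.
- by rewrite integral_vexp_rho_Y ltry.
Qed.

(** Tonelli and the reversibility [rho_sym]. The identity is between extended-real integrals of
    nonnegative functions, so that integrability of one side can be deduced from the other. *)
Lemma Lop_sym h (f g : R -> R) : measurable_fun setT f -> measurable_fun setT g ->
  (forall x, h <= x -> 0 <= f x) -> (forall x, h <= x -> 0 <= g x) ->
  (\int[mu]_(a in `[h, +oo[) ((\int[mu]_(x in `[h, +oo[) (f x * rY (x - a / d%:R))%:E) * (g a * rN a)%:E) =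
   \int[mu]_(x in `[h, +oo[) ((\int[mu]_(a in `[h, +oo[) (g a * rY (a - x / d%:R))%:E) * (f x * rN x)%:E))%E.
Proof.
move=> mf mg f0 g0.
pose I : R -> R := \1_(`[h, +oo[).
have mI : measurable_fun setT I by exact: measurable_indic.
have IE (F : R -> R) : measurable_fun setT F ->
    (\int[mu]_(x in `[h, +oo[) (F x)%:E = \int[mu]_x (I x * F x)%:E)%E.
  move=> mF; rewrite integral_mkcond; apply: eq_integral => x _.
  rewrite /patch /I indicE; case: ifP => _; by rewrite ?mul1r ?mul0r.
have I0 x : 0 <= I x by rewrite /I indicE.
have If0 x : 0 <= I x * f x.
  rewrite /I indicE; case: (boolP (x \in _)) => [|_]; last by rewrite mul0r.
  by rewrite inE /= in_itv /= andbT mul1r => /f0.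
have Ig0 x : 0 <= I x * g x.
  rewrite /I indicE; case: (boolP (x \in _)) => [|_]; last by rewrite mul0r.
  by rewrite inE /= in_itv /= andbT mul1r => /g0.
have one (F G : R -> R) : measurable_fun setT F -> measurable_fun setT G ->
  (forall x, 0 <= I x * F x) -> (forall x, 0 <= I x * G x) ->
  (\int[mu]_(a in `[h, +oo[) ((\int[mu]_(x in `[h, +oo[) (F x * rY (x - a / d%:R))%:E) * (G a * rN a)%:E) =
   \int[mu]_a \int[mu]_x ((I a * G a) * (I x * F x) * (rN a * rY (x - a / d%:R)))%:E)%E.
  move=> mF mG F0 G0; rewrite integral_mkcond; apply: eq_integral => a _.
  rewrite /patch; case: ifPn => aI; last first.
    have -> : I a = 0 by rewrite /I indicE (negbTE aI).
    by under eq_integral do rewrite !mul0r; rewrite integral0.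
  rewrite IE; last by apply: measurable_funM => //; exact: measurable_rho_Y_shift.
  have Ia : I a = 1 by rewrite /I indicE aI.
  have Ga0 : 0 <= G a * rN a by have := G0 a; rewrite Ia mul1r => ?; rewrite mulr_ge0 ?rho_nu_ge0.
  rewrite muleC -ge0_integralZl//=; last 2 first.
  - apply/measurable_EFinP; apply: measurable_funM => //.
    by apply: measurable_funM => //; exact: measurable_rho_Y_shift.
  - by move=> x _; rewrite lee_fin mulrA mulr_ge0 ?rho_Y_ge0.
  apply: eq_integral => x _; rewrite Ia -EFinM; congr EFin; ring.
rewrite (one f g mf mg If0 Ig0) (one g f mg mf Ig0 If0).
rewrite (fubini_tonelli (m1 := mu) (m2 := mu)
   (fun p : R * R => (((I p.1 * g p.1) * (I p.2 * f p.2) * (rN p.1 * rY (p.2 - p.1 / d%:R)))%:E))).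
- by apply: eq_integral => x _; apply: eq_integral => a _; rewrite /= rho_sym; congr EFin; ring.
- apply/measurable_EFinP; apply: measurable_funM.
    apply: measurable_funM; apply: measurable_funM;
    (apply: measurableT_comp; [|first [exact: measurable_fst|exact: measurable_snd]]) => //.
  apply: measurable_funM.
    by apply: measurableT_comp; [exact: measurable_rho_nu|exact: measurable_fst].
  apply: measurableT_comp; first exact: measurable_rho_Y.
  apply: measurable_funB; first exact: measurable_snd.
  by apply: measurable_funM => //; exact: measurable_fst.
- by move=> p; rewrite lee_fin; apply: mulr_ge0; apply: mulr_ge0 => //; rewrite ?rho_nu_ge0 ?rho_Y_ge0.
Qed.

Lemma measurable_Lint h (f : R -> R) : measurable_fun setT f ->
  (forall x, h <= x -> 0 <= f x) ->
  measurable_fun setT (fun a : R => \int[mu]_(x in `[h, +oo[) (f x * rY (x - a / d%:R))%:E)%E.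
Proof.
move=> mf f0; pose I : R -> R := \1_(`[h, +oo[).
rewrite (_ : (fun a => _) = fubini_F mu (fun p : R * R => ((I p.2 * f p.2) * rY (p.2 - p.1 / d%:R))%:E)); last first.
  apply/funext => a; rewrite /fubini_F [LHS]integral_mkcond; apply: eq_integral => x _ /=.
  rewrite /patch /I indicE; case: ifP => _; by rewrite ?mul1r ?mul0r.
apply: measurable_fun_fubini_tonelli_F.
- apply/measurable_EFinP; apply: measurable_funM.
    apply: measurable_funM.
      by apply: measurableT_comp; [exact: measurable_indic|exact: measurable_snd].
    by apply: measurableT_comp; [|exact: measurable_snd].
  apply: measurableT_comp; first exact: measurable_rho_Y.
  apply: measurable_funB; first exact: measurable_snd.
  by apply: measurable_funM => //; exact: measurable_fst.
- move=> p; rewrite lee_fin mulr_ge0 ?rho_Y_ge0//.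
  rewrite /I indicE; case: (boolP (_ \in _)) => [|_]; last by rewrite mul0r.
  by rewrite inE /= in_itv /= andbT mul1r => /f0.
Qed.

End gaussian.

(** * Second-order remainder and self-improving bounds *)

Section elementary.
Context {R : realType}.
Implicit Types (y x : R) (n : nat).

Lemma bernoulli_le n y : 0 <= y <= 1 -> 1 - n%:R * y <= (1 - y) ^+ n.
Proof.
move=> /andP[y0 y1]; elim: n => [|n ih]; first by rewrite expr0; lra.
rewrite exprS -natr1; have n0 : 0 <= n%:R :> R by [].
apply: (@le_trans _ _ ((1 - y) * (1 - n%:R * y))); last by rewrite ler_wpM2l//; lra.
have h : 0 <= n%:R * y ^+ 2 by rewrite mulr_ge0 ?sqr_ge0.
by rewrite expr2 in h; lra.
Qed.

(** The gap between [n y] and [1 - (1 - y)^n], of order [y^2]. *)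
Definition rem2 n y := n%:R * y - 1 + (1 - y) ^+ n.

Lemma rem2_ge_sqr n y : (2 <= n)%N -> 0 <= y <= 1 -> y ^+ 2 <= rem2 n y.
Proof.
move=> n2 /andP[y0 y1]; rewrite /rem2.
elim: n n2 => // n ih; rewrite leq_eqVlt => /predU1P[<-|/ih {}ih].
  by rewrite expr2 expr2; lra.
have h : (1 - y) ^+ n <= 1 by rewrite exprn_ile1//; lra.
have : y * (1 - y) ^+ n <= y * 1 by rewrite ler_wpM2l.
rewrite [(1 - y) ^+ n.+1]exprS -natr1; set P := (1 - y) ^+ n in ih *; set N := n%:R in ih *.
by move=> h2; lra.
Qed.

(** Induction on [rem2 n.+1 y = (1 - y) * rem2 n y + n * y ^+ 2]; the factor [1 - y] costs only a
    cubic error, whence the new constant [c + b]. *)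
Lemma rem2_taylor n : exists2 c, 0 <= c & forall y, 0 <= y <= 1 ->
  n%:R * (n%:R - 1) / 2 * y ^+ 2 - c * y ^+ 3 <= rem2 n y
    <= n%:R * (n%:R - 1) / 2 * y ^+ 2.
Proof.
elim: n => [|n [c c0 ih]].
  by exists 0 => // y _; rewrite /rem2 expr0; apply/andP; split; lra.
have b0 : 0 <= n%:R * (n%:R - 1) / 2 :> R.
  rewrite divr_ge0//; case: n {ih} => [|n]; first by rewrite mul0r.
  by rewrite mulr_ge0// -natr1; have : 0 <= n%:R :> R by []; lra.
set b := n%:R * (n%:R - 1) / 2 in ih b0.
exists (c + b); first by rewrite addr_ge0.
move=> y y01; have /andP[y0 y1] := y01; have /andP[l u] := ih y y01.
have -> : n.+1%:R * (n.+1%:R - 1) / 2 = b + n%:R :> R.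
  by rewrite /b -natr1; field.
have y2 : 0 <= y ^+ 2 by exact: sqr_ge0.
have y3 : 0 <= y ^+ 3 by exact: exprn_ge0.
have l' := ler_wpM2l (_ : 0 <= 1 - y) l; have u' := ler_wpM2l (_ : 0 <= 1 - y) u.
have {}l' := l' ltac:(lra); have {}u' := u' ltac:(lra).
have by3 : 0 <= b * y ^+ 3 by exact: mulr_ge0.
have cy4 : 0 <= c * (y * y ^+ 3) by rewrite !mulr_ge0.
rewrite /rem2 in l' u' *; rewrite [(1 - y) ^+ n.+1]exprS -natr1.
set P := (1 - y) ^+ n in l' u' *; set N := n%:R in l' u' *.
have e3 : y ^+ 3 = y * y ^+ 2 by rewrite exprS.
have e2 : y ^+ 2 = y * y by rewrite expr2.
by apply/andP; split; nra.
Qed.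

(** A bound with constant [M] improves to one with [K + th * M]. Iterating from an a priori constant
    [M0] leads to the fixed point [K / (1 - th)], where [M0] no longer appears; this makes later
    bounds scale with the small parameter contained in [K]. *)
Lemma contraction (Q : R -> Prop) (f V : R -> R) (K th M0 : R) :
  0 <= th < 1 -> 0 <= K -> 0 <= M0 -> (forall x, Q x -> 0 <= V x) ->
  (forall M, 0 <= M -> (forall x, Q x -> f x <= M * V x) ->
     forall x, Q x -> f x <= (K + th * M) * V x) ->
  (forall x, Q x -> f x <= M0 * V x) ->
  forall x, Q x -> f x <= K / (1 - th) * V x.
Proof.
move=> /andP[t0 t1] K0 M00 V0 step init x Qx.
have t1' : 0 < 1 - th by rewrite subr_gt0.
have K1 : 0 <= K / (1 - th) by rewrite divr_ge0// ltW.
have h n : forall x, Q x -> f x <= (K / (1 - th) + th ^+ n * M0) * V x.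
  elim: n => [|n ih] {Qx}x Qx.
    by apply: le_trans (init x Qx) _; rewrite ler_wpM2r ?V0// expr0 mul1r lerDr.
  have -> : K / (1 - th) + th ^+ n.+1 * M0 =
      K + th * (K / (1 - th) + th ^+ n * M0).
    by rewrite exprS; field; rewrite gt_eqF.
  by apply: step => //; rewrite addr_ge0// mulr_ge0// exprn_ge0.
apply: (@ler_cvg_to _ \oo _ _ (fun=> f x)
  (fun n => (K / (1 - th) + th ^+ n * M0) * V x)); first exact: cvg_cst.
  apply: cvgMl; rewrite -[X in _ --> X]addr0; apply: cvgD; first exact: cvg_cst.
  rewrite -(mul0r M0); apply: cvgMl; apply: cvg_expr.
  by rewrite ger0_norm.
by apply: nearW => n; exact: h.
Qed.

End elementary.

Section real_integrable.
Context {R : realType}.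
Local Notation mu := (@lebesgue_measure R).
Variable D : set R.
Hypothesis mD : measurable D.
Implicit Types f g : R -> R.

Lemma le_integrableR f g : measurable_fun D f ->
  (forall x, D x -> `|f x| <= g x) ->
  mu.-integrable D (fun x => (g x)%:E) -> mu.-integrable D (fun x => (f x)%:E).
Proof.
move=> mf fg gi; apply: le_integrable gi => //; first exact/measurable_EFinP.
move=> x Dx; rewrite lee_fin; apply: le_trans (fg x Dx) _; exact: ler_norm.
Qed.

Lemma integrableDR f g : mu.-integrable D (fun x => (f x)%:E) ->
  mu.-integrable D (fun x => (g x)%:E) -> mu.-integrable D (fun x => (f x + g x)%:E).
Proof. by move=> fi gi; under eq_fun do rewrite EFinD; exact: integrableD. Qed.

Lemma integrableZR k f : mu.-integrable D (fun x => (f x)%:E) ->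
  mu.-integrable D (fun x => (k * f x)%:E).
Proof. by move=> fi; under eq_fun do rewrite EFinM; exact: integrableZl. Qed.

Lemma eq_integrableR f g : (forall x, D x -> f x = g x) ->
  mu.-integrable D (fun x => (f x)%:E) -> mu.-integrable D (fun x => (g x)%:E).
Proof.
by move=> fg; apply: eq_integrable => // x; rewrite inE => /fg ->.
Qed.

Lemma integrable_normR f : mu.-integrable D (fun x => (f x)%:E) ->
  mu.-integrable D (fun x => `|f x|%:E).
Proof. exact: integrable_abse. Qed.

End real_integrable.

(** * Pairing the operator with a supersolution *)

Section weighted.
Context {R : realType} (d : nat).
Hypothesis hd : (2 <= d)%N.
Local Notation mu := (@lebesgue_measure R).
Local Notation rY := (@rho_Y R d).
Local Notation rN := (@rho_nu R d).
Variables (h : R) (w : R -> R).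
Hypothesis mw : measurable_fun setT w.
Hypothesis w01 : forall x, 0 <= w x <= 1.

Let d0 : 0 < d%:R :> R := d_gt0 hd.
Let w0 x : 0 <= w x. Proof. by case/andP: (w01 x). Qed.
Let w1 x : w x <= 1. Proof. by case/andP: (w01 x). Qed.

Lemma rho_Y_integral_le1 k b :
  (\int[mu]_(x in `[k, +oo[) (1 * rY (x - b))%:E <= 1)%E.
Proof.
have -> : 1%E = (\int[mu]_x (vexp 0 x * rY (x - b))%:E)%E.
  by rewrite integral_vexp_rho_Y// mul0r expr2 !mul0r addr0 expR0.
under eq_integral do rewrite mul1r.
under [leRHS]eq_integral do rewrite /vexp mul0r expR0 mul1r.
apply: ge0_subset_integral => //.
- by apply/measurable_EFinP; exact: measurable_rho_Y_shift.
- by move=> x _; rewrite lee_fin rho_Y_ge0.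
Qed.

Lemma integral_rho_Y_le1 a :
  (0 <= \int[mu]_(x in `[h, +oo[) (w x * rY (x - a / d%:R))%:E <= 1)%E.
Proof.
apply/andP; split; first by apply: integral_ge0 => x _; rewrite lee_fin mulr_ge0 ?rho_Y_ge0.
apply: le_trans (rho_Y_integral_le1 h (a / d%:R)); apply: ge0_le_integral => //.
- by move=> x _; rewrite lee_fin mulr_ge0 ?rho_Y_ge0.
- by apply/measurable_funTS/measurable_EFinP/measurable_funM => //; exact: measurable_rho_Y_shift.
- by apply/measurable_funTS/measurable_EFinP/measurable_funM => //; exact: measurable_rho_Y_shift.
- by move=> x _; rewrite lee_fin ler_wpM2r ?rho_Y_ge0.
Qed.

Lemma integral_rho_Y_fin a :
  (\int[mu]_(x in `[h, +oo[) (w x * rY (x - a / d%:R))%:E)%E \is a fin_num.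
Proof.
have /andP[i0 i1] := integral_rho_Y_le1 a.
by rewrite ge0_fin_numE//; apply: le_lt_trans i1 _; rewrite ltry.
Qed.

Lemma Lop_EFin a : h <= a ->
  (Lop d h w a)%:E = (d%:R%:E * \int[mu]_(x in `[h, +oo[) (w x * rY (x - a / d%:R))%:E)%E.
Proof. by move=> ha; rewrite /Lop ha EFinM /Rintegral fineK// integral_rho_Y_fin. Qed.

Lemma Lop_bounds a : 0 <= Lop d h w a <= d%:R.
Proof.
have [ha|ha] := leP h a; last by rewrite /Lop (lt_geF ha) lexx ltW.
have /andP[i0 i1] := integral_rho_Y_le1 a.
rewrite -!lee_fin Lop_EFin// mule_ge0//= ?lee_fin ?(ltW d0)//.
by rewrite -[leRHS]mule1; apply: lee_wpmul2l => //; rewrite lee_fin ltW.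
Qed.

Lemma measurable_Lop : measurable_fun setT (Lop d h w).
Proof.
apply: measurable_fun_ifT => //; first exact: measurable_fun_ler.
apply: measurable_funM => //; apply: measurableT_comp => //.
exact: measurable_Lint.
Qed.

Variables (g : R -> R) (k : R).
Hypothesis mg : measurable_fun setT g.
Hypothesis g0 : forall x, 0 <= g x.
Hypothesis gi : mu.-integrable `[h, +oo[ (fun x => (g x * rN x)%:E).
Hypothesis gk : forall x, h <= x ->
  (\int[mu]_(a in `[h, +oo[) (g a * rY (a - x / d%:R))%:E <= (k * g x)%:E)%E.

Let gN0 x : 0 <= g x * rN x. Proof. by rewrite mulr_ge0 ?rho_nu_ge0. Qed.
Let mgN : measurable_fun setT (fun x => g x * rN x).
Proof. by apply: measurable_funM => //; exact: measurable_rho_nu. Qed.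

Lemma integrable_weighted : mu.-integrable `[h, +oo[ (fun x => (w x * (g x * rN x))%:E).
Proof.
apply: le_integrableR gi => //; first exact/measurable_funTS/measurable_funM.
by move=> x _; rewrite (ger0_norm (mulr_ge0 (w0 x) (gN0 x))) ler_piMl.
Qed.

Lemma integrable_Lop_weighted :
  mu.-integrable `[h, +oo[ (fun x => (Lop d h w x * (g x * rN x))%:E).
Proof.
have di : mu.-integrable `[h, +oo[ (fun x => (d%:R * (g x * rN x))%:E).
  exact: integrableZR.
apply: le_integrableR di => //.
  by apply/measurable_funTS/measurable_funM => //; exact: measurable_Lop.
move=> x _; have /andP[l0 l1] := Lop_bounds x.
by rewrite (ger0_norm (mulr_ge0 l0 (gN0 x))) ler_wpM2r.
Qed.

(** Symmetry moves [L] from [w] onto the weight [g], whose average is at most [k * g]. The weight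
    will be [chint] in the subcritical case and the constant 1 at the root of the full tree. *)
Lemma Lop_weighted_le :
  Rintegral mu `[h, +oo[ (fun x => Lop d h w x * (g x * rN x)) <=
  d%:R * k * Rintegral mu `[h, +oo[ (fun x => w x * (g x * rN x)).
Proof.
have iw := integrable_weighted; have iL := integrable_Lop_weighted.
rewrite -RintegralZl// -lee_fin /Rintegral !fineK; last 2 first.
- by apply: integrable_fin_num => //; exact: integrableZR.
- exact: integrable_fin_num iL.
apply: (@le_trans _ _ (\int[mu]_(x in `[h, +oo[) (d%:R%:E *
  ((\int[mu]_(a in `[h, +oo[) (g a * rY (a - x / d%:R))%:E) * (w x * rN x)%:E)))%E).
  rewrite le_eqVlt; apply/orP; left; apply/eqP.
  rewrite ge0_integralZl ?lee_fin ?(ltW d0)//; last 2 first.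
  - apply: emeasurable_funM.
      by apply/measurable_funTS; exact: measurable_Lint.
    by apply/measurable_funTS/measurable_EFinP/measurable_funM => //; exact: measurable_rho_nu.
  - move=> x _; apply: mule_ge0; last by rewrite lee_fin mulr_ge0 ?rho_nu_ge0.
    by apply: integral_ge0 => a _; rewrite lee_fin mulr_ge0 ?rho_Y_ge0.
  rewrite -(Lop_sym hd mw mg)//.
  rewrite -ge0_integralZl ?lee_fin ?(ltW d0)//; last 2 first.
  - apply: emeasurable_funM.
      by apply/measurable_funTS; exact: measurable_Lint.
    exact/measurable_funTS/measurable_EFinP.
  - move=> x _; apply: mule_ge0; last by rewrite lee_fin.
    by case/andP: (integral_rho_Y_le1 x).
  apply: eq_integral => x; rewrite inE /= in_itv /= andbT => hx.
  by rewrite EFinM Lop_EFin// muleA.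
apply: ge0_le_integral.
- exact: measurable_itv.
- move=> x _; apply: mule_ge0; first by rewrite lee_fin ltW.
  apply: mule_ge0; last by rewrite lee_fin mulr_ge0 ?rho_nu_ge0.
  by apply: integral_ge0 => a _; rewrite lee_fin mulr_ge0 ?rho_Y_ge0.
- apply: measurable_funeM; apply: emeasurable_funM.
    by apply/measurable_funTS; exact: measurable_Lint.
  by apply/measurable_funTS/measurable_EFinP/measurable_funM => //; exact: measurable_rho_nu.
- apply/measurable_funTS/measurable_EFinP; apply: measurable_funM => //.
  exact: measurable_funM.
- move=> x /=; rewrite in_itv /= andbT => hx.
  have r0 : (0 <= (w x * rN x)%:E)%E by rewrite lee_fin mulr_ge0 ?rho_nu_ge0.
  have dd : (0 <= d%:R%:E :> \bar R)%E by rewrite lee_fin ltW.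
  apply: le_trans (lee_wpmul2l dd (lee_wpmul2r r0 (gk hx))) _.
  by rewrite -!EFinM lee_fin le_eqVlt; apply/orP; left; apply/eqP; ring.
Qed.

End weighted.

(** * The operator and its eigenfunction *)

Lemma integral_itv_gt0 {R : realType} (f : R -> R) (u v : R) : u < v ->
  measurable_fun setT f -> (forall x, x \in `[u, v] -> 0 < f x) ->
  (0 < \int[lebesgue_measure]_(x in `[u, v]) (f x)%:E)%E.
Proof.
move=> uv mf f0; rewrite lt_neqAle; apply/andP; split; last first.
  by apply: integral_ge0 => x xuv; rewrite lee_fin ltW ?f0.
apply/eqP => /esym i0.
have : (\int[lebesgue_measure]_(x in `[u, v]) `|(f x)%:E| = 0)%E.
  rewrite -[RHS]i0; apply: eq_integral => x; rewrite inE => xuv.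
  by rewrite gee0_abs ?lee_fin ?ltW ?f0.
move/ae_eq_integral_abs => h.
have [//||N [mN N0 sN]] := h; first by apply/measurable_funTS/measurable_EFinP.
have : (lebesgue_measure `[u, v] <= lebesgue_measure N)%E.
  apply: le_measure; rewrite ?inE// => x xuv; apply: sN => /= /(_ xuv) [] fx0.
  by have := f0 x xuv; rewrite fx0 ltxx.
rewrite N0 lebesgue_measure_itv /= lte_fin uv -EFinB lee_fin; lra.
Qed.

Section operator.
Context {R : realType} (d : nat).
Hypothesis hd : (2 <= d)%N.
Local Notation mu := (@lebesgue_measure R).
Local Notation rY := (@rho_Y R d).
Local Notation rN := (@rho_nu R d).
Variables (hs lam : R) (chi : R -> R).
Hypothesis lam_gt0 : 0 < lam.
Hypothesis chi_L2 : L2nu d chi.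
Hypothesis chi_ge0 : forall x, 0 <= chi x.
Hypothesis chi_norm : nu_int d (fun x => chi x ^+ 2) = 1.
Hypothesis chi_eig : forall a, Lop d hs chi a = lam * chi a.

Local Notation D := (`[hs, +oo[%classic : set R).
Local Notation L := (Lop d hs).

(** [J f] is [<f, chi>], and [inD] is the space [L^1] of [chi nu] on [hs, oo). On this domain [J] is
    an eigenfunctional of [L], and the Harnack inequality makes [L f] finite at every point. *)
Definition wt x := chi x * rN x.
Definition inD (f : R -> R) := measurable_fun setT f /\
  mu.-integrable D (fun x => (f x * wt x)%:E).
Definition J (f : R -> R) : R := Rintegral mu D (fun x => f x * wt x).

Lemma inDset x : hs <= x -> D x. Proof. by rewrite /= in_itv /= andbT. Qed.
Lemma Dset x : D x -> hs <= x. Proof. by rewrite /= in_itv /= andbT. Qed.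

Let d0 : 0 < d%:R :> R := d_gt0 hd.

Lemma chi_meas : measurable_fun setT chi. Proof. by case: chi_L2. Qed.

Lemma wt_meas : measurable_fun setT wt.
Proof. by apply: measurable_funM; [exact: chi_meas|exact: measurable_rho_nu]. Qed.

Lemma chi_lt x : x < hs -> chi x = 0.
Proof.
move=> xh; have := chi_eig x; rewrite /Lop leNgt xh /= => /eqP.
by rewrite eq_sym mulf_eq0 (gt_eqF lam_gt0) => /eqP.
Qed.

Lemma wt_ge0 x : 0 <= wt x. Proof. by rewrite mulr_ge0 ?rho_nu_ge0. Qed.

Lemma integrable_wt : mu.-integrable setT (fun x => (wt x)%:E).
Proof.
have [mc ic] := chi_L2.
apply: (@le_integrableR _ _ _ _ (fun x => chi x ^+ 2 * rN x + vexp 0 x * rN x)) => //.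
- exact: wt_meas.
- move=> x _; rewrite ger0_norm ?wt_ge0//.
  rewrite /wt /vexp mul0r expR0 -mulrDl ler_wpM2r ?rho_nu_ge0//.
  by have := sqr_ge0 (chi x - 1); have := chi_ge0 x; nra.
- by apply: integrableDR => //; exact: integrable_vexp_rho_nu.
Qed.

(** By reversibility the kernel from [a] is at most a multiple of [rho_nu], with a constant
    depending on [a]. *)
Lemma integrable_rho_Y (f : R -> R) (a : R) : measurable_fun setT f ->
  mu.-integrable D (fun x => (f x * rN x)%:E) ->
  mu.-integrable D (fun x => (f x * rY (x - a / d%:R))%:E).
Proof.
move=> mf fi; pose c := normal_peak (sigma_Y d) / rN a.
have rNa := rho_nu_gt0 hd a.
have c0 : 0 <= c by rewrite divr_ge0 ?ltW ?pY_gt0.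
apply: (@le_integrableR _ _ _ _ (fun x => c * `|f x * rN x|)) => //.
- apply/measurable_funTS/measurable_funM => //.
  exact: measurable_rho_Y_shift.
- move=> x _; rewrite !normrM.
  have -> : `|rY (x - a / d%:R)| = rN x * rY (a - x / d%:R) / rN a.
    by rewrite ger0_norm ?rho_Y_ge0// -rho_sym// mulrAC divff ?mul1r// gt_eqF.
  rewrite (ger0_norm (rho_nu_ge0 hd x)) [leRHS]mulrCA.
  rewrite ler_wpM2l ?normr_ge0// /c.
  rewrite -mulrA [leRHS]mulrC ler_wpM2l ?rho_nu_ge0//.
  by rewrite ler_wpM2r ?invr_ge0 ?(ltW rNa)// rho_Y_le.
- by apply: integrableZR => //; exact: integrable_normR.
Qed.

Lemma integrable_chi_rho_Y a : mu.-integrable D (fun x => (chi x * rY (x - a / d%:R))%:E).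
Proof.
apply: integrable_rho_Y; first exact: chi_meas.
by apply: integrableS integrable_wt => //.
Qed.

Lemma chi_eigE a : hs <= a ->
  (\int[mu]_(x in D) (chi x * rY (x - a / d%:R))%:E = (lam / d%:R * chi a)%:E)%E.
Proof.
move=> ha; have := chi_eig a; rewrite /Lop ha => e.
rewrite -mulrA mulrCA -e mulKf ?gt_eqF// /Rintegral fineK//.
exact: integrable_fin_num (integrable_chi_rho_Y a).
Qed.

(** A zero of [chi] on [hs, oo) makes the integral of [chi] against a positive kernel vanish, hence
    [chi = 0] almost everywhere, against the unit norm. *)
Lemma chi_gt0 a : hs <= a -> 0 < chi a.
Proof.
move=> ha; rewrite lt_neqAle chi_ge0 andbT; apply/eqP => /esym c0.
have := chi_eigE ha; rewrite c0 mulr0 => i0.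
have : (\int[mu]_(x in D) `|(chi x * rY (x - a / d%:R))%:E| = 0)%E.
  rewrite -[RHS]i0; apply: eq_integral => x _.
  by rewrite gee0_abs ?lee_fin ?mulr_ge0 ?rho_Y_ge0.
move/ae_eq_integral_abs => h.
have [//||N [mN N0 sN]] := h.
  apply/measurable_funTS/measurable_EFinP/measurable_funM; first exact: chi_meas.
  exact: measurable_rho_Y_shift.
have z0 : (\int[mu]_x (chi x ^+ 2 * rN x)%:E = 0)%E.
  rewrite -[RHS](@integral0 _ _ _ mu setT); apply: ae_eq_integral => //.
    apply/measurable_EFinP/measurable_funM; last exact: measurable_rho_nu.
    by apply: measurable_funX; exact: chi_meas.
  exists N; split => //; apply: subset_trans sN => x /= nx /= e; apply: nx => _.
  suff -> : chi x = 0 by rewrite expr0n /= mul0r.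
  have [hx|/chi_lt//] := leP hs x.
  have /eqP := e (inDset hx); rewrite eqe mulf_eq0 (gt_eqF (rho_Y_gt0 hd _)) orbF.
  by move/eqP.
move: chi_norm; rewrite /nu_int /Rintegral z0 /= => /eqP.
by rewrite eq_sym oner_eq0.
Qed.

Lemma wt_gt0 x : hs <= x -> 0 < wt x.
Proof. by move=> hx; rewrite mulr_gt0 ?rho_nu_gt0 ?chi_gt0. Qed.

(* [chi rho_nu] at [x] dominates the kernel from [a <= A], since it is an average
   of kernels from [y] in [A, A + 1] and [rho_Y (x - y / d)] increases with [y]
   up to a factor bounded for [x >= hs] *)
Lemma harnack A : exists2 C, 0 < C & forall a x, hs <= a <= A -> hs <= x ->
  rY (x - a / d%:R) <= C * wt x.
Proof.
pose A1 := Num.max A hs.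
have A1A : A <= A1 by rewrite le_max lexx.
have A1h : hs <= A1 by rewrite le_max lexx orbT.
pose A2 := A1 + 1; have A2E : A2 = A1 + 1 by [].
pose m := fine (\int[mu]_(y in `[A1, A2]) (wt y)%:E)%E.
have iw : mu.-integrable `[A1, A2] (fun x => (wt x)%:E).
  by apply: integrableS integrable_wt.
have mE : (\int[mu]_(y in `[A1, A2]) (wt y)%:E)%E = m%:E.
  by rewrite /m fineK//; exact: integrable_fin_num iw.
have m0 : 0 < m.
  rewrite -lte_fin -mE; apply: integral_itv_gt0; first lra.
    exact: wt_meas.
  by move=> y; rewrite in_itv /= => /andP[hy _]; apply: wt_gt0; exact: le_trans hy.
(* A bound for [(y - a) / d * ((a + y) / d - 2 x)], the difference of squares compared in [key]; as
   [y >= a], it decreases in [x], so a lower bound on [x] is enough. *)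
pose M := (A1 + 1 - hs) / d%:R * (`|2 * hs| + 2 * (`|A1| + 1) / d%:R).
pose c := expR (qY d * M).
have c0 : 0 < c by exact: expR_gt0.
exists (lam / d%:R * c / m); first by rewrite !mulr_gt0 ?divr_gt0 ?invr_gt0.
move=> a x /andP[ha aA] hx.
have key y : y \in `[A1, A2] -> rY (x - a / d%:R) <= c * rY (x - y / d%:R).
  rewrite in_itv /= => /andP[y1 y2]; apply: rho_Y_compare => //.
  have -> : (x - y / d%:R) ^+ 2 - (x - a / d%:R) ^+ 2 =
     (y - a) / d%:R * ((a + y) / d%:R - 2 * x) by field; rewrite gt_eqF.
  rewrite /M; apply: (@le_trans _ _ ((y - a) / d%:R *
     (`|2 * hs| + 2 * (`|A1| + 1) / d%:R))).
    rewrite ler_wpM2l//; first by rewrite divr_ge0 ?(ltW d0)//; lra.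
    rewrite addrC lerD//; first by have := ler_norm (- (2 * hs)); rewrite normrN; lra.
    rewrite ler_pM2r ?invr_gt0//; have := ler_norm A1; lra.
  rewrite ler_wpM2r//.
  by rewrite ler_pM2r ?invr_gt0//; lra.
(* By reversibility the eigenvalue equation at [x] expresses [lam / d * wt x] as an integral of the
   kernels from [y] with weight [wt y]. *)
have e : (\int[mu]_(y in D) (chi y * rN y * rY (x - y / d%:R))%:E =
          (lam / d%:R * wt x)%:E)%E.
  transitivity (\int[mu]_(y in D) ((rN x)%:E * (chi y * rY (y - x / d%:R))%:E))%E.
    by apply: eq_integral => y _; rewrite -mulrA rho_sym// -EFinM; congr EFin; ring.
  rewrite integralZl//; last exact: integrable_chi_rho_Y.
  by rewrite chi_eigE// -EFinM /wt; congr EFin; ring.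
have le1 : (rY (x - a / d%:R) / c * m <= lam / d%:R * wt x).
  rewrite -lee_fin -e EFinM -mE -integralZl//.
  apply: (@le_trans _ _ (\int[mu]_(y in `[A1, A2]) (chi y * rN y * rY (x - y / d%:R))%:E)%E).
    apply: ge0_le_integral => //.
    - by move=> y _; rewrite -EFinM lee_fin mulr_ge0 ?wt_ge0// divr_ge0 ?rho_Y_ge0 ?(ltW c0).
    - apply/measurable_funTS; under eq_fun do rewrite -EFinM.
      by apply/measurable_EFinP/measurable_funM => //; exact: wt_meas.
    - apply/measurable_funTS/measurable_EFinP/measurable_funM; first exact: wt_meas.
      apply: measurableT_comp; first exact: measurable_rho_Y.
      by apply: measurable_funB => //; apply: measurable_funM.
    - move=> y /key h; rewrite -EFinM lee_fin mulrC ler_wpM2l ?wt_ge0//.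
      by rewrite ler_pdivrMr// [leRHS]mulrC.
  apply: ge0_subset_integral => //.
  - apply/measurable_funTS/measurable_EFinP/measurable_funM; first exact: wt_meas.
    apply: measurableT_comp; first exact: measurable_rho_Y.
    by apply: measurable_funB => //; apply: measurable_funM.
  - by move=> y _; rewrite lee_fin mulr_ge0 ?wt_ge0 ?rho_Y_ge0.
  - by move=> y /=; rewrite !in_itv /= andbT => /andP[h _]; exact: le_trans h.
rewrite (_ : lam / d%:R * c / m * wt x = lam / d%:R * wt x * c / m); last by ring.
by rewrite ler_pdivlMr// -ler_pdivrMr// mulrAC.
Qed.

Implicit Types (f g : R -> R) (a k A : R).

Lemma inD_le f g : measurable_fun setT f -> (forall x, hs <= x -> `|f x| <= g x) ->
  inD g -> inD f.
Proof.
move=> mf fg [mg ig]; split => //.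
apply: le_integrableR ig => //.
- by apply/measurable_funTS/measurable_funM => //; exact: wt_meas.
- by move=> x /Dset hx; rewrite normrM (ger0_norm (wt_ge0 x)) ler_wpM2r ?wt_ge0 ?fg.
Qed.

Lemma inD_lin k f g : inD f -> inD g -> inD (fun x => k * f x + g x).
Proof.
move=> [mf fi] [mg gi]; split.
  by apply: measurable_funD => //; exact: measurable_funM.
apply: (@eq_integrableR _ _ _ (fun x => k * (f x * wt x) + g x * wt x)) => //.
  by move=> x _; ring.
by apply: integrableDR => //; exact: integrableZR.
Qed.

Lemma inDZ k f : inD f -> inD (fun x => k * f x).
Proof.
move=> [mf fi]; split; first exact: measurable_funM.
apply: (@eq_integrableR _ _ _ (fun x => k * (f x * wt x))) => //.
  by move=> x _; ring.
exact: integrableZR.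
Qed.

Lemma inD_abs f : inD f -> inD (fun x => `|f x|).
Proof.
move=> [mf fi]; split; first exact: measurableT_comp.
apply: (@eq_integrableR _ _ _ (fun x => `|f x * wt x|)) => //; last exact: integrable_normR.
by move=> x _; rewrite normrM (ger0_norm (wt_ge0 x)).
Qed.

Lemma J_lin k f g : inD f -> inD g -> J (fun x => k * f x + g x) = k * J f + J g.
Proof.
move=> [mf fi] [mg gi]; rewrite /J.
under eq_Rintegral do rewrite mulrDl -mulrA.
rewrite RintegralD//; last exact: integrableZR.
by rewrite RintegralZl.
Qed.

Lemma JZ k f : inD f -> J (fun x => k * f x) = k * J f.
Proof.
by move=> [mf fi]; rewrite /J; under eq_Rintegral do rewrite -mulrA; rewrite RintegralZl.
Qed.

Lemma J_le f g : inD f -> inD g -> (forall x, hs <= x -> f x <= g x) -> J f <= J g.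
Proof.
move=> [mf fi] [mg gi] fg; apply: le_Rintegral => // x /Dset hx.
by rewrite ler_wpM2r ?wt_ge0 ?fg.
Qed.

Lemma J_eq f g : (forall x, hs <= x -> f x = g x) -> J f = J g.
Proof. by move=> fg; apply: eq_Rintegral => x; rewrite inE => /Dset /fg ->. Qed.

Lemma J_ge0 f : (forall x, hs <= x -> 0 <= f x) -> 0 <= J f.
Proof.
by move=> f0; apply: Rintegral_ge0 => x /Dset /f0 ?; rewrite mulr_ge0 ?wt_ge0.
Qed.

Lemma J_EFin f : inD f -> (\int[mu]_(x in D) (f x * wt x)%:E)%E = (J f)%:E.
Proof. by move=> [_ fi]; rewrite /J /Rintegral fineK//; exact: integrable_fin_num fi. Qed.

Lemma J_gt0 f : inD f -> (forall x, hs <= x -> 0 < f x) -> 0 < J f.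
Proof.
move=> fD f0; rewrite -lte_fin -J_EFin//.
have f0' x : hs <= x -> 0 < f x * wt x.
  by move=> hx; rewrite mulr_gt0 ?f0 ?wt_gt0.
have mf : measurable_fun setT (fun x => f x * wt x).
  by apply: measurable_funM; [case: fD|exact: wt_meas].
apply: (@lt_le_trans _ _ (\int[mu]_(x in `[hs, (hs + 1)%R]) (f x * wt x)%:E)%E).
  apply: integral_itv_gt0 => //; first lra.
  by move=> x; rewrite in_itv /= => /andP[/f0'].
apply: ge0_subset_integral => //.
- exact/measurable_funTS/measurable_EFinP.
- by move=> x /Dset /f0' /ltW; rewrite lee_fin.
- by move=> x /=; rewrite !in_itv /= andbT => /andP[].
Qed.

Lemma inD_intY f a : inD f -> hs <= a ->
  mu.-integrable D (fun x => (f x * rY (x - a / d%:R))%:E).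
Proof.
move=> [mf fi] ha; have [C C0 hC] := harnack a.
apply: (@le_integrableR _ _ _ _ (fun x => C * `|f x * wt x|)) => //.
- by apply/measurable_funTS/measurable_funM => //; exact: measurable_rho_Y_shift.
- move=> x /Dset hx; rewrite normrM [`|f x * wt x|]normrM (ger0_norm (wt_ge0 x)) (ger0_norm (rho_Y_ge0 hd _)).
  by rewrite mulrCA ler_wpM2l// hC// ha lexx.
- by apply: integrableZR => //; exact: integrable_normR.
Qed.

Lemma L_lt f a : a < hs -> L f a = 0.
Proof. by move=> ah; rewrite /Lop leNgt ah. Qed.

Lemma L_lin k f g a : inD f -> inD g ->
  L (fun x => k * f x + g x) a = k * L f a + L g a.
Proof.
move=> fD gD; rewrite /Lop; case: ifPn => ha; last by rewrite mulr0 addr0.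
under eq_Rintegral do rewrite mulrDl -mulrA.
rewrite RintegralD//; [|by apply: integrableZR => //; exact: inD_intY|exact: inD_intY].
by rewrite RintegralZl//; [ring|exact: inD_intY].
Qed.

Lemma LZ k f a : inD f -> L (fun x => k * f x) a = k * L f a.
Proof.
move=> fD; rewrite /Lop; case: ifPn => ha; last by rewrite mulr0.
under eq_Rintegral do rewrite -mulrA.
by rewrite RintegralZl//; [ring|exact: inD_intY].
Qed.

Lemma L_eq f g a : (forall x, hs <= x -> f x = g x) -> L f a = L g a.
Proof.
move=> fg; rewrite /Lop; case: ifPn => // ha; congr (_ * _).
by apply: eq_Rintegral => x; rewrite inE => /Dset /fg ->.
Qed.

Lemma L_le f g a : inD f -> inD g -> (forall x, hs <= x -> f x <= g x) -> L f a <= L g a.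
Proof.
move=> fD gD fg; rewrite /Lop; case: ifPn => // ha.
rewrite ler_wpM2l ?(ltW d0)//; apply: le_Rintegral => //; try exact: inD_intY.
by move=> x /Dset hx; rewrite ler_wpM2r ?rho_Y_ge0 ?fg.
Qed.

Lemma L_ge0 f a : (forall x, hs <= x -> 0 <= f x) -> 0 <= L f a.
Proof.
move=> f0; rewrite /Lop; case: ifPn => // ha; rewrite mulr_ge0 ?(ltW d0)//.
by apply: Rintegral_ge0 => x /Dset /f0 ?; rewrite mulr_ge0 ?rho_Y_ge0.
Qed.

Lemma L_abs f a : inD f -> `|L f a| <= L (fun x => `|f x|) a.
Proof.
move=> fD; have aD := inD_abs fD; rewrite ler_norml; apply/andP; split.
  rewrite -mulN1r -LZ//; apply: L_le => //; first exact: inDZ.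
  by move=> x _; rewrite mulN1r lerNl -normrN ler_norm.
by apply: L_le => // x _; exact: ler_norm.
Qed.

(** [L] smooths: the mass [J f] controls [L f] pointwise on bounded sets. *)
Lemma L_harnack A : exists2 C, 0 < C & forall f a, inD f ->
  (forall x, hs <= x -> 0 <= f x) -> hs <= a <= A -> L f a <= C * J f.
Proof.
have [C C0 hC] := harnack A; exists (d%:R * C); first by rewrite mulr_gt0.
move=> f a fD f0 ha; have /andP[ha1 _] := ha; rewrite /Lop ha1 -mulrA ler_wpM2l ?(ltW d0)//.
rewrite /J -RintegralZl//; last by case: fD.
apply: le_Rintegral => //; first exact: inD_intY.
  by apply: integrableZR => //; case: fD.
by move=> x /Dset hx; rewrite mulrCA ler_wpM2l ?f0// hC.
Qed.

Lemma L_EFin f a : inD f -> hs <= a ->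
  (\int[mu]_(x in D) (f x * rY (x - a / d%:R))%:E)%E = (L f a / d%:R)%:E.
Proof.
move=> fD ha; rewrite /Lop ha mulrAC divff ?gt_eqF// mul1r /Rintegral fineK//.
exact: integrable_fin_num (inD_intY fD ha).
Qed.

Lemma measurable_L_ge0 f : inD f -> (forall x, hs <= x -> 0 <= f x) ->
  measurable_fun setT (L f).
Proof.
move=> fD f0.
rewrite (_ : L f = fun a => if hs <= a then d%:R *
    fine (\int[mu]_(x in D) (f x * rY (x - a / d%:R))%:E)%E else 0); last by [].
apply: measurable_fun_ifT => //.
  by apply: measurable_fun_ler.
apply: measurable_funM => //; apply: measurableT_comp => //.
by apply: measurable_Lint => //; case: fD.
Qed.

(** [chi] is a left eigenvector by symmetry. For nonnegative [f] the identity is first obtained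
    between extended-real integrals, and its finite right side is what puts [L f] back into the
    space. *)
Lemma J_L_ge0 f : inD f -> (forall x, hs <= x -> 0 <= f x) ->
  inD (L f) /\ J (L f) = lam * J f.
Proof.
move=> fD f0.
have e : (\int[mu]_(a in D) (L f a * wt a)%:E = (lam * J f)%:E)%E.
  transitivity (\int[mu]_(a in D) (d%:R%:E * ((\int[mu]_(x in D) (f x * rY (x - a / d%:R))%:E) * (chi a * rN a)%:E)))%E.
    apply: eq_integral => a; rewrite inE => /Dset ha.
    by rewrite L_EFin// -!EFinM; congr EFin; rewrite /wt; field; rewrite gt_eqF.
  have mf : measurable_fun setT f by case: fD.
  rewrite ge0_integralZl//; last 2 first.
  - apply: emeasurable_funM.
      by apply/measurable_funTS; apply: measurable_Lint.
    by apply/measurable_funTS/measurable_EFinP; exact: wt_meas.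
  - move=> a _; rewrite mule_ge0 ?lee_fin ?wt_ge0//.
    by apply: integral_ge0 => x /Dset hx; rewrite lee_fin mulr_ge0 ?f0 ?rho_Y_ge0.
  rewrite Lop_sym//; last exact: chi_meas.
  transitivity (d%:R%:E * \int[mu]_(x in D) ((lam / d%:R)%:E * (f x * wt x)%:E))%E.
    congr (_ * _)%E; apply: eq_integral => x; rewrite inE => /Dset hx.
    by rewrite chi_eigE// -!EFinM /wt; congr EFin; ring.
  rewrite integralZl//; last by case: fD.
  by rewrite J_EFin// -!EFinM; congr EFin; field; rewrite gt_eqF.
have iD : inD (L f).
  split; first exact: measurable_L_ge0.
  apply: ge0_integrable => //.
  - apply/measurable_funTS/measurable_funM; last exact: wt_meas.
    exact: measurable_L_ge0.
  - by move=> x _; rewrite mulr_ge0 ?wt_ge0 ?L_ge0.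
  - by rewrite e ltry.
by split => //; apply: EFin_inj; rewrite -J_EFin.
Qed.

Lemma J_L f : inD f -> inD (L f) /\ J (L f) = lam * J f.
Proof.
move=> fD; pose a x := `|f x|; pose b x := `|f x| + f x.
have aD : inD a by exact: inD_abs.
have bE : b = fun x => 1 * a x + f x by apply/funext => x; rewrite mul1r.
have bD : inD b by rewrite bE; exact: inD_lin.
have a0 x : hs <= x -> 0 <= a x by move=> _; exact: normr_ge0.
have b0 x : hs <= x -> 0 <= b x.
  by move=> _; rewrite /b; have := ler_norm (- f x); rewrite normrN; lra.
have [La Ja] := J_L_ge0 aD a0; have [Lb Jb] := J_L_ge0 bD b0.
have Lf : L f = fun x => (-1) * L a x + L b x.
  by apply/funext => x; rewrite bE L_lin//; ring.
rewrite Lf; split; first exact: inD_lin.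
by rewrite J_lin// Ja Jb bE J_lin//; ring.
Qed.

Lemma inD_L f : inD f -> inD (L f).
Proof. by move=> fD; case: (J_L fD). Qed.

Lemma inD_chi : inD chi.
Proof.
split; first exact: chi_meas.
apply: (@eq_integrableR _ _ _ (fun x => chi x ^+ 2 * rN x)) => //.
  by move=> x _; rewrite /wt expr2 mulrA.
by case: chi_L2 => _ ic; apply: integrableS ic.
Qed.

Lemma Rintegral_D f : (forall x, x < hs -> f x = 0) ->
  Rintegral mu setT f = Rintegral mu D f.
Proof.
move=> f0; rewrite [RHS]Rintegral_mkcond; congr fine; apply: eq_integral => x _.
rewrite /patch; case: ifPn => // /negP xD; rewrite f0// ltNge; apply/negP => hx.
by apply: xD; rewrite inE; exact: inDset.
Qed.

Lemma nu_int_J f : nu_int d (fun x => f x * chi x) = J f.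
Proof.
rewrite /nu_int Rintegral_D; last by move=> x /chi_lt ->; rewrite mulr0 mul0r.
by apply: eq_Rintegral => x _; rewrite /wt mulrA.
Qed.

Lemma J_chi : J chi = 1.
Proof. by rewrite -chi_norm -nu_int_J; apply: eq_Rintegral => x _; rewrite expr2. Qed.

Lemma inD_vexp k : inD (vexp k).
Proof.
split; first exact: measurable_vexp.
apply: (@le_integrableR _ _ _ _ (fun x => chi x ^+ 2 * rN x + vexp (2 * k) x * rN x)) => //.
- by apply/measurable_funTS/measurable_funM; [exact: measurable_vexp|exact: wt_meas].
- move=> x _; rewrite ger0_norm; last by apply: mulr_ge0; [exact: expR_ge0|exact: wt_ge0].
  rewrite /wt mulrA -mulrDl; apply: ler_wpM2r; first exact: rho_nu_ge0.
  have -> : vexp (2 * k) x = vexp k x ^+ 2 by rewrite /vexp -expRM_natl -mulrA.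
  by have := sqr_ge0 (chi x - vexp k x); have := sqr_ge0 (chi x + vexp k x); lra.
- apply: integrableDR => //; first by case: chi_L2 => _ ic; apply: integrableS ic.
  by apply: integrableS (integrable_vexp_rho_nu hd (2 * k)).
Qed.

Lemma inD_cst c : inD (cst c).
Proof.
apply: (@inD_le _ (fun x => `|c| * vexp 0 x)) => //; last exact/inDZ/inD_vexp.
by move=> x _; rewrite /vexp mul0r expR0 mulr1.
Qed.

Lemma L_vexp_le k a : hs <= a ->
  L (vexp k) a <= d%:R * expR (k * (a / d%:R) + k ^+ 2 * sigma_Y d ^+ 2 / 2).
Proof.
move=> ha; rewrite /Lop ha ler_wpM2l ?(ltW d0)// -lee_fin -integral_vexp_rho_Y//.
rewrite /Rintegral fineK; last exact: integrable_fin_num (inD_intY (inD_vexp k) ha).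
apply: ge0_subset_integral => //.
- apply/measurable_EFinP/measurable_funM; first exact: measurable_vexp.
  exact: measurable_rho_Y_shift.
- by move=> x _; rewrite lee_fin mulr_ge0 ?expR_ge0 ?rho_Y_ge0.
Qed.

(** For [a >= 0] a child has mean [a / d <= a / 2], so [L] turns [exp (k a)] into at most
    [d exp (k a / 2 + const)]; for large [a] the gain [exp (- k a / 2)] beats the factor [2 d] and
    the variance term. *)
Lemma lyapunov k : 0 < k -> exists A, forall a, hs <= a -> A < a ->
  L (vexp k) a <= vexp k a / 2.
Proof.
move=> k0; pose c := ln (2 * d%:R) + k ^+ 2 * sigma_Y d ^+ 2 / 2.
exists (Num.max 0 (2 * c / k)) => a ha; rewrite gt_max => /andP[a0 ac].
apply: le_trans (L_vexp_le k ha) _.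
have d2 := @d_ge2 R d hd.
rewrite ler_pdivlMr//; set E := expR _.
have -> : d%:R * E * 2 = expR (ln (2 * d%:R)) * E.
  by rewrite lnK ?posrE ?mulr_gt0//; ring.
rewrite /E -expRD /vexp ler_expR.
have ad : a / d%:R <= a / 2 by rewrite ler_pM2l// lef_pV2 ?posrE.
have : k * (a / d%:R) <= k * (a / 2) by rewrite ler_pM2l.
by move: ac; rewrite ltr_pdivrMr// /c; lra.
Qed.

Lemma vexp_ge k a : 0 <= k -> hs <= a -> vexp k hs <= vexp k a.
Proof. by move=> k0 ha; rewrite ler_expR ler_wpM2l. Qed.

Lemma vexp_gt0 k (x : R) : 0 < vexp k x. Proof. exact: expR_gt0. Qed.

(** Drift condition: above the level [A] of [lyapunov] half of the old constant suffices, and below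
    it the Harnack inequality replaces the constant by [J f]. The factor 1/2 feeds [contraction]. *)
Lemma L_lyapunov k : 0 < k -> exists2 C, 0 < C & forall f M, inD f -> 0 <= M ->
  (forall x, hs <= x -> 0 <= f x <= M * vexp k x) ->
  forall a, hs <= a -> L f a <= (C * J f + M / 2) * vexp k a.
Proof.
move=> k0; have [A hA] := lyapunov k0; have [C C0 hC] := L_harnack A.
exists (C / vexp k hs); first by rewrite divr_gt0 ?vexp_gt0.
move=> f M fD M0 fM a ha; have J0 : 0 <= J f by apply: J_ge0 => x /fM /andP[].
rewrite mulrDl; have [aA|Aa] := leP a A.
  apply: (@le_trans _ _ (C * J f)).
    by apply: hC => //; [move=> x /fM /andP[]|rewrite ha].
  apply: (@le_trans _ _ (C / vexp k hs * J f * vexp k a)); last first.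
    by rewrite lerDl mulr_ge0 ?(ltW (vexp_gt0 _ _))// divr_ge0.
  have -> : C / vexp k hs * J f * vexp k a = C * J f * (vexp k a / vexp k hs) by ring.
  apply: ler_peMr; first by rewrite mulr_ge0// ltW.
  by rewrite ler_pdivlMr ?vexp_gt0// mul1r vexp_ge// ltW.
apply: (@le_trans _ _ (L (fun x => M * vexp k x) a)).
  by apply: L_le => //; [exact/inDZ/inD_vexp|move=> x /fM /andP[]].
rewrite LZ; last exact: inD_vexp.
apply: (@le_trans _ _ (M * (vexp k a / 2))); first by rewrite ler_wpM2l// hA.
rewrite mulrA mulrAC lerDr mulr_ge0 ?(ltW (vexp_gt0 _ _))//.
by rewrite mulr_ge0// divr_ge0 ?(ltW C0) ?(ltW (vexp_gt0 _ _)).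
Qed.

Definition above (B x : R) : R := if B < x then 1 else 0.

Lemma measurable_above B : measurable_fun setT (above B).
Proof. by apply: measurable_fun_ifT => //; apply: measurable_fun_ltr. Qed.

Lemma inD_above B f : inD f -> inD (fun x => f x * above B x).
Proof.
move=> fD; apply: (@inD_le _ (fun x => `|f x|)); last exact: inD_abs.
- by apply: measurable_funM; [case: fD|exact: measurable_above].
- by move=> x _; rewrite /above; case: ifP => _; rewrite ?mulr1 ?mulr0 ?normr0.
Qed.

Lemma J_tail f : inD f -> (forall x, hs <= x -> 0 <= f x) ->
  forall e, 0 < e -> exists B, J (fun x => f x * above B x) < e.
Proof.
move=> fD f0 e e0.
have [mf fi] := fD.
pose u n x : \bar R := (f x * above n%:R x * wt x)%:E.
have mu_ n : measurable_fun D (u n).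
  apply/measurable_funTS/measurable_EFinP/measurable_funM; last exact: wt_meas.
  by apply: measurable_funM => //; exact: measurable_above.
have cu : {ae mu, forall x, D x -> u n x @[n --> \oo] --> (cst 0%E : R -> \bar R) x}.
  apply: aeW => x Dx; apply: cvg_near_cst.
  near=> n; rewrite /u /above ifF ?mulr0 ?mul0r//.
  apply/negbTE; rewrite -leNgt; near: n; exact: nbhs_infty_ger.
have [] := @dominated_convergence _ _ _ mu D _ u (cst 0%E) (fun x => (f x * wt x)%:E) mu_ _ cu fi _ => //.
  apply: aeW => x n /Dset hx.
  rewrite /u abse_EFin lee_fin ger0_norm; last first.
    apply: mulr_ge0; last exact: wt_ge0.
    by apply: mulr_ge0; [exact: f0|rewrite /above; case: ifP].
  apply: ler_wpM2r; first exact: wt_ge0.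
  by rewrite /above; case: ifP => _; rewrite ?mulr1 ?mulr0 ?f0.
move=> _ _; rewrite integral0 => cv.
have : J (fun x => f x * above n%:R x) @[n --> \oo] --> 0.
  exact: (@fine_cvg R nat \oo _ _ 0 cv).
move/cvgrPdist_lt => /(_ _ e0) [N _ /(_ N (leqnn N))] /=.
rewrite sub0r normrN => h; exists N%:R; apply: le_lt_trans h; exact: ler_norm.
Unshelve. all: by end_near. Qed.

Lemma chi_bounded A : exists2 C, 0 < C & forall a, hs <= a <= A -> chi a <= C.
Proof.
have [C C0 hC] := L_harnack A; exists (C / lam); first by rewrite divr_gt0.
move=> a ha; rewrite ler_pdivlMr// mulrC -chi_eig.
by have := hC _ _ inD_chi (fun x _ => chi_ge0 x) ha; rewrite J_chi mulr1.
Qed.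

(** A Doeblin condition: on bounded sets the kernel is bounded below and [wt] is bounded above, so
    every [a] in [hs, hs + 1] sees the mass of [f] below [B] with a uniform weight. *)
Lemma minorization B : exists2 e, 0 < e & forall f a, inD f ->
  (forall x, hs <= x -> 0 <= f x) -> hs <= a <= hs + 1 ->
  e * (J f - J (fun x => f x * above B x)) <= L f a.
Proof.
have [C C0 hC] := chi_bounded B.
pose M := (`|hs| + `|B| + (`|hs| + 1) / d%:R) ^+ 2.
pose r := normal_peak (sigma_Y d) * expR (- (qY d * M)).
have r0 : 0 < r by rewrite mulr_gt0 ?expR_gt0 ?pY_gt0.
pose c := C * normal_peak (sigma_nu d).
have c0 : 0 < c by rewrite mulr_gt0// pN_gt0.
exists (d%:R * (r / c)); first by apply: mulr_gt0 => //; exact: divr_gt0.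
move=> f a fD f0 /andP[ha ha1].
have fB := inD_above B fD.
pose g x := (-1) * (f x * above B x) + f x.
have gD : inD g by exact: inD_lin.
have -> : J f - J (fun x => f x * above B x) = J g by rewrite J_lin//; ring.
rewrite /Lop ha -mulrA ler_wpM2l ?(ltW d0)//.
have [mg gi] := gD.
rewrite /J -RintegralZl//; apply: le_Rintegral => //; first exact: integrableZR.
  exact: inD_intY.
move=> x /Dset hx; rewrite /g /above; case: ltP => xB.
  rewrite mulr1 mulN1r addNr mul0r mulr0 mulr_ge0 ?f0 ?rho_Y_ge0//.
rewrite mulr0 mulr0 add0r mulrCA ler_wpM2l ?f0//.
apply: (@le_trans _ _ r).
  rewrite -mulrA ler_piMr ?(ltW r0)// mulrC ler_pdivrMr// mul1r /wt /c.
  by rewrite ler_pM ?rho_nu_ge0 ?rho_nu_le// hC// hx.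
apply: rho_Y_lower => //.
rewrite -(real_normK (num_real (x - a / d%:R))) /M lerXn2r ?nnegrE//.
have h1 : `|x| <= `|hs| + `|B|.
  have := ler_norm hs; have := ler_norm (- hs); rewrite normrN => ? ?.
  have := ler_norm B; have := normr_ge0 B => ? ?; have := normr_ge0 hs => ?.
  by rewrite ler_norml; apply/andP; split; lra.
have h2 : `|a / d%:R| <= (`|hs| + 1) / d%:R.
  rewrite normrM normfV (ger0_norm (ltW d0)) ler_wpM2r ?invr_ge0 ?(ltW d0)//.
  have := ler_norm hs; have := ler_norm (- hs); rewrite normrN => ? ?.
  by rewrite ler_norml; apply/andP; split; lra.
by apply: le_trans (ler_normB _ _) _; exact: lerD.
Qed.

Lemma vexpD k l (x : R) : vexp k x * vexp l x = vexp (k + l) x.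
Proof. by rewrite /vexp -expRD mulrDl. Qed.

Lemma vexp_le k l (x : R) : k <= l -> hs <= x -> vexp k x <= expR ((k - l) * hs) * vexp l x.
Proof.
move=> kl hx; rewrite /vexp -expRD ler_expR.
have : (l - k) * hs <= (l - k) * x by rewrite ler_wpM2l// subr_ge0.
by lra.
Qed.

Lemma L_le_d f a : inD f -> (forall x, hs <= x -> f x <= 1) -> L f a <= d%:R.
Proof.
move=> fD f1; have [ha|/L_lt->] := leP hs a; last exact: ltW.
apply: (@le_trans _ _ (L (vexp 0) a)).
  apply: L_le => //; first exact: inD_vexp.
  by move=> x /f1; rewrite /vexp mul0r expR0.
by have := L_vexp_le 0 ha; rewrite !mul0r expr2 !mul0r addr0 expR0 mulr1.
Qed.

(** The equation of [1 - E z^N] at a level [h >= hs]. It can be written with [L] taken at [hs]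
    because [w] vanishes below [h]. *)
Definition is_w (h z : R) (w : R -> R) := [/\ measurable_fun setT w, forall x, 0 <= w x <= 1,
  forall x, x < h -> w x = 0 &
  forall x, h <= x -> w x = 1 - z * (1 - L w x / d%:R) ^+ d].

(** * A priori bounds on solutions of the branching equation *)

Section level.
Variables (h z : R) (w : R -> R).
Hypothesis hsh : hs <= h.
Hypothesis z01 : 0 <= z < 1.
Hypothesis Hw : is_w h z w.

Let z0 : 0 <= z. Proof. by case/andP: z01. Qed.
Let z1 : z < 1. Proof. by case/andP: z01. Qed.

Lemma inD_w : inD w.
Proof.
have [mw w01 _ _] := Hw; apply: (@inD_le _ (cst 1)) => //; last exact: inD_cst.
by move=> x _; case/andP: (w01 x) => ? ?; rewrite ger0_norm.
Qed.

Lemma w_ge0 x : 0 <= w x. Proof. by have [_ /(_ x)/andP[]] := Hw. Qed.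
Lemma w_le1 x : w x <= 1. Proof. by have [_ /(_ x)/andP[]] := Hw. Qed.

Lemma Lw_ge0 x : 0 <= L w x. Proof. by apply: L_ge0 => ? _; exact: w_ge0. Qed.

Lemma y01 x : 0 <= L w x / d%:R <= 1.
Proof.
rewrite divr_ge0 ?Lw_ge0 ?(ltW d0)//= ler_pdivrMr// mul1r.
by apply: L_le_d; [exact: inD_w|move=> ? _; exact: w_le1].
Qed.

Lemma w_rem2 x : h <= x -> w x = (1 - z) + z * L w x - z * rem2 d (L w x / d%:R).
Proof.
move=> hx; have [_ _ _ /(_ x hx) ->] := Hw.
rewrite /rem2; set P := (1 - _) ^+ d; field; rewrite gt_eqF//.
Qed.

Lemma rem2_ge0 x : 0 <= rem2 d (L w x / d%:R).
Proof. by apply: le_trans (rem2_ge_sqr hd (y01 x)); exact: sqr_ge0. Qed.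

Lemma w_le x : h <= x -> w x <= (1 - z) + L w x.
Proof.
move=> hx; rewrite w_rem2//.
have : 0 <= z * rem2 d (L w x / d%:R) by rewrite mulr_ge0 ?rem2_ge0.
have : z * L w x <= 1 * L w x by rewrite ler_wpM2r ?Lw_ge0 ?ltW.
by lra.
Qed.

Lemma w_ge x : h <= x -> 1 - z <= w x.
Proof.
move=> hx; have [_ _ _ /(_ x hx) ->] := Hw; rewrite lerD2l lerN2.
rewrite ler_piMr// exprn_ile1//; have /andP[? ?] := y01 x; first lra.
by lra.
Qed.

Lemma measurable_y : measurable_fun setT (fun x => L w x / d%:R).
Proof. by apply: measurable_funM => //; case: (inD_L inD_w). Qed.

Lemma inD_rem2 : inD (fun x => rem2 d (L w x / d%:R)).
Proof.
apply: (@inD_le _ (L w)); last exact/inD_L/inD_w.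
- apply: measurable_funD; last first.
    by apply: measurable_funX; apply: measurable_funB => //; exact: measurable_y.
  by apply: measurable_funB => //; apply: measurable_funM => //; exact: measurable_y.
- move=> x _; rewrite ger0_norm ?rem2_ge0// /rem2.
  have := y01 x => /andP[? ?].
  have : (1 - L w x / d%:R) ^+ d <= 1 by rewrite exprn_ile1//; lra.
  have -> : d%:R * (L w x / d%:R) = L w x by field; rewrite gt_eqF.
  by lra.
Qed.

End level.

Lemma J_indic_gt0 h : hs <= h -> 0 < J (fun x => if h <= x then 1 else 0).
Proof.
move=> hh; pose f x : R := if h <= x then 1 else 0.
have mf : measurable_fun setT f.
  by apply: measurable_fun_ifT => //; apply: measurable_fun_ler.
have fD : inD f.
  apply: (@inD_le _ (cst 1)) => //; last exact: inD_cst.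
  by move=> x _; rewrite /f; case: ifP => _; rewrite ?normr1 ?normr0.
rewrite -/f -lte_fin -J_EFin//.
have mfw : measurable_fun setT (fun x => f x * wt x).
  by apply: measurable_funM => //; exact: wt_meas.
apply: (@lt_le_trans _ _ (\int[mu]_(x in `[h, (h + 1)%R]) (f x * wt x)%:E)%E).
  apply: integral_itv_gt0 => //; first lra.
  move=> x; rewrite in_itv /= => /andP[hx _]; rewrite /f hx mul1r.
  by apply: wt_gt0; exact: le_trans hx.
apply: ge0_subset_integral => //.
- exact/measurable_funTS/measurable_EFinP.
- by move=> x _; rewrite lee_fin; apply: mulr_ge0; [rewrite /f; case: ifP|exact: wt_ge0].
- by move=> x /=; rewrite !in_itv /= andbT => /andP[hx _]; exact: le_trans hx.
Qed.

(** Everything is measured by the single number [J w]. First [w >= 1 - z] on [h, oo) bounds [1 - z]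
    by a multiple of [J w]; then [w <= (1 - z) + L w] and the drift condition improve the trivial
    bound [w <= 1] to one linear in [J w]. *)
Lemma w_bound h : hs <= h -> exists2 C, 0 < C & forall z w, 0 <= z < 1 ->
  is_w h z w ->
  [/\ 0 < J w, 1 - z <= C * J w & forall x, hs <= x -> w x <= C * J w * vexp 1 x].
Proof.
move=> hh; have [C C0 hC] := L_lyapunov ltr01.
have j0 := J_indic_gt0 hh; set j := J _ in j0.
pose v := vexp 1 hs; have v0 : 0 < v by exact: vexp_gt0.
(* [(j * v)^-1] pays for the term [1 - z] and [C] for [L w]; the fixed point of the contraction with
   factor 1/2 doubles the sum. *)
pose K := (j * v)^-1 + C.
have K0 : 0 < K by rewrite addr_gt0// invr_gt0 mulr_gt0.
exists (j^-1 + 2 * K); first by rewrite addr_gt0 ?invr_gt0 ?mulr_gt0.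
move=> z w z01 Hw; have wD := inD_w Hw; have /andP[z0 z1] := z01.
have jw : (1 - z) * j <= J w.
  rewrite /j -JZ; last first.
    apply: (@inD_le _ (cst 1)) => //; last exact: inD_cst.
      by apply: measurable_fun_ifT => //; apply: measurable_fun_ler.
    by move=> x _; case: ifP => _; rewrite ?normr1 ?normr0.
  apply: J_le => //.
    apply: inDZ; apply: (@inD_le _ (cst 1)) => //; last exact: inD_cst.
      by apply: measurable_fun_ifT => //; apply: measurable_fun_ler.
    by move=> x _; case: ifP => _; rewrite ?normr1 ?normr0.
  move=> x _; case: ifPn => [hx|_]; first by rewrite mulr1; exact: w_ge Hw _ hx.
  by rewrite mulr0; exact: w_ge0 Hw x.
have Jw0 : 0 < J w by apply: lt_le_trans jw; rewrite mulr_gt0// subr_gt0.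
have zj : 1 - z <= j^-1 * J w by rewrite mulrC ler_pdivlMr.
split=> //.
  by apply: le_trans zj _; rewrite ler_wpM2r ?(ltW Jw0)// lerDl mulr_ge0 ?(ltW K0).
move=> x hx; apply: (@le_trans _ _ (2 * K * J w * vexp 1 x)); last first.
  rewrite ler_wpM2r ?(ltW (vexp_gt0 _ _))// ler_wpM2r ?(ltW Jw0)//.
  by rewrite lerDr invr_ge0 ltW.
have := @contraction _ (fun x => hs <= x) w (vexp 1) (K * J w) (1 / 2) (v^-1).
have -> : K * J w / (1 - 1 / 2) = 2 * K * J w by field.
apply => //.
- by apply/andP; split; lra.
- by rewrite mulr_ge0 ?(ltW K0) ?(ltW Jw0).
- by rewrite invr_ge0 ltW.
- by move=> t _; rewrite ltW ?vexp_gt0.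
- move=> M M0 wM t ht; have [hwt|wt_] := leP h t; last first.
    have [_ _ /(_ t wt_) -> _] := Hw.
    apply: mulr_ge0; last exact/ltW/vexp_gt0.
    by apply: addr_ge0; [rewrite mulr_ge0 ?ltW|lra].
  apply: le_trans (w_le z01 Hw hwt) _.
  have h1 : 1 - z <= (j * v)^-1 * J w * vexp 1 t.
    apply: le_trans zj _.
    have -> : (j * v)^-1 * J w * vexp 1 t = j^-1 * J w * (vexp 1 t / v).
      by field; rewrite !gt_eqF.
    apply: ler_peMr; first by rewrite mulr_ge0 ?invr_ge0 ?ltW.
    by rewrite ler_pdivlMr// mul1r; exact: vexp_ge.
  have h2 : L w t <= (C * J w + M / 2) * vexp 1 t.
    apply: hC => // u hu; rewrite wM// andbT; exact: w_ge0 Hw u.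
  have -> : (K * J w + 1 / 2 * M) * vexp 1 t =
     (j * v)^-1 * J w * vexp 1 t + (C * J w + M / 2) * vexp 1 t by rewrite /K; ring.
  exact: lerD.
- move=> t ht; rewrite mulrC; apply: le_trans (w_le1 Hw t) _.
  by rewrite ler_pdivlMr// mul1r; exact: vexp_ge.
Qed.

Lemma J_vexp_gt0 k : 0 < J (vexp k).
Proof. by apply: J_gt0; [exact: inD_vexp|move=> x _; exact: vexp_gt0]. Qed.

Lemma Lw_bound h : hs <= h -> exists2 C, 0 < C & forall z w, 0 <= z < 1 -> is_w h z w ->
  forall x, hs <= x -> L w x <= C * J w * vexp 1 x.
Proof.
move=> hh; have [C C0 hC] := w_bound hh.
have [Cl Cl0 hCl] := L_lyapunov ltr01.
pose K := Cl * J (vexp 1) + 1 / 2.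
have K0 : 0 < K by rewrite addr_gt0// ?mulr_gt0 ?J_vexp_gt0//; lra.
exists (C * K); first by rewrite mulr_gt0.
move=> z w z01 Hw x hx; have [Jw _ wV] := hC z w z01 Hw; have wD := inD_w Hw.
apply: (@le_trans _ _ (L (fun t => C * J w * vexp 1 t) x)).
  by apply: L_le => //; exact/inDZ/inD_vexp.
rewrite LZ; last exact: inD_vexp.
have : L (vexp 1) x <= K * vexp 1 x.
  apply: hCl => //; first exact: inD_vexp.
  by move=> t _; rewrite mul1r lexx andbT; exact/ltW/vexp_gt0.
move=> hL; apply: (@le_trans _ _ (C * J w * (K * vexp 1 x))); last by rewrite le_eqVlt; apply/orP; left; apply/eqP; ring.
by rewrite ler_wpM2l// mulr_ge0 ?ltW.
Qed.

(** The remainder is quadratic in [L w], which squares both [J w] and the weight [vexp 1]. *)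
Lemma rem_bound h : hs <= h -> exists2 C, 0 < C & forall z w, 0 <= z < 1 -> is_w h z w ->
  forall x, hs <= x -> rem2 d (L w x / d%:R) <= C * J w ^+ 2 * vexp 2 x.
Proof.
move=> hh; have [C C0 hC] := Lw_bound hh; have [c c0 hc] := @rem2_taylor R d.
set b := d%:R * (d%:R - 1) / 2 in hc.
have b0 : 0 < b by have := @d_ge2 R d hd => d2; rewrite divr_gt0// mulr_gt0//; lra.
exists (b * (C / d%:R) ^+ 2); first by rewrite mulr_gt0// exprn_gt0// divr_gt0.
move=> z w z01 Hw x hx; have /andP[_ hr] := hc _ (y01 Hw x); apply: le_trans hr _.
have -> : b * (C / d%:R) ^+ 2 * J w ^+ 2 * vexp 2 x = b * ((C * J w * vexp 1 x) / d%:R) ^+ 2.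
  rewrite (_ : (2 : R) = 1 + 1); last by lra.
  by rewrite -(vexpD 1 1); field; rewrite gt_eqF.
rewrite ler_wpM2l ?(ltW b0)// lerXn2r ?nnegrE//.
- by case/andP: (y01 Hw x).
- rewrite divr_ge0 ?(ltW d0)// mulr_ge0 ?(ltW (vexp_gt0 _ _))// mulr_ge0 ?(ltW C0)//.
  by apply: J_ge0 => t _; exact: w_ge0 Hw t.
- by rewrite ler_pM2r ?invr_gt0//; exact: (hC z w).
Qed.

(** [L chi / d] without the cut at [hs]: it extends [lam / d * chi] to the left of [hs], where [chi]
    itself is 0. *)
Definition chint a := fine (\int[mu]_(y in D) (chi y * rY (y - a / d%:R))%:E)%E.

Lemma chint_EFin a :
  (\int[mu]_(y in D) (chi y * rY (y - a / d%:R))%:E)%E = (chint a)%:E.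
Proof. by rewrite /chint fineK//; exact: integrable_fin_num (integrable_chi_rho_Y a). Qed.

Lemma chint_chi a : hs <= a -> chint a = lam / d%:R * chi a.
Proof. by move=> ha; rewrite /chint chi_eigE. Qed.

Lemma chint_ge0 a : 0 <= chint a.
Proof.
by apply: fine_ge0; apply: integral_ge0 => y _; rewrite lee_fin mulr_ge0 ?rho_Y_ge0.
Qed.

Lemma measurable_chint : measurable_fun setT chint.
Proof.
apply: measurableT_comp => //; apply: measurable_Lint => //; exact: chi_meas.
Qed.

Lemma J_window_gt0 b : hs <= b ->
  0 < fine (\int[mu]_(y in `[b, (b + 1)%R]) (wt y)%:E)%E.
Proof.
move=> hb; have iw : mu.-integrable `[b, b + 1] (fun x => (wt x)%:E).
  by apply: integrableS integrable_wt.
rewrite -lte_fin fineK; last exact: integrable_fin_num iw.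
apply: integral_itv_gt0; [lra|exact: wt_meas|].
by move=> y; rewrite in_itv /= => /andP[hy _]; apply: wt_gt0; exact: le_trans hy.
Qed.

Lemma EFin_mul_le (r k a b : R) (A B A' B' : \bar R) : A = a%:E -> B = b%:E ->
  A' = (r%:E * A)%E -> B' = (k%:E * B)%E -> (A' <= B')%E -> r * a <= k * b.
Proof. by move=> -> -> -> ->. Qed.

Lemma window_chint b r a : hs <= b -> 0 <= r ->
  (forall y, b <= y <= b + 1 -> r <= rY (y - a / d%:R)) ->
  r * fine (\int[mu]_(y in `[b, (b + 1)%R]) (wt y)%:E)%E
    <= normal_peak (sigma_nu d) * chint a.
Proof.
move=> hb r0 hr; have iw : mu.-integrable `[b, b + 1] (fun x => (wt x)%:E).
  by apply: integrableS integrable_wt.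
have pN0 := @pN_gt0 R d hd.
have IE : (\int[mu]_(y in `[b, (b + 1)%R]) (wt y)%:E)%E =
    (fine (\int[mu]_(y in `[b, (b + 1)%R]) (wt y)%:E)%E)%:E.
  by rewrite fineK//; exact: integrable_fin_num iw.
have ic := integrable_chi_rho_Y a.
apply: (EFin_mul_le IE (chint_EFin a) (integralZl _ iw _) (integralZl _ ic _));
  [exact: measurable_itv|exact: measurable_itv|].
have mk : measurable_fun setT (fun y : R => normal_peak (sigma_nu d) * (chi y * rY (y - a / d%:R))).
  apply: measurable_funM => //; apply: measurable_funM; first exact: chi_meas.
  exact: measurable_rho_Y_shift.
apply: (@le_trans _ _ (\int[mu]_(y in `[b, (b + 1)%R])
    (normal_peak (sigma_nu d) * (chi y * rY (y - a / d%:R)))%:E)%E).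
  apply: ge0_le_integral => //.
  - by move=> y _; rewrite -EFinM lee_fin; apply: mulr_ge0 => //; exact: wt_ge0.
  - apply/measurable_funTS; under eq_fun do rewrite -EFinM.
    by apply/measurable_EFinP/measurable_funM => //; exact: wt_meas.
  - exact/measurable_funTS/measurable_EFinP.
  - move=> y /=; rewrite in_itv /= => hy; rewrite -EFinM lee_fin /wt.
    have -> : normal_peak (sigma_nu d) * (chi y * rY (y - a / d%:R)) =
      rY (y - a / d%:R) * (chi y * normal_peak (sigma_nu d)) by ring.
    apply: ler_pM => //; first by rewrite mulr_ge0// rho_nu_ge0.
      exact: hr.
    by rewrite ler_wpM2l// rho_nu_le.
under [leRHS]eq_integral do rewrite -EFinM.
apply: ge0_subset_integral => //.
- exact/measurable_funTS/measurable_EFinP.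
- move=> y _; rewrite lee_fin; apply: mulr_ge0; first exact: ltW.
  by rewrite mulr_ge0 ?rho_Y_ge0.
- by move=> y /=; rewrite !in_itv /= andbT => /andP[hy _]; exact: le_trans hy.
Qed.

(** The kernel near [hs] is compared with its values on a window further right, which it favours
    more and more as [a] grows; hence a constant uniform in [a]. A strip of width [s] next to [hs]
    then changes an integral by at most a multiple of [s * chint a]. *)
Lemma chint_compare : exists2 C, 0 < C & forall x a, hs - 1 <= x <= hs + 1 ->
  hs - 1 <= a -> rY (x - a / d%:R) <= C * chint a.
Proof.
have hb : hs <= hs + 1 by lra.
have m0 := J_window_gt0 hb; set m := fine _ in m0.
(* Here [y - x <= 3], [y + x <= 2 (|hs| + 3)] and [- a / d <= |hs| + 1] bound the difference of
   squares. *)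
pose M := 3 * (2 * (`|hs| + 3) + 2 * (`|hs| + 1)).
pose c := expR (qY d * M); have c0 : 0 < c by exact: expR_gt0.
have pN0 := @pN_gt0 R d hd.
exists (c * normal_peak (sigma_nu d) / m); first by rewrite divr_gt0// mulr_gt0.
move=> x a /andP[x1 x2] ha.
have := @window_chint (hs + 1) (rY (x - a / d%:R) / c) a hb.
rewrite -/m => h.
have key y : hs + 1 <= y <= hs + 1 + 1 -> rY (x - a / d%:R) / c <= rY (y - a / d%:R).
  move=> /andP[y1 y2]; rewrite ler_pdivrMr// [leRHS]mulrC; apply: rho_Y_compare => //.
  have -> : (y - a / d%:R) ^+ 2 - (x - a / d%:R) ^+ 2 = (y - x) * (y + x - 2 * (a / d%:R)) by ring.
  have n1 := ler_norm hs; have n2 := ler_norm (- hs); rewrite normrN in n2.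
  have n0 := normr_ge0 hs.
  have ad : - (`|hs| + 1) <= a / d%:R.
    have [a0|a0] := leP 0 a.
      by apply: (@le_trans _ _ 0); [lra|rewrite divr_ge0// ltW].
    have : a <= a / d%:R.
      by rewrite ler_pdivlMr// ler_neMr// ?(ltW a0)//; have := @d_ge2 R d hd; lra.
    by lra.
  rewrite /M; apply: (@le_trans _ _ ((y - x) * (2 * (`|hs| + 3) + 2 * (`|hs| + 1)))).
    by apply: ler_wpM2l; lra.
  by apply: ler_wpM2r; lra.
have {}h := h (divr_ge0 (rho_Y_ge0 hd _) (ltW c0)) key.
have -> : c * normal_peak (sigma_nu d) / m * chint a = normal_peak (sigma_nu d) * chint a * c / m by ring.
by rewrite ler_pdivlMr// -ler_pdivrMr// mulrAC.
Qed.

Lemma chint_bounded : exists2 C, 0 < C & forall a, hs - 1 <= a <= hs + 1 -> chint a <= C.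
Proof.
pose M := (`|hs| + 1) ^+ 2.
pose r := normal_peak (sigma_nu d) * expR (- (qN d * M)).
have r0 : 0 < r by rewrite mulr_gt0 ?expR_gt0 ?pN_gt0.
have pY0 := @pY_gt0 R d hd.
pose I := fine (\int[mu]_(x in D) (wt x)%:E)%E.
have iw : mu.-integrable D (fun x => (wt x)%:E) by apply: integrableS integrable_wt.
have IE : (\int[mu]_(x in D) (wt x)%:E)%E = I%:E.
  by rewrite /I fineK//; exact: integrable_fin_num iw.
have I0 : 0 <= I by apply: fine_ge0; apply: integral_ge0 => x _; rewrite lee_fin wt_ge0.
exists (normal_peak (sigma_Y d) / r * I + 1).
  by rewrite ltr_wpDl// mulr_ge0// divr_ge0// ltW.
move=> a /andP[a1 a2]; apply: (@le_trans _ _ (normal_peak (sigma_Y d) / r * I)); last by lra.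
have qN0 : 0 <= qN d :> R.
  by have := @d_ge2 R d hd => d2; rewrite /qN divr_ge0//; lra.
have ra : r <= rN a.
  rewrite rho_nuE// ler_wpM2l ?(ltW (pN_gt0 hd))// ler_expR lerN2 ler_wpM2l//.
  rewrite /M -(real_normK (num_real a)) lerXn2r ?nnegrE ?addr_ge0//.
  have n1 := ler_norm hs; have n2 := ler_norm (- hs); rewrite normrN in n2.
  by rewrite ler_norml; apply/andP; split; lra.
rewrite -lee_fin -chint_EFin EFinM -IE -integralZl//.
apply: ge0_le_integral => //.
- by move=> y _; rewrite lee_fin mulr_ge0 ?rho_Y_ge0.
- apply/measurable_funTS/measurable_EFinP/measurable_funM; first exact: chi_meas.
  exact: measurable_rho_Y_shift.
- apply/measurable_funTS; under eq_fun do rewrite -EFinM.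
  by apply/measurable_EFinP/measurable_funM => //; exact: wt_meas.
move=> y _; rewrite -EFinM lee_fin /wt mulrCA ler_wpM2l//.
have rNa := rho_nu_gt0 hd a.
have -> : rY (y - a / d%:R) = rN y * (rY (a - y / d%:R) / rN a).
  by rewrite mulrA -rho_sym// mulrAC divff ?mul1r// gt_eqF.
rewrite mulrC ler_wpM2r ?rho_nu_ge0// ler_pM ?rho_Y_ge0 ?invr_ge0 ?(ltW rNa) ?rho_Y_le//.
by rewrite lef_pV2 ?posrE.
Qed.

Lemma measurable_chi_rho_Y b : measurable_fun setT (fun y : R => chi y * rY (y - b)).
Proof. by apply: measurable_funM; [exact: chi_meas|exact: measurable_rho_Y_shift]. Qed.

Lemma integral_short_le (f : R -> R) h k M x C : measurable_fun setT f -> h <= k ->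
  (forall y, h <= y < k -> 0 <= f y <= M) ->
  (forall y, h <= y < k -> rY (y - x / d%:R) <= C) -> 0 <= M -> 0 <= C ->
  (\int[mu]_(y in `[h, k[) (f y * rY (y - x / d%:R))%:E <= (M * C * (k - h))%:E)%E.
Proof.
move=> mf hk fM rC M0 C0.
have -> : ((M * C * (k - h))%:E = \int[mu]_(y in `[h, k[) (M * C)%:E)%E.
  rewrite integral_cst//= lebesgue_measure_itv /= lte_fin.
  move: hk; rewrite le_eqVlt => /predU1P[->|->]; last by rewrite -EFinB -EFinM.
  by rewrite ltxx subrr mulr0 mule0.
apply: ge0_le_integral => //.
- by move=> y /=; rewrite in_itv /= => /fM /andP[? _]; rewrite lee_fin mulr_ge0 ?rho_Y_ge0.
- by apply/measurable_funTS/measurable_EFinP/measurable_funM => //; exact: measurable_rho_Y_shift.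
- move=> y /=; rewrite in_itv /= => hy; rewrite lee_fin.
  by have /andP[f0 f1] := fM y hy; apply: ler_pM => //; [exact: rho_Y_ge0|exact: rC].
Qed.

(** The part lost by raising the level is an integral over the short strip [hs, h), which
    [chint_compare] bounds by a multiple of the whole. *)
Lemma chi_cut_lower : exists2 C, 0 < C & forall h x, hs <= h <= hs + 1 -> hs <= x ->
  (((1 - C * (h - hs)) * chint x)%:E <=
   \int[mu]_(a in `[h, +oo[) (chi a * rY (a - x / d%:R))%:E)%E.
Proof.
have [C C0 hC] := chint_compare; have [M M0 hM] := chi_bounded (hs + 1).
exists (M * C); first by rewrite mulr_gt0.
move=> h x /andP[h1 h2] hx.
have e : (\int[mu]_(y in D) (chi y * rY (y - x / d%:R))%:E =
   \int[mu]_(y in `[hs, h[) (chi y * rY (y - x / d%:R))%:E +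
   \int[mu]_(y in `[h, +oo[) (chi y * rY (y - x / d%:R))%:E)%E.
  rewrite -ge0_integral_setU//=.
  - by rewrite -itv_bndbnd_setU ?bnd_simp.
  - by apply/measurable_funTS/measurable_EFinP; exact: measurable_chi_rho_Y.
  - by move=> y _; rewrite lee_fin mulr_ge0 ?rho_Y_ge0.
  - apply/disj_setPS => y [/=]; rewrite !in_itv /= andbT => /andP[_ yh] hy.
    by have := lt_le_trans yh hy; rewrite ltxx.
have u : (\int[mu]_(y in `[hs, h[) (chi y * rY (y - x / d%:R))%:E <= (M * (C * chint x) * (h - hs))%:E)%E.
  apply: integral_short_le => //.
  - exact: chi_meas.
  - by move=> y /andP[y1 y2]; rewrite chi_ge0 hM// y1; apply: le_trans h2; exact: ltW.
  - move=> y /andP[y1 y2]; apply: hC; last by lra.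
    by apply/andP; split; [lra|apply: le_trans h2; exact: ltW].
  - exact: ltW.
  - by rewrite mulr_ge0 ?chint_ge0 ?(ltW C0).
rewrite chint_EFin in e.
have i0 : (0 <= \int[mu]_(y in `[hs, h[) (chi y * rY (y - x / d%:R))%:E)%E.
  by apply: integral_ge0 => y _; rewrite lee_fin mulr_ge0 ?rho_Y_ge0.
move: e u i0; case: integral => [r| |]//; case: integral => [q| |]//= [e].
rewrite !lee_fin => u _; rewrite e in u *; rewrite mulrBl mul1r.
by lra.
Qed.

Lemma J_levelE h f : hs <= h -> (forall x, hs <= x -> x < h -> f x = 0) ->
  (\int[mu]_(x in D) (f x * wt x)%:E = \int[mu]_(x in `[h, +oo[) (f x * wt x)%:E)%E.
Proof.
move=> hh f0; rewrite integral_mkcond [RHS]integral_mkcond; apply: eq_integral => x _.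
rewrite /patch; have [hx|xh] := leP h x.
  by rewrite !mem_set//= in_itv /= andbT ?(le_trans hh).
rewrite [in RHS]memNset; last by rewrite /= in_itv /= andbT leNgt xh.
by case: ifPn => //; rewrite inE => /Dset hx; rewrite f0 ?mul0r.
Qed.

Lemma inD_cut h f : inD f -> inD (fun x => if h <= x then f x else 0).
Proof.
move=> fD; apply: (@inD_le _ (fun x => `|f x|)); last exact: inD_abs.
  by apply: measurable_fun_ifT => //; [apply: measurable_fun_ler|case: fD].
by move=> x _; case: ifP => _; rewrite ?normr0.
Qed.

(** Symmetry transfers the cut at [h] from [L w] to [chi], where [chi_cut_lower] applies. *)
Lemma J_L_cut : exists2 C, 0 < C & forall h w, hs <= h <= hs + 1 -> inD w ->
  (forall x, 0 <= w x) -> (forall x, x < h -> w x = 0) ->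
  (1 - C * (h - hs)) * lam * J w <= J (fun x => if h <= x then L w x else 0).
Proof.
have [C C0 hC] := chi_cut_lower; exists C => //.
move=> h w hh wD w0 wh; have /andP[h1 h2] := hh.
have [mw _] := wD; have LD := inD_L wD; have cD := inD_cut h LD.
have wint a : (\int[mu]_(x in `[h, +oo[) (w x * rY (x - a / d%:R))%:E =
    \int[mu]_(x in D) (w x * rY (x - a / d%:R))%:E)%E.
  rewrite integral_mkcond [RHS]integral_mkcond; apply: eq_integral => x _.
  rewrite /patch; have [hx|xh] := leP h x.
    by rewrite !mem_set//= in_itv /= andbT ?(le_trans h1).
  rewrite [in LHS]memNset; last by rewrite /= in_itv /= andbT leNgt xh.
  by case: ifPn => // _; rewrite wh ?mul0r.
have e1 : (J (fun x => if h <= x then L w x else 0))%:E = (d%:R%:E * \int[mu]_(a in `[h, +oo[)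
   ((\int[mu]_(x in `[h, +oo[) (w x * rY (x - a / d%:R))%:E) * (chi a * rN a)%:E))%E.
  rewrite -J_EFin// (J_levelE h1); last by move=> x _ xh; rewrite leNgt xh.
  rewrite -ge0_integralZl//; last 2 first.
  - apply: emeasurable_funM; last by apply/measurable_funTS/measurable_EFinP; exact: wt_meas.
    by apply/measurable_funTS; apply: measurable_Lint.
  - move=> a _; apply: mule_ge0; last by rewrite lee_fin wt_ge0.
    by apply: integral_ge0 => x _; rewrite lee_fin mulr_ge0 ?rho_Y_ge0.
  apply: eq_integral => a; rewrite inE /= in_itv /= andbT => ha.
  rewrite ha wint L_EFin//; last exact: le_trans ha.
  by rewrite -!EFinM; congr EFin; rewrite /wt; field; rewrite gt_eqF.
rewrite -lee_fin e1 Lop_sym//; last exact: chi_meas.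
have c1 (x : R) : h <= x -> (((1 - C * (h - hs)) * (lam / d%:R * chi x))%:E <=
   \int[mu]_(a in `[h, +oo[) (chi a * rY (a - x / d%:R))%:E)%E.
  by move=> hx; have hx' := le_trans h1 hx; rewrite -chint_chi//; exact: hC.
have [neg|pos] := leP (1 - C * (h - hs)) 0.
  apply: (@le_trans _ _ 0%E).
    rewrite lee_fin -mulrA mulr_le0_ge0// mulr_ge0 ?(ltW lam_gt0)//.
    by apply: J_ge0 => x _; exact: w0.
  apply: mule_ge0; first by rewrite lee_fin ltW.
  apply: integral_ge0 => x _; apply: mule_ge0; last by rewrite lee_fin mulr_ge0 ?rho_nu_ge0.
  by apply: integral_ge0 => y _; rewrite lee_fin mulr_ge0 ?rho_Y_ge0.
set q := 1 - C * (h - hs) in pos c1 *.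
apply: (@le_trans _ _ (d%:R%:E * \int[mu]_(x in `[h, +oo[) ((q * (lam / d%:R))%:E * (w x * wt x)%:E))%E).
  rewrite integralZl//; last first.
    by apply: integrableS (proj2 wD) => // x /=; rewrite !in_itv /= !andbT; exact: le_trans.
  rewrite -(J_levelE h1); last by move=> x _ /wh.
  by rewrite J_EFin// -!EFinM lee_fin le_eqVlt; apply/orP; left; apply/eqP; field; rewrite gt_eqF.
rewrite lee_pmul2l ?lte_fin//.
apply: ge0_le_integral => //.
- move=> x _; rewrite -EFinM lee_fin; apply: mulr_ge0; first by rewrite mulr_ge0 ?divr_ge0 ?ltW.
  by apply: mulr_ge0 => //; exact: wt_ge0.
- apply/measurable_funTS; under eq_fun do rewrite -EFinM.
  apply/measurable_EFinP/measurable_funM => //; apply: measurable_funM => //; exact: wt_meas.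
- apply: emeasurable_funM.
    by apply/measurable_funTS; apply: measurable_Lint => //; exact: chi_meas.
  apply/measurable_funTS/measurable_EFinP/measurable_funM => //; exact: measurable_rho_nu.
- move=> x /=; rewrite in_itv /= andbT => hx.
  apply: le_trans (lee_wpmul2r _ (c1 x hx)); last by rewrite lee_fin mulr_ge0 ?rho_nu_ge0.
  by rewrite -!EFinM lee_fin /wt le_eqVlt; apply/orP; left; apply/eqP; ring.
Qed.

(** For [h] close to [hs] the linear part of the equation still multiplies [J w] by more than 1, so
    the quadratic remainder has to compensate; this keeps [J w] above a positive constant as [z]
    tends to 1. *)
Lemma supercritical : 1 < lam -> exists2 dl, 0 < dl & forall h, hs <= h <= hs + dl ->
  exists e z0, [/\ 0 < e, 0 <= z0 < 1 & forall z w, z0 <= z < 1 -> is_w h z w ->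
    e <= fine (\int[mu]_(x in D) (w x * rN x)%:E)%E].
Proof.
move=> l1; have [C C0 hC] := J_L_cut.
pose dl := Num.min 1 ((lam - 1) / (2 * C * lam)).
have dl0 : 0 < dl by rewrite lt_min ltr01 divr_gt0 ?subr_gt0// !mulr_gt0.
exists dl => // h /andP[h1 h2].
have dl1 : dl <= 1 by rewrite ge_min lexx.
have hh : hs <= h <= hs + 1 by rewrite h1; lra.
have q1 : (1 + lam) / 2 <= (1 - C * (h - hs)) * lam.
  have : C * (h - hs) * lam <= (lam - 1) / 2.
    have -> : (lam - 1) / 2 = C * ((lam - 1) / (2 * C * lam)) * lam by field; rewrite !gt_eqF.
    rewrite ler_wpM2r ?(ltW lam_gt0)// ler_wpM2l ?(ltW C0)//.
    by apply: (@le_trans _ _ dl); [lra|rewrite ge_min lexx orbT].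
  by lra.
have [Cr Cr0 hCr] := rem_bound h1; have [Cw Cw0 hCw] := w_bound h1.
pose K := Cr * J (vexp 2); have K0 : 0 < K by rewrite mulr_gt0// J_vexp_gt0.
(* Chosen so that [z0 * (1 + lam) / 2] is [(3 + lam) / 4], halfway between 1 and the growth factor
   [(1 + lam) / 2] left after the cut. *)
pose z0 := 2 * (3 + lam) / (4 * (1 + lam)).
have l0 : 0 < 1 + lam by lra.
have z01 : 0 <= z0 < 1.
  apply/andP; split; first by apply: divr_ge0; lra.
  by rewrite /z0 ltr_pdivrMr ?mul1r; lra.
have zq : z0 * ((1 + lam) / 2) = (3 + lam) / 4 by rewrite /z0; field; rewrite gt_eqF.
pose c0 := (lam - 1) / (4 * K).
have c00 : 0 < c0 by rewrite divr_gt0 ?subr_gt0// mulr_gt0.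
exists (c0 ^+ 2 / 4), z0; split=> //; first by rewrite divr_gt0// exprn_gt0.
move=> z w /andP[zz0 z1] Hw.
have z01' : 0 <= z < 1 by case/andP: z01 => z00 _; apply/andP; split; lra.
have [Jw0 _ _] := hCw z w z01' Hw; have wD := inD_w Hw.
have [mw w01 wh weq] := Hw.
have wge0 x : 0 <= w x by case/andP: (w01 x).
have LD := inD_L wD; have rD := inD_rem2 Hw.
have j1 : z * J (fun x => if h <= x then L w x else 0) - J (fun x => rem2 d (L w x / d%:R)) <= J w.
  have -> : z * J (fun x => if h <= x then L w x else 0) - J (fun x => rem2 d (L w x / d%:R)) =
      J (fun x => z * (if h <= x then L w x else 0) + (-1) * rem2 d (L w x / d%:R)).
    by rewrite J_lin; [rewrite JZ//; ring|exact: inD_cut|exact: inDZ].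
  apply: J_le => //; first by apply: inD_lin; [exact: inD_cut|exact: inDZ].
  move=> x hx; have r0 := rem2_ge0 Hw x; case: ifPn => hhx; last first.
    by have := wge0 x; lra.
  rewrite (w_rem2 Hw hhx).
  have : z * rem2 d (L w x / d%:R) <= 1 * rem2 d (L w x / d%:R).
    by apply: ler_wpM2r => //; exact: ltW.
  by lra.
have j2 : J (fun x => rem2 d (L w x / d%:R)) <= K * J w ^+ 2.
  have -> : K * J w ^+ 2 = Cr * J w ^+ 2 * J (vexp 2) by rewrite /K; ring.
  rewrite -JZ; last exact: inD_vexp.
  apply: J_le => //; first exact/inDZ/inD_vexp.
  by move=> x hx; exact: (hCr z w z01' Hw x hx).
have j3 : (3 + lam) / 4 * J w <= z * J (fun x => if h <= x then L w x else 0).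
  apply: (@le_trans _ _ (z * ((1 + lam) / 2 * J w))).
    rewrite mulrA ler_wpM2r ?(ltW Jw0)// -zq ler_wpM2r//; lra.
  rewrite ler_wpM2l//; first by case/andP: z01'.
  apply: le_trans (hC h w hh wD wge0 wh); rewrite ler_wpM2r ?(ltW Jw0)//.
have j4 : c0 <= J w.
  rewrite /c0 ler_pdivrMr; last exact: mulr_gt0.
  have : (lam - 1) / 4 * J w <= K * J w * J w by rewrite expr2 in j2; lra.
  by rewrite ler_pM2r//; lra.
have iw : mu.-integrable D (fun x => (w x * rN x)%:E).
  apply: (@le_integrableR _ _ _ _ (fun x => vexp 0 x * rN x)) => //.
  - by apply/measurable_funTS/measurable_funM => //; exact: measurable_rho_nu.
  - move=> x _; rewrite /vexp mul0r expR0 ger0_norm ?mulr_ge0 ?rho_nu_ge0//.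
    by rewrite ler_wpM2r ?rho_nu_ge0//; case/andP: (w01 x).
  - by apply: integrableS (integrable_vexp_rho_nu hd 0).
pose V := fine (\int[mu]_(x in D) (w x * rN x)%:E)%E; rewrite -[leRHS]/V.
have VE : (\int[mu]_(x in D) (w x * rN x)%:E)%E = V%:E.
  by rewrite /V fineK//; exact: integrable_fin_num iw.
pose t := c0 / 2; have t0 : 0 < t by rewrite divr_gt0.
(* From the pairing with [chi] to the integral against [nu]: since [w <= 1],
   [w chi <= w / t + t chi^2], and [chi] has unit norm. With [t = c0 / 2] this yields
   [c0^2 / 4 <= V]. *)
have j5 : J w <= V / t + t.
  have -> : V / t + t = fine (\int[mu]_(x in D) (t^-1 * (w x * rN x) + t * (chi x * wt x))%:E)%E.
    under eq_integral do rewrite EFinD !EFinM -!EFinM (EFinM t^-1) (EFinM t).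
    rewrite integralD//; last 2 first.
    - exact: integrableZl.
    - by apply: integrableZl => //; case: inD_chi.
    rewrite !integralZl//; last by case: inD_chi.
    by rewrite VE (J_EFin inD_chi) J_chi -!EFinM -EFinD /= mulr1 mulrC.
  apply: le_Rintegral => //; first by case: wD.
    apply: integrableDR => //; apply: integrableZR => //; by case: inD_chi.
  move=> x _; rewrite /wt !mulrA -mulrDl ler_wpM2r ?rho_nu_ge0//.
  have /andP[a1 a2] := w01 x; have cx := chi_ge0 x.
  apply: (@le_trans _ _ ((w x + (t * chi x) ^+ 2) / t)); last first.
    by rewrite le_eqVlt; apply/orP; left; apply/eqP; field; rewrite gt_eqF.
  rewrite ler_pdivlMr//.
  have := sqr_ge0 (t * chi x - w x); have : w x * w x <= w x * 1 by rewrite ler_wpM2l.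
  have : 0 <= (t * chi x) ^+ 2 by exact: sqr_ge0.
  by rewrite !expr2; lra.
have : (c0 - t) * t <= V by rewrite -ler_pdivlMr//; lra.
by rewrite /t; lra.
Qed.

Lemma chint_lower B : exists2 c, 0 < c & forall a, hs - 1 <= a <= B -> c <= chint a.
Proof.
have m0 := J_window_gt0 (lexx hs); set m := fine _ in m0.
pose M := (`|hs| + 1 + (`|hs| + 1 + `|B|)) ^+ 2.
pose r := normal_peak (sigma_Y d) * expR (- (qY d * M)).
have r0 : 0 < r by rewrite mulr_gt0 ?expR_gt0 ?pY_gt0.
have pN0 := @pN_gt0 R d hd.
exists (r * m / normal_peak (sigma_nu d)); first by rewrite divr_gt0// mulr_gt0.
move=> a /andP[a1 a2]; rewrite ler_pdivrMr// mulrC [leRHS]mulrC mulrC.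
apply: window_chint => //; first exact: ltW.
move=> y /andP[y1 y2]; apply: rho_Y_lower => //.
rewrite -(real_normK (num_real (y - a / d%:R))) /M lerXn2r ?nnegrE//.
apply: le_trans (ler_normB _ _) _; apply: lerD.
  have := ler_norm hs; have := ler_norm (- hs); rewrite normrN => ? ?.
  by rewrite ler_norml; apply/andP; split; lra.
rewrite normrM normfV (ger0_norm (ltW d0)).
have d2 := @d_ge2 R d hd.
apply: (@le_trans _ _ `|a|).
  by rewrite ler_pdivrMr// ler_peMr//; lra.
have := ler_norm hs; have := ler_norm (- hs); rewrite normrN => ? ?.
have := ler_norm B; have := normr_ge0 B; have := normr_ge0 hs => ? ? ?.
by rewrite ler_norml; apply/andP; split; lra.
Qed.

Lemma chi_integral_level h x : h <= hs ->
  (\int[mu]_(y in `[h, +oo[) (chi y * rY (y - x / d%:R))%:E = (chint x)%:E)%E.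
Proof.
move=> hh; rewrite -chint_EFin integral_mkcond [RHS]integral_mkcond.
apply: eq_integral => y _; rewrite /patch; have [hy|yh] := leP hs y.
  by rewrite !mem_set//= in_itv /= andbT// (le_trans hh).
rewrite [in RHS]memNset; last by rewrite /= in_itv /= andbT leNgt yh.
by case: ifP => // _; rewrite chi_lt ?mul0r.
Qed.

(** Symmetry moves the kernel onto the constant 1, whose average is at most 1; what remains is the
    integral of [chi rho_nu]. *)
Lemma integrable_chint_rho_nu h : h <= hs ->
  mu.-integrable `[h, +oo[ (fun a => (chint a * rN a)%:E).
Proof.
move=> hh.
have mcr : measurable_fun setT (fun a : R => chint a * rN a).
  by apply: measurable_funM; [exact: measurable_chint|exact: measurable_rho_nu].
apply: ge0_integrable => //.
- exact: measurable_funTS.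
- by move=> a _; rewrite mulr_ge0 ?chint_ge0 ?rho_nu_ge0.
have iw := integrable_wt; have : (\int[mu]_x (wt x)%:E < +oo)%E.
  by rewrite -ge0_fin_numE; [exact: integrable_fin_num iw|apply: integral_ge0 => x _; rewrite lee_fin wt_ge0].
apply: le_lt_trans.
have -> : (\int[mu]_(a in `[h, +oo[) (chint a * rN a)%:E)%E =
   (\int[mu]_(a in `[h, +oo[) ((\int[mu]_(x in `[h, +oo[) (chi x * rY (x - a / d%:R))%:E) * (1 * rN a)%:E))%E.
  by apply: eq_integral => a _; rewrite chi_integral_level// mul1r -EFinM.
rewrite (@Lop_sym _ _ _ h chi (fun=> 1))//; last exact: chi_meas.
apply: (@le_trans _ _ (\int[mu]_(x in `[h, +oo[) (wt x)%:E)%E); last first.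
  apply: ge0_subset_integral => //.
  - by apply/measurable_EFinP; exact: wt_meas.
  - by move=> x _; rewrite lee_fin wt_ge0.
apply: ge0_le_integral => //.
- move=> x _; apply: mule_ge0; last by rewrite lee_fin wt_ge0.
  by apply: integral_ge0 => y _; rewrite lee_fin mul1r rho_Y_ge0.
- apply: emeasurable_funM; last by apply/measurable_funTS/measurable_EFinP; exact: wt_meas.
  by apply/measurable_funTS; apply: (@measurable_Lint _ _ _ h (fun=> 1)).
- by apply/measurable_funTS/measurable_EFinP; exact: wt_meas.
- move=> x _; rewrite -[leRHS]mul1e; apply: lee_wpmul2r; first by rewrite lee_fin wt_ge0.
  exact: rho_Y_integral_le1.
Qed.

(** [chint] is positive also slightly below [hs], and the room between [lam] and 1 makes it a
    supersolution on [h, oo) with factor [th < 1]. Pairing with it gives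
    [X <= (1 - z) * Ig + th * X], so [X] vanishes as [z] tends to 1. *)
Lemma subcritical : lam < 1 -> exists2 h : R, h < hs & forall e : R, 0 < e ->
  exists2 z0 : R, 0 <= z0 < 1 & forall (z : R) (w : R -> R), z0 <= z < 1 ->
    measurable_fun setT w ->
    (forall x, 0 <= w x <= 1) -> (forall x, h <= x -> w x <= (1 - z) + Lop d h w x) ->
    fine (\int[mu]_(x in `[h, +oo[) (w x * rN x)%:E)%E <= e.
Proof.
move=> l1; have [C C0 hC] := chint_compare; have [Sg Sg0 hSg] := chint_bounded.
(* The strip [h, hs) adds at most [d * Sg * C * dl <= (1 - lam) / 2] to the factor [lam]. *)
pose dl := Num.min 1 ((1 - lam) / (2 * (d%:R * Sg * C))).
have dSC : 0 < d%:R * Sg * C by rewrite !mulr_gt0.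
have dl0 : 0 < dl by rewrite lt_min ltr01 divr_gt0 ?subr_gt0// mulr_gt0.
have dl1 : dl <= 1 by rewrite ge_min lexx.
pose h := hs - dl; exists h; first by rewrite /h; lra.
have hh : h <= hs by rewrite /h; lra.
have h1 : hs - 1 <= h by rewrite /h; lra.
pose th := (1 + lam) / 2; have th1 : th < 1 by rewrite /th; lra.
have ig := integrable_chint_rho_nu hh.
pose Ig := fine (\int[mu]_(a in `[h, +oo[) (chint a * rN a)%:E)%E.
have Ig0 : 0 <= Ig.
  by apply: fine_ge0; apply: integral_ge0 => a _; rewrite lee_fin mulr_ge0 ?chint_ge0 ?rho_nu_ge0.
have IgE : (\int[mu]_(a in `[h, +oo[) (chint a * rN a)%:E)%E = Ig%:E.
  by rewrite /Ig fineK//; exact: integrable_fin_num ig.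
have sup x : h <= x -> (\int[mu]_(a in `[h, +oo[) (chint a * rY (a - x / d%:R))%:E <=
    (th / d%:R * chint x)%:E)%E.
  move=> hx.
  have -> : (\int[mu]_(a in `[h, +oo[) (chint a * rY (a - x / d%:R))%:E =
     \int[mu]_(y in `[h, hs[) (chint y * rY (y - x / d%:R))%:E +
     \int[mu]_(y in D) (chint y * rY (y - x / d%:R))%:E)%E.
    rewrite -ge0_integral_setU//=.
    - by rewrite -itv_bndbnd_setU ?bnd_simp.
    - apply/measurable_funTS/measurable_EFinP/measurable_funM; first exact: measurable_chint.
      exact: measurable_rho_Y_shift.
    - by move=> y _; rewrite lee_fin mulr_ge0 ?chint_ge0 ?rho_Y_ge0.
    - apply/disj_setPS => y [/=]; rewrite !in_itv /= andbT => /andP[_ yh] hy.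
      by have := lt_le_trans yh hy; rewrite ltxx.
  have -> : (\int[mu]_(y in D) (chint y * rY (y - x / d%:R))%:E = (lam / d%:R * chint x)%:E)%E.
    transitivity (\int[mu]_(y in D) ((lam / d%:R)%:E * (chi y * rY (y - x / d%:R))%:E))%E.
      by apply: eq_integral => y; rewrite inE => /Dset hy; rewrite chint_chi// -EFinM mulrA.
    by rewrite integralZl//; [rewrite chint_EFin|exact: integrable_chi_rho_Y].
  have u : (\int[mu]_(y in `[h, hs[) (chint y * rY (y - x / d%:R))%:E <=
      (Sg * (C * chint x) * (hs - h))%:E)%E.
    apply: integral_short_le => //.
    - exact: measurable_chint.
    - by move=> y /andP[y1 y2]; rewrite chint_ge0 hSg//; apply/andP; split; lra.
    - by move=> y /andP[y1 y2]; apply: hC; [apply/andP; split; lra|lra].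
    - exact: ltW.
    - by rewrite mulr_ge0 ?chint_ge0 ?(ltW C0).
  apply: le_trans (leeD u (lexx _)) _; rewrite -EFinD lee_fin.
  have -> : Sg * (C * chint x) * (hs - h) + lam / d%:R * chint x =
     (d%:R * Sg * C * dl + lam) / d%:R * chint x by rewrite /h; field; rewrite gt_eqF.
  rewrite ler_wpM2r ?chint_ge0// ler_pM2r ?invr_gt0//.
  have : d%:R * Sg * C * dl <= d%:R * Sg * C * ((1 - lam) / (2 * (d%:R * Sg * C))).
    by rewrite ler_pM2l// ge_min lexx orbT.
  have -> : d%:R * Sg * C * ((1 - lam) / (2 * (d%:R * Sg * C))) = (1 - lam) / 2.
    by field; rewrite !gt_eqF.
  by rewrite /th; lra.
pose Q := expR (1 ^+ 2 * sigma_nu d ^+ 2 / 2) : R.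
have Q0 : 0 < Q by exact: expR_gt0.
(* Above [B] the mass of [nu] is at most [exp (- B) * Q <= e / 2] by its exponential moment; below
   [B] the function [chint] is bounded away from 0, so the pairing controls the integral of [w]. *)
move=> e e0; pose B := Num.max hs (ln (2 * Q / e)).
have BQ : expR (- B) * Q <= e / 2.
  have : expR (- B) <= expR (- ln (2 * Q / e)) by rewrite ler_expR lerN2 le_max lexx orbT.
  rewrite [leRHS]expRN lnK ?posrE ?divr_gt0 ?mulr_gt0// => hB.
  apply: (@le_trans _ _ ((2 * Q / e)^-1 * Q)); first by rewrite ler_wpM2r// ltW.
  by rewrite le_eqVlt; apply/orP; left; apply/eqP; field; rewrite !gt_eqF.
have [c c0 hc] := chint_lower B.
(* For [1 - z <= q] the bound [(1 - z) * Ig / (1 - th)] on the pairing is at most [c * e / 2];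
   adding 1 to [Ig] keeps the denominator positive. *)
pose q := c * (1 - th) * e / (2 * (Ig + 1)).
have q0 : 0 < q by rewrite divr_gt0 ?mulr_gt0 ?subr_gt0//; lra.
exists (Num.max 0 (1 - q)).
  by rewrite le_max lexx /= gt_max ltr01 /=; lra.
move=> z w /andP[]; rewrite ge_max => /andP[z0 zq] z1 mw w01 wle.
have w0 x : 0 <= w x by case/andP: (w01 x).
have iX := integrable_weighted hd mw w01 measurable_chint chint_ge0 ig.
have iL := integrable_Lop_weighted hd mw w01 measurable_chint chint_ge0 ig.
pose X := Rintegral mu `[h, +oo[ (fun x => w x * (chint x * rN x)).
have XX : X <= (1 - z) * Ig + th * X.
  have Lle := Lop_weighted_le hd mw w01 measurable_chint chint_ge0 ig sup.
  have dth : d%:R * (th / d%:R) = th by field; rewrite gt_eqF.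
  rewrite dth -/X in Lle.
  apply: le_trans (_ : Rintegral mu `[h, +oo[ (fun x => (1 - z) * (chint x * rN x) +
      Lop d h w x * (chint x * rN x)) <= _).
    apply: le_Rintegral; [exact: measurable_itv|exact: iX| |].
      apply: integrableDR; [exact: measurable_itv| |exact: iL].
      by apply: integrableZR => //; exact: measurable_itv.
    move=> x /=; rewrite in_itv /= andbT => hx; rewrite -mulrDl.
    by apply: ler_wpM2r; [rewrite mulr_ge0 ?chint_ge0 ?rho_nu_ge0|exact: wle].
  rewrite RintegralD; [|exact: measurable_itv| |exact: iL]; last first.
    by apply: integrableZR => //; exact: measurable_itv.
  rewrite (RintegralZl _ _ ig)//; exact: lerD.
have X1 : X <= (1 - z) * Ig / (1 - th) by rewrite ler_pdivlMr ?subr_gt0//; lra.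
have ivN : mu.-integrable `[h, +oo[ (fun x => (vexp 1 x * rN x)%:E).
  by apply: integrableS (integrable_vexp_rho_nu hd 1).
have iwN : mu.-integrable `[h, +oo[ (fun x => (w x * rN x)%:E).
  apply: (@le_integrableR _ _ _ _ (fun x => vexp 0 x * rN x)) => //.
  - by apply/measurable_funTS/measurable_funM => //; exact: measurable_rho_nu.
  - move=> x _; rewrite /vexp mul0r expR0 ger0_norm ?mulr_ge0 ?rho_nu_ge0//.
    by rewrite ler_wpM2r ?rho_nu_ge0//; case/andP: (w01 x).
  - by apply: integrableS (integrable_vexp_rho_nu hd 0).
apply: (@le_trans _ _ (Rintegral mu `[h, +oo[ (fun x => c^-1 * (w x * (chint x * rN x)) + expR (- B) * (vexp 1 x * rN x)))).
  apply: le_Rintegral => //.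
    by apply: integrableDR; [exact: measurable_itv|apply: integrableZR|apply: integrableZR];
      try exact: measurable_itv.
  move=> x /=; rewrite in_itv /= andbT => hx.
  have -> : c^-1 * (w x * (chint x * rN x)) + expR (- B) * (vexp 1 x * rN x) =
    (w x * (chint x / c) + expR (- B) * vexp 1 x) * rN x by ring.
  rewrite ler_wpM2r ?rho_nu_ge0//.
  have p1 : 0 <= expR (- B) * vexp 1 x by rewrite mulr_ge0 ?expR_ge0.
  have p2 : 0 <= w x * (chint x / c) by rewrite mulr_ge0// divr_ge0 ?chint_ge0 ?ltW.
  have [xB|Bx] := leP x B.
    have cx : c <= chint x by apply: hc; rewrite xB andbT; exact: le_trans hx.
    have c1 : 1 <= chint x / c by rewrite ler_pdivlMr ?mul1r.
    have := ler_peMr (w0 x) c1.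
    by lra.
  have : 1 <= expR (- B) * vexp 1 x.
    by rewrite /vexp -expRD -[leLHS]expR0 ler_expR; lra.
  by case/andP: (w01 x) => _ ?; lra.
rewrite (RintegralD _ (integrableZR _ _ iX) (integrableZR _ _ ivN)); try exact: measurable_itv.
rewrite (RintegralZl _ _ iX) ?(RintegralZl _ _ ivN); try exact: measurable_itv.
have V1 : Rintegral mu `[h, +oo[ (fun x => vexp 1 x * rN x) <= Q.
  rewrite -lee_fin /Rintegral fineK; last exact: integrable_fin_num ivN.
  rewrite /Q -integral_vexp_rho_nu//; apply: ge0_subset_integral => //.
  - apply/measurable_EFinP/measurable_funM; first exact: measurable_vexp.
    exact: measurable_rho_nu.
  - by move=> x _; rewrite lee_fin mulr_ge0 ?expR_ge0 ?rho_nu_ge0.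
have a1 : expR (- B) * Rintegral mu `[h, +oo[ (fun x => vexp 1 x * rN x) <= e / 2.
  by apply: le_trans BQ; rewrite ler_wpM2l ?expR_ge0.
have a2 : c^-1 * X <= e / 2.
  rewrite mulrC ler_pdivrMr//; apply: le_trans X1 _.
  rewrite ler_pdivrMr ?subr_gt0//.
  have : (1 - z) * Ig <= q * (Ig + 1) by apply: ler_pM => //; lra.
  have -> : q * (Ig + 1) = e / 2 * c * (1 - th).
    by rewrite /q; field; apply/negP => /eqP; lra.
  by [].
by rewrite -/X; lra.
Qed.

Section critical.
Hypothesis lam1 : lam = 1.

Lemma L_chi a : L chi a = chi a. Proof. by rewrite chi_eig lam1 mul1r. Qed.

Lemma JL f : inD f -> J (L f) = J f.
Proof. by move=> fD; case: (J_L fD) => _ ->; rewrite lam1 mul1r. Qed.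

Lemma iterL_spec f m : inD f -> (forall x, hs <= x -> 0 <= f x) ->
  [/\ inD (iter m L f), forall x, hs <= x -> 0 <= iter m L f x & J (iter m L f) = J f].
Proof.
move=> fD f0; elim: m => [//|m [mD m0 Jm]] /=; split.
- exact: inD_L.
- by move=> x _; apply: L_ge0.
- by rewrite JL.
Qed.

(* splitting [chi] at a high level [B]: the part below is pushed under a fixed multiple
   of [vexp 1] by iterating [L], the part above has small mass *)
Lemma chi_le_vexp : exists2 C, 0 < C & forall x, hs <= x -> chi x <= C * vexp 1 x.
Proof.
have [C C0 hC] := L_lyapunov ltr01.
exists (2 * C); first by rewrite mulr_gt0.
move=> x hx; apply/ler_addgt0Pr => e e0.
have [Cx Cx0 hCx] := L_harnack x.
have [B hB] := J_tail inD_chi (fun t _ => chi_ge0 t) (divr_gt0 (divr_gt0 e0 (ltr0n _ 2)) Cx0).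
set g := (fun t => chi t * above B t) in hB.
pose f t := (-1) * g t + chi t.
have gD : inD g by exact/inD_above/inD_chi.
have fD : inD f by apply: inD_lin => //; exact: inD_chi.
have g0 t : 0 <= g t by rewrite mulr_ge0// /above; case: ifP.
have f0 t : 0 <= f t.
  by rewrite /f /g /above; case: ifP => _; rewrite ?mulr1 ?mulr0 ?mulN1r ?addNr ?mulr0 ?add0r.
have [M M0 hM] := chi_bounded B.
pose v := vexp 1 hs; have v0 : 0 < v by exact: vexp_gt0.
have Jf : J f <= 1.
  rewrite -J_chi; apply: J_le => //; first exact: inD_chi.
  by move=> t _; rewrite /f mulN1r gerDr oppr_le0.
(* [B] and [M] depend on [x] and [e], but their effect carries the factor [(1 / 2) ^+ m]; the
   surviving constant [2 * C] does not depend on them. *)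
have step m : forall t, hs <= t -> iter m L f t <= (2 * C + M / v * (1 / 2) ^+ m) * vexp 1 t.
  elim: m => [|m ih] t ht.
    rewrite expr0 mulr1 /=; apply: (@le_trans _ _ (M / v * vexp 1 t)).
      rewrite /f /g /above; case: ltP => tB.
        by rewrite mulr1 mulN1r addNr mulr_ge0 ?divr_ge0 ?ltW ?vexp_gt0.
      rewrite mulr0 mulr0 add0r mulrAC -mulrA; apply: le_trans (hM t _) _; first by rewrite ht.
      by rewrite ler_peMr ?(ltW M0)// ler_pdivlMr// mul1r; exact: vexp_ge.
    by rewrite ler_wpM2r ?lerDr ?mulr_ge0 ?ltW ?vexp_gt0.
  have [mD m0 Jm] := @iterL_spec f m fD (fun t _ => f0 t).
  apply: (@le_trans _ _ ((C * J (iter m L f) + (2 * C + M / v * (1 / 2) ^+ m) / 2) * vexp 1 t)).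
    apply: hC => //; last by move=> u hu; rewrite m0 ?ih.
    apply: addr_ge0; first by lra.
    by apply: mulr_ge0; [rewrite divr_ge0 ?ltW|rewrite exprn_ge0].
  rewrite ler_wpM2r ?(ltW (vexp_gt0 _ _))// Jm exprS.
  have : C * J f <= C * 1 by rewrite ler_wpM2l// ltW.
  by set q := (1 / 2) ^+ m; lra.
have chiE m : iter m L f x + iter m L g x = chi x.
  elim: m x hx {hCx Cx Cx0 hB} => [|m ih] t ht /=.
    by rewrite /f; ring.
  have [mD _ _] := @iterL_spec f m fD (fun t _ => f0 t).
  have [mG _ _] := @iterL_spec g m gD (fun t _ => g0 t).
  rewrite -[L (iter m L f) t]mul1r -L_lin// -L_chi; apply: L_eq => u hu.
  by rewrite mul1r ih.
(* Iteration preserves [J], so the upper part keeps its small mass, and the Harnack inequality at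
   the fixed point [x] bounds its value. *)
have tail m : iter m.+1 L g x <= e / 2.
  have [mG m0 Jm] := @iterL_spec g m gD (fun t _ => g0 t).
  apply: (@le_trans _ _ (Cx * J (iter m L g))); first by apply: hCx => //; rewrite hx lexx.
  by rewrite Jm mulrC -ler_pdivlMr// ltW.
have cv : (M / v * (1 / 2) ^+ m) * vexp 1 x @[m --> \oo] --> 0.
  rewrite -(mul0r (vexp 1 x)) -(mulr0 (M / v)); apply: cvgMl; apply: cvgMr.
  by apply: cvg_expr; rewrite ger0_norm; lra.
have e20 : 0 < e / 2 by lra.
move/cvgrPdist_lt: cv => /(_ _ e20) [N _ /(_ N.+1 (leqnSn N))] /=.
rewrite sub0r normrN => /ltW /(le_trans (ler_norm _)) hN.
by rewrite -(chiE N.+1); have := step N.+1 x hx; have := tail N; rewrite mulrDl; lra.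
Qed.

Lemma inD_unit_indic : inD (fun x => if x <= hs + 1 then 1 else 0).
Proof.
apply: (@inD_le _ (cst 1)); last exact: inD_cst.
  by apply: measurable_fun_ifT => //; apply: measurable_fun_ler.
by move=> x _; case: ifP => _; rewrite ?normr1 ?normr0.
Qed.

Lemma J_unit_indic_gt0 : 0 < J (fun x => if x <= hs + 1 then 1 else 0).
Proof.
rewrite -lte_fin -(J_EFin inD_unit_indic).
have mfw : measurable_fun setT (fun x : R => (if x <= hs + 1 then 1 else 0) * wt x).
  by apply: measurable_funM; [case: inD_unit_indic|exact: wt_meas].
apply: (@lt_le_trans _ _ (\int[mu]_(x in `[hs, (hs + 1)%R])
    ((if x <= hs + 1 then 1 else 0) * wt x)%:E)%E).
  apply: integral_itv_gt0 => //; first lra.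
  by move=> x; rewrite in_itv /= => /andP[hx ->]; rewrite mul1r wt_gt0.
apply: ge0_subset_integral => //.
- exact/measurable_funTS/measurable_EFinP.
- by move=> x _; rewrite lee_fin; apply: mulr_ge0; [case: ifP|exact: wt_ge0].
- by move=> x /=; rewrite !in_itv /= andbT => /andP[].
Qed.

(* spectral gap: on the orthogonal of [chi], positive and negative parts of [r] have the
   same mass, so the minorization makes them cancel, while [vexp 2] controls the tails *)
Lemma spectral_gap : exists2 C, 0 < C & forall (r : R -> R) (E M0 : R), inD r -> J r = 0 ->
  0 <= E -> (forall x, hs <= x -> `|r x - L r x| <= E * vexp 2 x) ->
  0 <= M0 -> (forall x, hs <= x -> `|r x| <= M0 * vexp 2 x) ->
  forall x, hs <= x -> `|r x| <= C * E * vexp 2 x.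
Proof.
have [C C0 hC] := L_lyapunov (ltr0n R 2).
(* With tail mass at most [1 / (8 C)] the term [C * 2 M dl] is at most [M / 4]; with the [M / 2] of
   the drift condition this gives the contraction factor 3/4. *)
have C8 : 0 < (8 * C)^-1 by rewrite invr_gt0 mulr_gt0.
have [B] := J_tail (inD_vexp 2) (fun t _ => ltW (vexp_gt0 2 t)) C8.
set dl := J _ => hdl.
have [ep ep0 hep] := minorization B.
have j0 := J_unit_indic_gt0; set j := J _ in j0.
have V20 := J_vexp_gt0 2.
pose K := C * J (vexp 2) / (ep * j) + 1.
have K1 : 0 <= C * J (vexp 2) / (ep * j).
  by apply: divr_ge0; apply: mulr_ge0; exact: ltW.
have K0 : 0 < K by rewrite /K ltr_wpDl.
exists (4 * K); first by rewrite mulr_gt0.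
move=> r E M0 rD Jr E0 re M00 rM0.
have aD := inD_abs rD.
pose N := J (fun x => `|r x|).
pose fp x := (1 / 2) * `|r x| + (1 / 2) * r x.
pose fm x := (1 / 2) * `|r x| + (- (1 / 2)) * r x.
have hD : inD (fun x => (1 / 2) * r x) by exact: inDZ.
have hD' : inD (fun x => (- (1 / 2)) * r x) by exact: inDZ.
have pD : inD fp by exact: inD_lin.
have mD : inD fm by exact: inD_lin.
have nr x : - `|r x| <= r x <= `|r x| by rewrite -ler_norml.
have p0 x : hs <= x -> 0 <= fp x <= `|r x|.
  by move=> _; have /andP[? ?] := nr x; rewrite /fp; apply/andP; split; lra.
have m0 x : hs <= x -> 0 <= fm x <= `|r x|.
  by move=> _; have /andP[? ?] := nr x; rewrite /fm; apply/andP; split; lra.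
have Jp : J fp = N / 2 by rewrite J_lin// JZ// Jr -/N; lra.
have Jm : J fm = N / 2 by rewrite J_lin// JZ// Jr -/N; lra.
have Lp x : L fp x = (1 / 2) * L (fun x => `|r x|) x + (1 / 2) * L r x.
  by rewrite L_lin// LZ.
have Lm x : L fm x = (1 / 2) * L (fun x => `|r x|) x - (1 / 2) * L r x.
  by rewrite L_lin// LZ// mulNr.
have step M : 0 <= M -> (forall x, hs <= x -> `|r x| <= M * vexp 2 x) ->
    forall x, hs <= x -> `|r x| <= (K * E + 3 / 4 * M) * vexp 2 x.
  move=> M1 rM.
  have tl f : inD f -> (forall x, hs <= x -> 0 <= f x <= `|r x|) ->
      J (fun x => f x * above B x) <= M * dl.
    move=> fD fr; rewrite /dl -JZ; last exact/inD_above/inD_vexp.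
    apply: J_le; [exact: inD_above|exact/inDZ/inD_above/inD_vexp|].
    move=> x hx; rewrite mulrA ler_wpM2r//; first by rewrite /above; case: ifP.
    by apply: le_trans (rM x hx); case/andP: (fr x hx).
  (* If [N / 2] exceeds the tail bound, both [L fp] and [L fm] are at least [ep * p] on
     [hs, hs + 1], so [|L r|] falls short of [L |r|] by [2 ep p] there. As [J] is invariant under
     [L], integrating bounds this deficit by the error [E]. *)
  have hN : N <= 2 * M * dl + E * J (vexp 2) / (ep * j).
    have [Np|pN] := leP (N / 2) (M * dl).
      have : 0 <= E * J (vexp 2) / (ep * j).
        by apply: divr_ge0; apply: mulr_ge0 => //; exact: ltW.
      by lra.
    pose p := N / 2 - M * dl; have pp : 0 < p by rewrite subr_gt0.
    pose g x := (- (2 * (ep * p))) * (if x <= hs + 1 then 1 else 0)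
       + (E * vexp 2 x + L (fun x => `|r x|) x).
    have g1D : inD (fun x => E * vexp 2 x + L (fun x => `|r x|) x).
      by apply: inD_lin; [exact: inD_vexp|exact: inD_L].
    have gD : inD g by apply: inD_lin => //; exact: inD_unit_indic.
    have : N <= J g.
      apply: J_le => // x hx.
      have h1 : `|r x| <= `|L r x| + E * vexp 2 x.
        apply: le_trans (lerD (lexx _) (re x hx)); rewrite addrC.
        by have := ler_normD (r x - L r x) (L r x); rewrite subrK.
      suff h2 : `|L r x| <= L (fun x => `|r x|) x -
           2 * (ep * p) * (if x <= hs + 1 then 1 else 0).
        apply: le_trans h1 _; rewrite /g; set I := (if _ then _ else _) in h2 *; lra.
      case: ifPn => xh; last by rewrite mulr0 subr0; exact: L_abs.
      have hx1 : hs <= x <= hs + 1 by rewrite hx.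
      have q1 : ep * p <= L fp x.
        apply: le_trans (hep fp x pD _ hx1); last by move=> t /p0/andP[].
        by rewrite ler_wpM2l ?(ltW ep0)// /p Jp lerB//; exact: tl.
      have q2 : ep * p <= L fm x.
        apply: le_trans (hep fm x mD _ hx1); last by move=> t /m0/andP[].
        by rewrite ler_wpM2l ?(ltW ep0)// /p Jm lerB//; exact: tl.
      rewrite Lp in q1; rewrite Lm in q2.
      by rewrite mulr1 ler_norml; apply/andP; split; lra.
    rewrite /g J_lin//; last exact: inD_unit_indic.
    rewrite J_lin; [|exact: inD_vexp|exact: inD_L].
    rewrite JL// -/N -/j => h1.
    have h2 : 2 * (ep * p) * j <= E * J (vexp 2) by lra.
    have h3 : 2 * p <= E * J (vexp 2) / (ep * j).
      by rewrite ler_pdivlMr ?mulr_gt0//; lra.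
    by rewrite /p in h3; lra.
  move=> x hx.
  have Lr : L (fun x => `|r x|) x <= (C * N + M / 2) * vexp 2 x.
    by apply: hC => // t ht; rewrite normr_ge0 rM.
  have h1 : `|r x| <= `|L r x| + E * vexp 2 x.
    apply: le_trans (lerD (lexx _) (re x hx)); rewrite addrC.
    by have := ler_normD (r x - L r x) (L r x); rewrite subrK.
  have h2 := L_abs x rD.
  have h3 : C * N + M / 2 + E <= K * E + 3 / 4 * M.
    have a1 : C * N <= C * (2 * M * dl + E * J (vexp 2) / (ep * j)).
      by rewrite ler_wpM2l ?(ltW C0).
    have a2 : C * dl <= 1 / 8.
      have : C * dl <= C * (8 * C)^-1 by rewrite ler_wpM2l ?(ltW C0) ?(ltW hdl).
      have -> : C * (8 * C)^-1 = 1 / 8 by field; rewrite gt_eqF.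
      by [].
    have a3 : M * (C * dl) <= M * (1 / 8) by rewrite ler_wpM2l.
    by rewrite /K; lra.
  have h4 : (C * N + M / 2 + E) * vexp 2 x <= (K * E + 3 / 4 * M) * vexp 2 x.
    by rewrite ler_wpM2r ?(ltW (vexp_gt0 _ _)).
  by apply: le_trans h4; lra.
have := @contraction _ (fun x => hs <= x) (fun x => `|r x|) (vexp 2) (K * E) (3 / 4) M0.
have -> : K * E / (1 - 3 / 4) = 4 * K * E by field.
apply => //.
- by apply/andP; split; lra.
- by rewrite mulr_ge0 ?(ltW K0).
- by move=> x _; exact/ltW/vexp_gt0.
Qed.

Lemma crit_identity z w : 0 <= z < 1 -> is_w hs z w ->
  (1 - z) * (J (cst 1) - J w) = z * J (fun x => rem2 d (L w x / d%:R)).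
Proof.
move=> z01 Hw; have wD := inD_w Hw; have rD := inD_rem2 Hw.
have LD := inD_L wD.
have e : J w = (1 - z) * J (cst 1) + (z * J w + (- z) * J (fun x => rem2 d (L w x / d%:R))).
  rewrite -{2}(JL wD) -(JZ (- z))// -J_lin//; last exact: inDZ.
  rewrite -J_lin; [|exact: inD_cst|by apply: inD_lin => //; exact: inDZ].
  by apply: J_eq => x hx; rewrite {1}(w_rem2 Hw hx) /=; ring.
by lra.
Qed.

(** The a priori order of magnitude. Since [rem2 >= y^2], [crit_identity] bounds the [J]-integral of
    [y^2] by a multiple of [1 - z], and [y <= e + y^2 / e] with [e] the square root of [1 - z]
    balances the two terms. *)
Lemma crit_small z w : 1 / 2 <= z < 1 -> is_w hs z w ->
  J w <= 3 * d%:R * J (cst 1) * Num.sqrt (1 - z).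
Proof.
move=> /andP[z2 z1] Hw.
have z01 : 0 <= z < 1 by apply/andP; split; lra.
have wD := inD_w Hw; have rD := inD_rem2 Hw.
have z1' : 0 < 1 - z by rewrite subr_gt0.
pose e := Num.sqrt (1 - z); have e0 : 0 < e by rewrite sqrtr_gt0.
have e2 : e ^+ 2 = 1 - z by rewrite sqr_sqrtr// ltW.
have J1 : 0 <= J (cst 1) by apply: J_ge0.
have Jw : 0 <= J w by apply: J_ge0 => x _; exact: w_ge0 Hw x.
set Jr := J (fun x => rem2 d (L w x / d%:R)).
have Jr0 : 0 <= Jr by apply: J_ge0 => x _; exact: rem2_ge0 Hw x.
have hr : Jr <= 2 * e ^+ 2 * J (cst 1).
  have := crit_identity z01 Hw; rewrite -/Jr e2 => id.
  have : 0 <= (1 - z) * J w by rewrite mulr_ge0// ltW.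
  have : 0 <= (z - 1 / 2) * Jr by rewrite mulr_ge0// subr_ge0.
  by lra.
have : J w <= d%:R * e * J (cst 1) + d%:R / e * Jr.
  rewrite -{1}(JL wD) -[d%:R / e * Jr]JZ// -J_lin; [|exact: inD_cst|exact: inDZ].
  apply: J_le; [exact: inD_L|by apply: inD_lin; [exact: inD_cst|exact: inDZ]|].
  move=> x hx /=; have yr := rem2_ge_sqr hd (y01 Hw x).
  set y := L w x / d%:R in yr *; set rr := rem2 d y in yr *.
  have -> : L w x = d%:R * y by rewrite /y; field; rewrite gt_eqF.
  rewrite mulr1 -!mulrA -mulrDr ler_wpM2l ?(ltW d0)//.
  have h : e * (e + e^-1 * rr) = e ^+ 2 + rr by field; rewrite gt_eqF.
  rewrite -(ler_pM2l e0) h.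
  by have := sqr_ge0 (e - y); have := sqr_ge0 (e + y); lra.
move=> h; apply: le_trans h _.
have : d%:R / e * Jr <= d%:R / e * (2 * e ^+ 2 * J (cst 1)).
  by rewrite ler_wpM2l// divr_ge0 ?ltW.
have -> : d%:R / e * (2 * e ^+ 2 * J (cst 1)) = 2 * d%:R * e * J (cst 1).
  by field; rewrite gt_eqF.
by rewrite -/e; lra.
Qed.

Lemma vexp21 (x : R) : vexp 2 x * vexp 1 x = vexp 3 x.
Proof. by rewrite (_ : 3 = 2 + 1) ?vexpD//; ring. Qed.

Lemma vexp22 (x : R) : vexp 2 x * vexp 2 x = vexp 4 x.
Proof. by rewrite (_ : 4 = 2 + 2) ?vexpD//; ring. Qed.

(** [r = w - J w * chi] is orthogonal to [chi] and nearly fixed by [L]: the defect comes from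
    [1 - z] and the remainder, both of order [(J w)^2]. The spectral gap transfers this order to
    [r]. *)
Lemma crit_asymp1 : exists K z0, [/\ 0 < K, 1 / 2 <= z0 < 1 &
  forall z w, z0 <= z < 1 -> is_w hs z w ->
  [/\ 0 < J w, J w <= K * Num.sqrt (1 - z), 1 - z <= K * J w ^+ 2 &
   forall x, hs <= x -> `|w x - J w * chi x| <= K * J w ^+ 2 * vexp 2 x]].
Proof.
have [C1 C10 hC1] := w_bound (lexx hs).
have [C3 C30 hC3] := rem_bound (lexx hs).
have [Cg Cg0 hCg] := spectral_gap.
have [Cx Cx0 hCx] := chi_le_vexp.
have J10 : 0 < J (cst 1) by apply: J_gt0; [exact: inD_cst|].
set J1 := J (cst 1) in J10.
pose K0 := 3 * d%:R * J1; have K00 : 0 < K0 by rewrite !mulr_gt0.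
pose C4 := 2 * C3 * J (vexp 2) / J1.
have C40 : 0 < C4 by rewrite divr_gt0// !mulr_gt0// J_vexp_gt0.
pose E2 := expR ((0 - 2) * hs).
have E20 : 0 < E2 by exact: expR_gt0.
pose C5 := C4 * (1 + d%:R) * E2 + C3.
have d1 : 0 < 1 + d%:R :> R by rewrite addr_gt0.
have C50 : 0 < C5 by apply: addr_gt0 => //; apply: mulr_gt0 => //; exact: mulr_gt0.
(* For [1 - z <= q^2] one has [J w <= J1 / 2], so the left side of [crit_identity] is at least
   [(1 - z) * J1 / 2], which bounds [1 - z] by a multiple of [(J w)^2]. *)
pose q := J1 / (2 * K0); have q0 : 0 < q by rewrite divr_gt0// mulr_gt0.
pose z0 := Num.max (1 / 2) (1 - q ^+ 2).
exists (K0 + C4 + Cg * C5), z0.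
have CgC5 : 0 < Cg * C5 by exact: mulr_gt0.
have Kpos : 0 < K0 + C4 + Cg * C5 by lra.
split=> //.
  rewrite le_max lexx /= gt_max; apply/andP; split; first lra.
  by rewrite ltrBlDr ltrDl exprn_gt0.
move=> z w /andP[]; rewrite ge_max => /andP[z2 zq] z1 Hw.
have z01 : 0 <= z < 1 by apply/andP; split; lra.
have [Jw0 zJ wV] := hC1 z w z01 Hw.
have wD := inD_w Hw.
have c1 : J w <= K0 * Num.sqrt (1 - z) by apply: crit_small => //; rewrite z2.
have c2 : J w <= J1 / 2.
  apply: le_trans c1 _; have -> : J1 / 2 = K0 * q by rewrite /q; field; rewrite gt_eqF.
  rewrite ler_wpM2l ?(ltW K00)// -(ger0_norm (ltW q0)) -sqrtr_sqr.
  by rewrite ler_wsqrtr//; lra.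
have c3 : 1 - z <= C4 * J w ^+ 2.
  have id := crit_identity z01 Hw.
  have r1 : J (fun x => rem2 d (L w x / d%:R)) <= C3 * J w ^+ 2 * J (vexp 2).
    rewrite -JZ; last exact: inD_vexp.
    apply: J_le; [exact: inD_rem2 Hw|exact/inDZ/inD_vexp|].
    by move=> x hx; exact: (hC3 z w z01 Hw x hx).
  have r0 : 0 <= J (fun x => rem2 d (L w x / d%:R)).
    by apply: J_ge0 => x _; exact: rem2_ge0 Hw x.
  have h1 : (1 - z) * (J1 / 2) <= C3 * J w ^+ 2 * J (vexp 2).
    apply: (@le_trans _ _ ((1 - z) * (J1 - J w))).
      by rewrite ler_wpM2l//; lra.
    rewrite id; apply: le_trans r1; rewrite ler_piMl// ltW//.
  rewrite /C4 (_ : _ * _ = C3 * J w ^+ 2 * J (vexp 2) / (J1 / 2)).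
    by rewrite ler_pdivlMr// divr_gt0.
  by field; rewrite gt_eqF.
have Jw2 : 0 <= J w ^+ 2 by exact: sqr_ge0.
split => //.
- apply: le_trans c1 _; rewrite ler_wpM2r ?sqrtr_ge0//.
  by lra.
- by apply: le_trans c3 _; rewrite ler_wpM2r//; lra.
pose r x := (- J w) * chi x + w x.
have rD : inD r by apply: inD_lin => //; exact: inD_chi.
have Jr : J r = 0 by rewrite J_lin//; [rewrite J_chi; ring|exact: inD_chi].
have Lr x : L r x = L w x - J w * chi x.
  by rewrite L_lin//; [rewrite L_chi; ring|exact: inD_chi].
have Ld x : L w x <= d%:R.
  by apply: L_le_d => // t _; exact: w_le1 Hw t.
have re x : hs <= x -> `|r x - L r x| <= (C5 * J w ^+ 2) * vexp 2 x.
  move=> hx; have -> : r x - L r x = (1 - z) - (1 - z) * L w x - z * rem2 d (L w x / d%:R).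
    by rewrite Lr /r {1}(w_rem2 Hw hx); ring.
  have p1 := rem2_ge0 Hw x; have p2 := hC3 z w z01 Hw x hx.
  have p3 := Lw_ge0 Hw x.
  set rr := rem2 _ _ in p1 p2 *.
  have v1 : 1 <= E2 * vexp 2 x.
    have := @vexp_le 0 2 x; rewrite /E2 {1}/vexp mul0r expR0; apply => //.
  have a1 : (1 - z) * L w x <= (1 - z) * d%:R by rewrite ler_wpM2l//; lra.
  have a2 : 0 <= (1 - z) * L w x by rewrite mulr_ge0//; lra.
  have a3 : z * rr <= 1 * rr by rewrite ler_wpM2r// ltW.
  have a4 : 0 <= z * rr by rewrite mulr_ge0//; lra.
  have a5 : (1 - z) * (1 + d%:R) <= C4 * (1 + d%:R) * E2 * J w ^+ 2 * vexp 2 x.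
    have -> : C4 * (1 + d%:R) * E2 * J w ^+ 2 * vexp 2 x =
      (C4 * J w ^+ 2) * (1 + d%:R) * (E2 * vexp 2 x) by ring.
    have b1 : (1 - z) * (1 + d%:R) <= C4 * J w ^+ 2 * (1 + d%:R).
      by rewrite ler_wpM2r// addr_ge0// ltW.
    apply: le_trans b1 _; apply: ler_peMr => //.
    by apply: mulr_ge0; [apply: mulr_ge0 => //; exact: ltW|exact: ltW].
  have -> : C5 * J w ^+ 2 * vexp 2 x = C4 * (1 + d%:R) * E2 * J w ^+ 2 * vexp 2 x +
     C3 * J w ^+ 2 * vexp 2 x by rewrite /C5; ring.
  by rewrite ler_norml; apply/andP; split; lra.
pose F := expR ((1 - 2) * hs); have F0 : 0 < F by exact: expR_gt0.
(* Only of first order in [J w]: this is the starting bound of the contraction and leaves no trace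
   in the conclusion. *)
have rM x : hs <= x -> `|r x| <= ((C1 + Cx) * J w * F) * vexp 2 x.
  move=> hx; apply: (@le_trans _ _ ((C1 + Cx) * J w * vexp 1 x)); last first.
    rewrite -[leRHS]mulrA ler_wpM2l//; first by apply: mulr_ge0; [lra|exact: ltW].
    by apply: vexp_le => //; lra.
  have h1 := wV x hx; have h2 : J w * chi x <= J w * (Cx * vexp 1 x).
    by rewrite ler_wpM2l ?(ltW Jw0)// hCx.
  have h3 := w_ge0 Hw x; have h4 : 0 <= J w * chi x by apply: mulr_ge0 => //; exact: ltW.
  have h5 : 0 <= C1 * J w * vexp 1 x by exact: le_trans h1.
  have h6 : 0 <= J w * (Cx * vexp 1 x) by exact: le_trans h2.
  by rewrite /r ler_norml; apply/andP; split; lra.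
move=> x hx; have -> : w x - J w * chi x = r x by rewrite /r; ring.
have G0 : 0 <= C5 * J w ^+ 2 by apply: mulr_ge0 => //; exact: ltW.
have H0 : 0 <= (C1 + Cx) * J w * F.
  by apply: mulr_ge0; [apply: mulr_ge0; [lra|exact: ltW]|exact: ltW].
apply: le_trans (hCg r _ _ rD Jr G0 re H0 rM x hx) _.
rewrite ler_wpM2r ?(ltW (vexp_gt0 _ _))// mulrA ler_wpM2r//.
by lra.
Qed.

Lemma inD_chi2 : inD (fun x => chi x ^+ 2).
Proof.
have [Cx Cx0 hCx] := chi_le_vexp.
apply: (@inD_le _ (fun x => Cx ^+ 2 * vexp 2 x)); last exact/inDZ/inD_vexp.
  by apply: measurable_funX; exact: chi_meas.
move=> x hx; rewrite ger0_norm ?sqr_ge0// (_ : (2 : R) = 1 + 1); last by lra.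
rewrite -vexpD -expr2 -exprMn lerXn2r ?nnegrE ?hCx//.
by rewrite mulr_ge0 ?(ltW Cx0) ?(ltW (vexp_gt0 _ _)).
Qed.

(** The remainder is expanded at [y = (c chi + L r) / d], where [L r] is of order [c^2]. The main
    term is [b / d^2 * c^2 chi^2]; everything else is of order [c^3] with weight [vexp 4]. *)
Lemma crit_asymp2 : exists K z0, [/\ 0 < K, 1 / 2 <= z0 < 1 &
  forall z w, z0 <= z < 1 -> is_w hs z w ->
  `|(1 - z) * J (cst 1) - (d%:R - 1) / (2 * d%:R) * J (fun x => chi x ^+ 2) * J w ^+ 2|
    <= K * J w ^+ 3].
Proof.
have [K [z0 [K0 z012 hK]]] := crit_asymp1.
have [C2 C20 hC2] := Lw_bound (lexx hs).
have [Cx Cx0 hCx] := chi_le_vexp.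
have [C3 C30 hC3] := rem_bound (lexx hs).
have [ct ct0 hct] := @rem2_taylor R d.
set b := d%:R * (d%:R - 1) / 2 in hct.
have b0 : 0 < b by have := @d_ge2 R d hd => d2; rewrite divr_gt0// mulr_gt0//; lra.
have J10 : 0 < J (cst 1) by apply: J_gt0; [exact: inD_cst|].
set J1 := J (cst 1) in J10 *.
(* Since [hs] may be negative, lower weights compare with [vexp 4] on [hs, oo) only up to these
   constants. *)
pose e k := expR ((k - 4) * hs).
have e0 k : 0 < e k by exact: expR_gt0.
have ve k x : k <= 4 -> hs <= x -> vexp k x <= e k * vexp 4 x by exact: vexp_le.
have [Cl Cl0 hCl] := L_lyapunov (ltr0n R 2).
pose K2 := K * (Cl * J (vexp 2) + 1 / 2).
have K20 : 0 < K2.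
  by rewrite mulr_gt0// addr_gt0// ?mulr_gt0 ?J_vexp_gt0//; lra.
pose A1 := b / d%:R ^+ 2 * (K2 * (2 * Cx * e 3 + K2 * J1)).
pose A2 := ct * (C2 / d%:R) ^+ 3 * e 3.
have A10 : 0 < A1.
  apply: mulr_gt0; first by apply: divr_gt0 => //; exact: exprn_gt0.
  apply: mulr_gt0 => //; apply: addr_gt0; last exact: mulr_gt0.
  by apply: mulr_gt0 => //; exact: mulr_gt0.
have A20 : 0 <= A2.
  by rewrite mulr_ge0 ?(ltW (e0 _))// mulr_ge0// exprn_ge0// divr_ge0 ?(ltW C20) ?(ltW d0).
pose Q := (A1 + A2) * J (vexp 4) + (K * C3 * J (vexp 2) * J1 + K).
have A12 : 0 < A1 + A2 by lra.
have Q0 : 0 < Q.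
  rewrite /Q; apply: addr_gt0; first by apply: mulr_gt0 => //; exact: J_vexp_gt0.
  by apply: addr_gt0 => //; rewrite !mulr_gt0 ?J_vexp_gt0.
exists Q, z0; split => //.
move=> z w zz Hw; have [Jw0 cs zc wc] := hK z w zz Hw.
have /andP[zz0 z1] := zz; have /andP[z02 _] := z012.
have z01 : 0 <= z < 1 by apply/andP; split; lra.
have wD := inD_w Hw.
set c := J w in Jw0 cs zc wc *.
have cJ1 : c <= J1.
  by apply: J_le => //; [exact: inD_cst|move=> x _; exact: w_le1 Hw x].
pose r x := (- c) * chi x + w x.
have rD : inD r by apply: inD_lin => //; exact: inD_chi.
have Lr x : L r x = L w x - c * chi x.
  by rewrite L_lin//; [rewrite L_chi; ring|exact: inD_chi].
have Lrb x : hs <= x -> `|L r x| <= K2 * c ^+ 2 * vexp 2 x.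
  move=> hx; apply: le_trans (L_abs x rD) _.
  have hr t : hs <= t -> `|r t| <= K * c ^+ 2 * vexp 2 t.
    by move=> ht; have := wc t ht; rewrite /r addrC mulNr.
  apply: (@le_trans _ _ (L (fun t => K * c ^+ 2 * vexp 2 t) x)).
    by apply: L_le => //; [exact: inD_abs|exact/inDZ/inD_vexp].
  rewrite LZ; last exact: inD_vexp.
  have h : L (vexp 2) x <= (Cl * J (vexp 2) + 1 / 2) * vexp 2 x.
    apply: hCl => //; first exact: inD_vexp.
    by move=> t _; rewrite mul1r lexx andbT; exact/ltW/vexp_gt0.
  have : K * c ^+ 2 * L (vexp 2) x <= K * c ^+ 2 * ((Cl * J (vexp 2) + 1 / 2) * vexp 2 x).
    by rewrite ler_wpM2l// mulr_ge0 ?sqr_ge0 ?(ltW K0).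
  by rewrite /K2; lra.
set beta := (d%:R - 1) / (2 * d%:R).
have bE : beta = b / d%:R ^+ 2 by rewrite /beta /b; field; rewrite gt_eqF.
have rem x : hs <= x -> `|rem2 d (L w x / d%:R) - beta * c ^+ 2 * chi x ^+ 2| <=
    (A1 + A2) * c ^+ 3 * vexp 4 x.
  move=> hx; have /andP[l u] := hct _ (y01 Hw x).
  set y := L w x / d%:R in l u *.
  have y0 : 0 <= y by case/andP: (y01 Hw x).
  have yE : y = (c * chi x + L r x) / d%:R by rewrite /y Lr; congr (_ / _); ring.
  have y3 : ct * y ^+ 3 <= A2 * c ^+ 3 * vexp 4 x.
    apply: (@le_trans _ _ (ct * (C2 * c * vexp 1 x / d%:R) ^+ 3)).
      rewrite ler_wpM2l// lerXn2r ?nnegrE//.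
        by rewrite divr_ge0 ?(ltW d0)// !mulr_ge0 ?(ltW (vexp_gt0 _ _)) ?(ltW C20) ?(ltW Jw0).
      by rewrite ler_pM2r ?invr_gt0//; exact: (hC2 z w z01 Hw x hx).
    have -> : ct * (C2 * c * vexp 1 x / d%:R) ^+ 3 =
        ct * (C2 / d%:R) ^+ 3 * c ^+ 3 * vexp 3 x.
      rewrite (_ : (3 : R) = 1 + (1 + 1)); last by lra.
      by rewrite -(vexpD 1 (1 + 1)) -(vexpD 1 1); field; rewrite gt_eqF.
    have -> : A2 * c ^+ 3 * vexp 4 x = ct * (C2 / d%:R) ^+ 3 * c ^+ 3 * (e 3 * vexp 4 x).
      by rewrite /A2; ring.
    rewrite ler_wpM2l//; last by apply: ve => //; lra.
    by rewrite mulr_ge0 ?exprn_ge0 ?(ltW Jw0)// mulr_ge0// exprn_ge0// divr_ge0 ?(ltW C20) ?(ltW d0).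
  have y2 : `|b * y ^+ 2 - beta * c ^+ 2 * chi x ^+ 2| <= A1 * c ^+ 3 * vexp 4 x.
    have -> : b * y ^+ 2 - beta * c ^+ 2 * chi x ^+ 2 =
       b / d%:R ^+ 2 * (L r x * (2 * c * chi x + L r x)).
      by rewrite yE bE; field; rewrite gt_eqF.
    have bd0 : 0 <= b / d%:R ^+ 2 by rewrite divr_ge0 ?exprn_ge0 ?(ltW b0) ?(ltW d0).
    rewrite normrM (ger0_norm bd0).
    have -> : A1 * c ^+ 3 * vexp 4 x = b / d%:R ^+ 2 *
       (K2 * (2 * Cx * e 3 + K2 * J1) * c ^+ 3 * vexp 4 x) by rewrite /A1; ring.
    rewrite ler_wpM2l// normrM.
    have V4 : 0 <= vexp 4 x by exact/ltW/vexp_gt0.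
    have V2 : 0 <= vexp 2 x by exact/ltW/vexp_gt0.
    have s1 : `|2 * c * chi x + L r x| <= 2 * c * (Cx * vexp 1 x) + K2 * c ^+ 2 * vexp 2 x.
      apply: le_trans (ler_normD _ _) _; apply: lerD; last exact: Lrb.
      rewrite ger0_norm ?mulr_ge0 ?(ltW Jw0)//.
      by rewrite ler_wpM2l ?hCx// mulr_ge0 ?(ltW Jw0).
    apply: le_trans (ler_pM (normr_ge0 _) (normr_ge0 _) (Lrb x hx) s1) _.
    have -> : K2 * c ^+ 2 * vexp 2 x * (2 * c * (Cx * vexp 1 x) + K2 * c ^+ 2 * vexp 2 x) =
        K2 * c ^+ 3 * (2 * Cx * vexp 3 x + K2 * c * vexp 4 x).
      by rewrite -(vexp21 x) -(vexp22 x); ring.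
    have -> : K2 * (2 * Cx * e 3 + K2 * J1) * c ^+ 3 * vexp 4 x =
        K2 * c ^+ 3 * (2 * Cx * (e 3 * vexp 4 x) + K2 * J1 * vexp 4 x) by ring.
    rewrite ler_wpM2l//; first by rewrite mulr_ge0 ?exprn_ge0 ?(ltW K20) ?(ltW Jw0).
    apply: lerD.
      by rewrite ler_wpM2l ?mulr_ge0 ?(ltW Cx0)//; apply: ve => //; lra.
    by rewrite ler_wpM2r// ler_wpM2l ?(ltW K20).
  have : - (A1 * c ^+ 3 * vexp 4 x) <= b * y ^+ 2 - beta * c ^+ 2 * chi x ^+ 2 <= A1 * c ^+ 3 * vexp 4 x.
    by rewrite -ler_norml.
  move=> /andP[t1 t2]; have t3 : 0 <= ct * y ^+ 3 by rewrite mulr_ge0// exprn_ge0.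
  have -> : (A1 + A2) * c ^+ 3 * vexp 4 x = A1 * c ^+ 3 * vexp 4 x + A2 * c ^+ 3 * vexp 4 x by ring.
  by rewrite ler_norml; apply/andP; split; lra.
set Jr := J (fun x => rem2 d (L w x / d%:R)).
have rmD := inD_rem2 Hw.
have Jrem : `|Jr - beta * c ^+ 2 * J (fun x => chi x ^+ 2)| <= (A1 + A2) * c ^+ 3 * J (vexp 4).
  have dD : inD (fun x => (- (beta * c ^+ 2)) * chi x ^+ 2 + rem2 d (L w x / d%:R)).
    by apply: inD_lin => //; exact: inD_chi2.
  have -> : Jr - beta * c ^+ 2 * J (fun x => chi x ^+ 2) =
      J (fun x => (- (beta * c ^+ 2)) * chi x ^+ 2 + rem2 d (L w x / d%:R)).
    by rewrite J_lin//; [rewrite -/Jr; ring|exact: inD_chi2].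
  rewrite ler_norml -mulNr -!JZ; try exact: inD_vexp.
  apply/andP; split; apply: J_le => //; try exact/inDZ/inD_vexp.
    by move=> x /rem; rewrite ler_norml => /andP[h _]; lra.
  by move=> x /rem; rewrite ler_norml => /andP[_ h]; lra.
have id := crit_identity z01 Hw; rewrite -/Jr -/c -/J1 in id.
have Jr0 : 0 <= Jr by apply: J_ge0 => x _; exact: rem2_ge0 Hw x.
have Jrb : Jr <= C3 * c ^+ 2 * J (vexp 2).
  rewrite -JZ; last exact: inD_vexp.
  apply: J_le => //; first exact/inDZ/inD_vexp.
  by move=> x hx; exact: (hC3 z w z01 Hw x hx).
have u1 : (1 - z) * Jr <= K * C3 * J (vexp 2) * J1 * c ^+ 3.
  apply: (@le_trans _ _ ((K * c ^+ 2) * (C3 * c ^+ 2 * J (vexp 2)))).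
    by apply: ler_pM => //; lra.
  have -> : K * c ^+ 2 * (C3 * c ^+ 2 * J (vexp 2)) = K * C3 * J (vexp 2) * c * c ^+ 3 by ring.
  rewrite ler_wpM2r ?exprn_ge0 ?(ltW Jw0)// ler_wpM2l//.
  by rewrite !mulr_ge0 ?(ltW K0) ?(ltW C30) ?(ltW (J_vexp_gt0 2)).
have u2 : (1 - z) * c <= K * c ^+ 3.
  have -> : K * c ^+ 3 = K * c ^+ 2 * c by ring.
  by rewrite ler_wpM2r ?(ltW Jw0).
have u3 : 0 <= (1 - z) * Jr by rewrite mulr_ge0//; lra.
have u4 : 0 <= (1 - z) * c by rewrite mulr_ge0 ?(ltW Jw0)//; lra.
move: Jrem; rewrite !ler_norml => /andP[l u].
have -> : Q * c ^+ 3 = (A1 + A2) * c ^+ 3 * J (vexp 4) +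
   (K * C3 * J (vexp 2) * J1 * c ^+ 3 + K * c ^+ 3) by rewrite /Q; ring.
clear -l u u1 u2 u3 u4 id; by apply/andP; split; lra.
Qed.

End critical.

End operator.

(** * The limiting survival function *)

Lemma cvgr_expr {R : realType} {T : Type} {G : set_system T} {FG : Filter G}
  (f : T -> R) (l : R) k : f x @[x --> G] --> l -> f x ^+ k @[x --> G] --> l ^+ k.
Proof.
move=> fl; elim: k => [|k ih]; first by under eq_fun do rewrite expr0; exact: cvg_cst.
by under eq_fun do rewrite exprS; rewrite exprS; exact: cvgM.
Qed.

Section branching_limit.
Context {R : realType} (d : nat).
Hypothesis hd : (2 <= d)%N.
Local Notation mu := (@lebesgue_measure R).
Local Notation rY := (@rho_Y R d).
Local Notation rN := (@rho_nu R d).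
Variables (h z : R).
Hypothesis z01 : 0 <= z <= 1.

Let d0 : 0 < d%:R :> R := d_gt0 hd.
Let z0 : 0 <= z. Proof. by case/andP: z01. Qed.
Let z1 : z <= 1. Proof. by case/andP: z01. Qed.

Definition cocut (u : R -> R) (x : R) := if h <= x then 1 - u x else 0.

Lemma measurable_cocut u : measurable_fun setT u -> measurable_fun setT (cocut u).
Proof.
move=> um; apply: measurable_fun_ifT => //; first exact: measurable_fun_ler.
exact: measurable_funB.
Qed.

Lemma cocut_in01 u : in01 u -> in01 (cocut u).
Proof.
move=> u01 x; rewrite /cocut; case: ifP => _; last by rewrite lexx ler01.
by have /andP[? ?] := u01 x; apply/andP; split; lra.
Qed.

(** [fcut u] and [cocut u] add up to 1 and the kernel has total mass 1; this turns averages of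
    generating functions into the linear operator. *)
Lemma fkernel_Lop u a : measurable_fun setT u -> in01 u -> h <= a ->
  fkernel d h u a = 1 - Lop d h (cocut u) a / d%:R.
Proof.
move=> um u01 ha; have qm := measurable_cocut um; have q01 := cocut_in01 u01.
have lopE : (\int[normal_prob 0 (sigma_Y d)]_y (cocut u (a / d%:R + y))%:E)%E =
    (Lop d h (cocut u) a / d%:R)%:E.
  rewrite (@integral_normal_prob_shift R (sigma_Y d) (a / d%:R) (fun x => (cocut u x)%:E)).
  - have -> : (Lop d h (cocut u) a / d%:R)%:E =
       (\int[mu]_(x in `[h, +oo[) (cocut u x * rY (x - a / d%:R))%:E)%E.
      rewrite /Lop ha /Rintegral mulrAC divff ?gt_eqF// mul1r fineK//.
      exact: integral_rho_Y_fin.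
    rewrite [RHS]integral_mkcond; apply: eq_integral => x _; rewrite /patch -EFinM.
    have [hx|xh] := leP h x; first by rewrite mem_set//= in_itv /= hx.
    rewrite memNset; last by rewrite /= in_itv /= andbT leNgt xh.
    by rewrite /cocut (lt_geF xh) mul0r.
  - exact/measurable_EFinP.
  - by move=> x; rewrite !lee_fin.
have : (\int[normal_prob 0 (sigma_Y d)]_y (fcut h u (a / d%:R + y))%:E +
   \int[normal_prob 0 (sigma_Y d)]_y (cocut u (a / d%:R + y))%:E = 1)%E.
  rewrite -ge0_integralD//; last 4 first.
  - by move=> y _; rewrite lee_fin; case/andP: (@fcut_in01 R h u u01 (a / d%:R + y)).
  - apply/measurable_EFinP; apply: measurableT_comp; first exact: measurable_fcut.
    exact: measurable_funD.
  - by move=> y _; rewrite lee_fin; case/andP: (q01 (a / d%:R + y)).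
  - apply/measurable_EFinP; apply: measurableT_comp => //; exact: measurable_funD.
  transitivity (\int[normal_prob 0 (sigma_Y d)]_(y in setT) cst 1%:E (y : R))%E.
    apply: eq_integral => y _; rewrite -EFinD /=; congr EFin.
    by rewrite /fcut /cocut; case: ifP => _; rewrite ?addr0// addrCA subrr addr0.
  by rewrite integral_cst//= mul1e probability_setT.
by rewrite fkernelE// lopE -EFinD => -[] /(canRL (addrK _)) ->.
Qed.

Local Notation F := (fiter d h z).
Local Notation q n := (cocut (F n)).

Lemma measurable_cocut_iter n : measurable_fun setT (q n).
Proof. by apply: measurable_cocut; case: (fiter_measurable_in01 d h z01 n). Qed.

Lemma cocut_iter_in01 n : in01 (q n).
Proof. by apply: cocut_in01; case: (fiter_measurable_in01 d h z01 n). Qed.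

Lemma fkernel_iter n a : h <= a ->
  fkernel d h (F n) a = 1 - Lop d h (q n) a / d%:R.
Proof. by have [? ?] := fiter_measurable_in01 d h z01 n; exact: fkernel_Lop. Qed.

Lemma cocut_iterS n x : h <= x -> q n.+1 x = 1 - z * (1 - Lop d h (q n) x / d%:R) ^+ d.
Proof. by move=> hx; rewrite /cocut hx /= fkernel_iter. Qed.

Lemma Lop_le01 (u v : R -> R) a : measurable_fun setT u -> measurable_fun setT v ->
  in01 u -> in01 v -> (forall x, h <= x -> u x <= v x) -> Lop d h u a <= Lop d h v a.
Proof.
move=> um vm u01 v01 uv; rewrite /Lop; case: ifP => // ha.
rewrite ler_pM2l// /Rintegral; apply: fine_le; [exact: integral_rho_Y_fin..|].
apply: ge0_le_integral.
- exact: measurable_itv.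
- by move=> x _; rewrite lee_fin mulr_ge0 ?rho_Y_ge0//; case/andP: (u01 x).
- by apply/measurable_funTS/measurable_EFinP/measurable_funM => //; exact: measurable_rho_Y_shift.
- by apply/measurable_funTS/measurable_EFinP/measurable_funM => //; exact: measurable_rho_Y_shift.
- by move=> x /=; rewrite in_itv /= andbT => hx; rewrite lee_fin ler_wpM2r ?rho_Y_ge0 ?uv.
Qed.

Lemma Lop_frac01 (u : R -> R) a : measurable_fun setT u -> in01 u ->
  0 <= 1 - Lop d h u a / d%:R <= 1.
Proof.
move=> um u01; have /andP[l0 l1] := Lop_bounds hd h um u01 a.
have : 0 <= Lop d h u a / d%:R by apply: divr_ge0 => //; exact: ltW.
have : Lop d h u a / d%:R <= 1 by rewrite ler_pdivrMr// mul1r.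
by move=> ? ?; apply/andP; split; lra.
Qed.

Lemma cocut_iter_leS n x : q n x <= q n.+1 x.
Proof.
have [hx|xh] := leP h x; last by rewrite /cocut (lt_geF xh).
elim: n x hx => [|n ih] x hx.
  have [m0 u0] := (measurable_cocut_iter 0, cocut_iter_in01 0).
  have /andP[y0 y1] := Lop_frac01 x m0 u0.
  rewrite cocut_iterS// {1}/cocut hx /= lerD2l lerN2 ler_piMr// exprn_ile1//.
have [mn un] := (measurable_cocut_iter n, cocut_iter_in01 n).
have [mS uS] := (measurable_cocut_iter n.+1, cocut_iter_in01 n.+1).
rewrite !cocut_iterS// lerD2l lerN2 ler_wpM2l// lerXn2r ?nnegrE//.
- by case/andP: (Lop_frac01 x mS uS).
- by case/andP: (Lop_frac01 x mn un).
by rewrite lerD2l lerN2 ler_pM2r ?invr_gt0//; exact: Lop_le01.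
Qed.

(** The function [w_z]: [1 - E z^N] for a vertex with [d] children, as the increasing limit over
    truncation depths, and 0 below [h]. *)
Definition wlim x := limn (fun n => q n x).

Lemma cocut_iter_cvg x : q n x @[n --> \oo] --> wlim x.
Proof.
apply: nondecreasing_is_cvgn; first by apply/nondecreasing_seqP => n; exact: cocut_iter_leS.
by exists 1 => _ [n _ <-]; case/andP: (cocut_iter_in01 n x).
Qed.

Lemma measurable_wlim : measurable_fun setT wlim.
Proof.
apply: (@measurable_fun_cvg _ _ _ _ (fun n => q n)).
  exact: measurable_cocut_iter.
by move=> x _; exact: cocut_iter_cvg.
Qed.

Lemma wlim_in01 x : 0 <= wlim x <= 1.
Proof.
have c := @cocut_iter_cvg x; apply/andP; split.
  by apply: (limr_ge c); near=> n; case/andP: (cocut_iter_in01 n x).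
by apply: (limr_le c); near=> n; case/andP: (cocut_iter_in01 n x).
Unshelve. all: by end_near. Qed.

Lemma wlim_lt x : x < h -> wlim x = 0.
Proof.
move=> xh; apply/cvg_lim => //; rewrite (_ : (fun n => _) = cst 0); first exact: cvg_cst.
by apply/funext => n; rewrite /cocut (lt_geF xh).
Qed.

Lemma Lop_iter_cvg a : Lop d h (q n) a @[n --> \oo] --> Lop d h wlim a.
Proof.
rewrite /Lop; case: ifP => ha; last exact: cvg_cst.
apply: cvgM; first exact: cvg_cst.
rewrite /Rintegral; apply: fine_cvg; rewrite fineK; last first.
  by apply: integral_rho_Y_fin => //; [exact: measurable_wlim|exact: wlim_in01].
apply: (@dominated_cvg _ _ R mu `[h, +oo[ _ (fun n x => (q n x * rY (x - a / d%:R))%:E)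
  (fun x => (wlim x * rY (x - a / d%:R))%:E) (fun x => (rY (x - a / d%:R))%:E)).
- exact: measurable_itv.
- move=> n; apply/measurable_funTS/measurable_EFinP/measurable_funM.
    exact: measurable_cocut_iter.
  exact: measurable_rho_Y_shift.
- move=> x _; apply: cvg_EFin; first by near=> n.
  by apply: cvgM; [exact: cocut_iter_cvg|exact: cvg_cst].
- by [].
- have e : (fun x => (rY (x - a / d%:R))%:E) = (fun x => (vexp 0 x * rY (x - a / d%:R))%:E).
    by apply/funext => x; rewrite /vexp mul0r expR0 mul1r.
  rewrite e; apply: integrableS (integrable_vexp_rho_Y hd 0 (a / d%:R)) => //.
- move=> n x _; rewrite lee_fin; have /andP[q0 q1] := cocut_iter_in01 n x.
  by rewrite ger0_norm ?mulr_ge0 ?rho_Y_ge0// ler_piMl ?rho_Y_ge0.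
Unshelve. all: by end_near. Qed.

Lemma fkernel_iter_cvg a : h <= a ->
  fkernel d h (F n) a @[n --> \oo] --> 1 - Lop d h wlim a / d%:R.
Proof.
move=> ha; rewrite (_ : (fun n => _) = (fun n => 1 - Lop d h (q n) a / d%:R)); last first.
  by apply/funext => n; exact: fkernel_iter.
apply: cvgB; first exact: cvg_cst.
by apply: cvgM; [exact: Lop_iter_cvg|exact: cvg_cst].
Qed.

Lemma wlim_eq x : h <= x -> wlim x = 1 - z * (1 - Lop d h wlim x / d%:R) ^+ d.
Proof.
move=> hx; apply/cvg_lim => //; rewrite -(cvg_shiftn 1).
rewrite (_ : (fun n => _) = (fun n => 1 - z * fkernel d h (F n) x ^+ d)); last first.
  by apply/funext => n; rewrite addn1 cocut_iterS// fkernel_iter.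
apply: cvgB; first exact: cvg_cst.
apply: cvgM; first exact: cvg_cst.
exact/cvgr_expr/fkernel_iter_cvg.
Qed.

(** The limiting generating function at a root with [m] children; it is 1 below [h], where the
    cluster is empty. *)
Definition gfun m x := if h <= x then z * (1 - Lop d h wlim x / d%:R) ^+ m else 1.

Lemma gfun_in01 m : in01 (gfun m).
Proof.
move=> x; apply: if_in01.
have /andP[y0 y1] := Lop_frac01 x measurable_wlim wlim_in01.
by rewrite mulr_ge0 ?exprn_ge0//= mulr_ile1 ?exprn_ge0 ?exprn_ile1.
Qed.

Lemma measurable_gfun m : measurable_fun setT (gfun m).
Proof.
apply: measurable_fun_ifT => //; first exact: measurable_fun_ler.
apply: measurable_funM => //; apply: measurable_funX; apply: measurable_funB => //.
apply: measurable_funM => //; apply: measurable_Lop => //.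
  exact: measurable_wlim.
exact: wlim_in01.
Qed.

Lemma gfun_cvg m x :
  (if h <= x then z * fkernel d h (F n) x ^+ m else 1) @[n --> \oo] --> gfun m x.
Proof.
rewrite /gfun; case: ifP => hx; last exact: cvg_cst.
by apply: cvgM; [exact: cvg_cst|exact/cvgr_expr/fkernel_iter_cvg].
Qed.

End branching_limit.

(** * Power series of the tail of the cluster size *)

Section cluster_tail.
Context {R : realType} (d : nat) {dT : measure_display} {Omega : measurableType dT}.
Hypothesis hd : (2 <= d)%N.
Variables (P : probability Omega R) (W : seq nat -> Omega -> R).
Hypothesis W_meas : forall x, measurable_fun setT (W x).
Hypothesis W_Y : forall x, vtx d x -> x != [::] -> forall B, measurable B ->
  P (W x @^-1` B) = normal_prob 0 (sigma_Y d) B.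
Hypothesis W_indep : mutually_independent P (vtx d) W.
Variables (h : R) (root : Omega -> R).
Hypothesis mroot : measurable_fun setT root.
Hypothesis mroot' : forall k, k != [::] ->
  measurable_fun setT (root : g_sigma_algebraType (cylinders (vtx d) W k) -> R).
Variable rc : seq nat.
Hypothesis rc_uniq : uniq rc.
Hypothesis rc_lt : all (fun i => i < d.+1)%N rc.
Local Notation N := (vcount d W h root rc).

Lemma measurable_vcount n t : measurable [set w | (t < N n w)%N].
Proof.
pose f w : R := \sum_(k < n.+1) \sum_(s <- tgen rc d k) (if abv d W h root s w then 1 else 0).
have fE w : f w = (N n w)%:R.
  rewrite /f /vcount natr_sum; apply: eq_bigr => k _; rewrite natr_sum; apply: eq_bigr => s _.
  by case: abv.
have mf : measurable_fun setT f.
  apply: measurable_sum => k; apply: measurable_sum => s.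
  by apply: measurable_fun_ifT => //; exact: measurable_abv.
have -> : [set w | (t < N n w)%N] = setT `&` f @^-1` `]t%:R, +oo[%classic.
  by rewrite setTI; apply/seteqP; split => w /=; rewrite in_itv /= andbT fE ltr_nat.
exact: mf.
Qed.

Lemma vcount_leS n w : (N n w <= N n.+1 w)%N.
Proof. exact: tcount_leS. Qed.

Lemma vcount_le n w : (N n w <= \sum_(k < n.+1) size (tgen rc d k))%N.
Proof. exact: tcount_le. Qed.

Variable z : R.
Hypothesis z01 : 0 <= z < 1.

Let z01' : 0 <= z <= 1. Proof. by case/andP: z01 => -> /ltW. Qed.

Lemma integrable_in01 (f : R -> R) : measurable_fun setT f -> in01 f ->
  P.-integrable setT (fun w => (f (root w))%:E).
Proof.
move=> mf f01; apply: (@le_integrable _ _ _ P setT _ _ (cst 1%:E)) => //.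
- by apply/measurable_EFinP; exact: measurableT_comp.
- move=> w _; rewrite lee_fin normr1.
  by have /andP[f0 f1] := f01 (root w); rewrite ger0_norm.
- exact: finite_measure_integrable_cst.
Qed.

Lemma pgf_cvg : pgf P N z n @[n --> \oo] -->
  Rintegral P setT (fun w => gfun d h z (size rc) (root w)).
Proof.
rewrite -(cvg_shiftn 1).
have fin := integrable_fin_num _ (integrable_in01 (measurable_gfun hd h z01' (size rc))
  (gfun_in01 hd h z01' (size rc))).
rewrite /Rintegral /pgf; apply: fine_cvg; rewrite fineK; last exact: fin.
under eq_fun do rewrite addn1 (expectation_vcount W_meas W_Y W_indep h mroot' z01' rc_uniq rc_lt).
apply: (@dominated_cvg _ _ R P setT measurableT _ _ (cst 1%E)).
- move=> n; apply/measurable_EFinP.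
  have [fm f01] := fiter_measurable_in01 d h z01' n.
  apply: measurable_fun_ifT => //; first exact: measurable_fun_ler.
  apply: measurable_funM => //; apply: measurable_funX.
  by apply: measurableT_comp mroot; exact: measurable_fkernel.
- move=> w _; apply: cvg_EFin; first by near=> n.
  exact: (@gfun_cvg R d hd h z z01' (size rc) (root w)).
- by [].
- exact: finite_measure_integrable_cst.
- move=> n w _; rewrite lee_fin.
  have [fm f01] := fiter_measurable_in01 d h z01' n.
  have /andP[k0 k1] := fkernel_in01 d h fm f01 (root w).
  have /andP[g0 g1] : 0 <= (if h <= root w then z * fkernel d h (fiter d h z n) (root w) ^+ size rc
      else 1) <= 1.
    case/andP: z01' => z0 z1; apply: if_in01.
    by rewrite mulr_ge0 ?exprn_ge0//= mulr_ile1 ?exprn_ge0 ?exprn_ile1.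
  by rewrite ger0_norm.
Unshelve. all: by end_near. Qed.

Lemma cluster_tail_series : series (fun t => tail P N t * z ^+ t) @ \oo -->
  (1 - Rintegral P setT (fun w => gfun d h z (size rc) (root w))) / (1 - z).
Proof.
apply: (tail_series_cvg measurable_vcount vcount_leS vcount_le z01).
by rewrite subKr; exact: pgf_cvg.
Qed.

End cluster_tail.

(** * A Tauberian theorem *)

Section bernstein.
Context {R : realType}.
Implicit Types (f g : nat -> R) (x : R) (n : nat).
Local Open Scope ring_scope.

(** Bernstein polynomials by conditioning on one coin toss: the value at [x] is the mean of [f (S)]
    for [S] binomial with parameters [n] and [x]. The argument of [f] is the unscaled count. *)
Fixpoint bern n f : {poly R} :=
  if n is m.+1 then 'X * bern m (fun k => f k.+1) + (1 - 'X) * bern m f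
  else (f 0%N)%:P.

Lemma bernS n f x : (bern n.+1 f).[x] =
  x * (bern n (fun k => f k.+1)).[x] + (1 - x) * (bern n f).[x].
Proof. by rewrite /= !hornerE. Qed.

Lemma bern_le n f g x : 0 <= x <= 1 -> (forall k, (k <= n)%N -> f k <= g k) ->
  (bern n f).[x] <= (bern n g).[x].
Proof.
move=> x01; have /andP[x0 x1] := x01; elim: n f g => [|n ih] f g fg.
  by rewrite /= !hornerC fg.
rewrite !bernS lerD// ler_wpM2l ?subr_ge0//; apply: ih => k kn.
  by apply: fg; rewrite ltnS.
by apply: fg; exact: leqW.
Qed.

Lemma bern_lin n a f g x : (bern n (fun k => a * f k + g k)).[x] =
  a * (bern n f).[x] + (bern n g).[x].
Proof.
elim: n f g => [|n ih] f g; first by rewrite /= !hornerC.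
by rewrite !bernS !ih; ring.
Qed.

Lemma bern_cst n a x : (bern n (fun=> a)).[x] = a.
Proof. by elim: n => [|n ih]; rewrite ?bernS ?ih /= ?hornerC//; ring. Qed.

Lemma bern_sqr n c x : (bern n (fun k => (k%:R - c) ^+ 2)).[x] =
  n%:R * x * (1 - x) + (n%:R * x - c) ^+ 2.
Proof.
elim: n c => [|n ih] c; first by rewrite /= hornerC; ring.
rewrite bernS ih (_ : (fun k => _) = fun k : nat => (k%:R - (c - 1)) ^+ 2); last first.
  by apply/funext => k; rewrite -natr1; congr (_ ^+ 2); ring.
by rewrite ih -natr1; ring.
Qed.

(** Bernstein's proof for 1-Lipschitz functions. The inequality [|s| <= s^2 / t + t] turns the
    Lipschitz error into the binomial variance, and [n >= t^(-2)] makes each of the two terms at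
    most [t = e / 2]. *)
Lemma weierstrass (G : R -> R) (e : R) : 0 < e ->
  (forall x y, 0 <= x <= 1 -> 0 <= y <= 1 -> `|G x - G y| <= `|x - y|) ->
  exists q : {poly R}, forall x, 0 <= x <= 1 -> `|G x - q.[x]| <= e.
Proof.
move=> e0 lipG; pose t := e / 2; have t0 : 0 < t by rewrite divr_gt0.
pose n := (Num.trunc (t ^+ 2)^-1).+1.
have nt : (t ^+ 2)^-1 <= n%:R.
  have t2 : 0 <= (t ^+ 2)^-1 by rewrite invr_ge0 sqr_ge0.
  by have /andP[_ /ltW] := truncn_itv t2.
have n0 : 0 < n%:R :> R by rewrite ltr0n.
have nt2 : n%:R^-1 <= t ^+ 2.
  by rewrite -[leRHS]invrK lef_pV2 ?posrE ?invr_gt0 ?exprn_gt0.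
exists (bern n (fun k => G (k%:R / n%:R))) => x x01; have /andP[x0 x1] := x01.
have key k : (k <= n)%N -> `|G (k%:R / n%:R) - G x| <=
    t^-1 * n%:R ^- 2 * (k%:R - n%:R * x) ^+ 2 + t.
  move=> kn; apply: le_trans (lipG _ _ _ x01) _.
    by rewrite divr_ge0//= ler_pdivrMr// mul1r ler_nat.
  set u := `|_|.
  have -> : t^-1 * n%:R ^- 2 * (k%:R - n%:R * x) ^+ 2 = u ^+ 2 / t.
    by rewrite /u real_normK ?num_real//; field; rewrite !gt_eqF.
  rewrite -(ler_pM2r t0) mulrDl divfK ?gt_eqF//.
  by have := sqr_ge0 (u - t); have := sqr_ge0 (u + t); lra.
have b2 : t^-1 * n%:R ^- 2 * (bern n (fun k => (k%:R - n%:R * x) ^+ 2)).[x] <= t.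
  rewrite bern_sqr subrr expr0n /= addr0.
  have -> : t^-1 * n%:R ^- 2 * (n%:R * x * (1 - x)) = t^-1 * (n%:R^-1 * (x * (1 - x))).
    by field; rewrite !gt_eqF.
  rewrite mulrC ler_pdivrMr// -expr2; apply: le_trans nt2.
  by rewrite ler_piMr ?invr_ge0 ?ltW//; nra.
rewrite distrC ler_norml; apply/andP; split.
- rewrite lerBrDl.
  apply: (@le_trans _ _ (bern n (fun k => (- (t^-1 * n%:R ^- 2)) * (k%:R - n%:R * x) ^+ 2 + (G x - t))).[x]).
    by rewrite bern_lin bern_cst mulNr; rewrite /t in b2 *; lra.
  apply: bern_le => // k /key; rewrite ler_norml => /andP[h _].
  by rewrite mulNr; lra.
- rewrite lerBlDl.
  apply: (@le_trans _ _ (bern n (fun k => (t^-1 * n%:R ^- 2) * (k%:R - n%:R * x) ^+ 2 + (G x + t))).[x]).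
    apply: bern_le => // k /key; rewrite ler_norml => /andP[_ h]; lra.
  by rewrite bern_lin bern_cst; rewrite /t in b2 *; lra.
Qed.

End bernstein.

(** * [Gamma (1 / 2)] as a limit of Riemann sums *)

Section gamma_half.
Context {R : realType}.
Local Notation mu := (@lebesgue_measure R).
Implicit Types u v x y : R.

Definition gf x : R := x `^ (1 / 2 - 1) * expR (- x).

Lemma gfE x : 0 < x -> gf x = (Num.sqrt x)^-1 * expR (- x).
Proof.
move=> x0; rewrite /gf (_ : 1 / 2 - 1 = - 2^-1); last by field.
by rewrite powRN powR12_sqrt// ltW.
Qed.

Lemma gf_ge0 x : 0 <= gf x.
Proof. by rewrite mulr_ge0 ?powR_ge0 ?expR_ge0. Qed.

Lemma gf_noninc x y : 0 < x -> x <= y -> gf y <= gf x.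
Proof.
move=> x0 xy; have y0 := lt_le_trans x0 xy; rewrite !gfE//.
apply: ler_pM; rewrite ?invr_ge0 ?sqrtr_ge0 ?expR_ge0 ?ler_expR ?lerN2//.
by rewrite lef_pV2 ?posrE ?sqrtr_gt0// ler_wsqrtr.
Qed.

Lemma measurable_gf : measurable_fun setT gf.
Proof.
apply: measurable_funM; first exact: measurable_powR.
by apply: measurableT_comp => //; exact: measurable_oppr.
Qed.

Definition gi u v : \bar R := (\int[mu]_(x in `]u, v]) (gf x)%:E)%E.

Lemma gi_ge0 u v : (0 <= gi u v)%E.
Proof. by apply: integral_ge0 => x _; rewrite lee_fin gf_ge0. Qed.

Lemma gi_split u v t : u <= v -> v <= t -> gi u t = (gi u v + gi v t)%E.
Proof.
move=> uv vt; rewrite /gi -ge0_integral_setU//=.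
- by rewrite -itv_bndbnd_setU ?bnd_simp.
- by apply/measurable_funTS/measurable_EFinP; exact: measurable_gf.
- by move=> x _; rewrite lee_fin gf_ge0.
- apply/disj_setPS => x [/=]; rewrite !in_itv /= => /andP[_ xv] /andP[vx _].
  by have := lt_le_trans vx xv; rewrite ltxx.
Qed.

Lemma integral_cst_itv u v (c : R) : u <= v ->
  (\int[mu]_(x in `]u, v]) c%:E = (c * (v - u))%:E)%E.
Proof.
move=> uv; rewrite integral_cst//= lebesgue_measure_itv /= lte_fin.
move: uv; rewrite le_eqVlt => /predU1P[->|->]; first by rewrite ltxx subrr mulr0 mule0.
by rewrite -EFinB -EFinM.
Qed.

Lemma gi_le u v : 0 < u -> u <= v -> (gi u v <= ((v - u) * gf u)%:E)%E.
Proof.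
move=> u0 uv; rewrite mulrC -integral_cst_itv//; apply: ge0_le_integral => //.
- by move=> x _; rewrite lee_fin gf_ge0.
- by apply/measurable_funTS/measurable_EFinP; exact: measurable_gf.
- by move=> x /=; rewrite in_itv /= => /andP[ux _]; rewrite lee_fin gf_noninc// ltW.
Qed.

Lemma gi_ge u v : 0 <= u -> u <= v -> (((v - u) * gf v)%:E <= gi u v)%E.
Proof.
move=> u0 uv; rewrite mulrC -integral_cst_itv//; apply: ge0_le_integral => //.
- by move=> x _; rewrite lee_fin gf_ge0.
- by apply/measurable_funTS/measurable_EFinP; exact: measurable_gf.
- move=> x /=; rewrite in_itv /= => /andP[ux xv].
  by rewrite lee_fin gf_noninc//; exact: le_lt_trans ux.
Qed.

(* dyadic-type decomposition of ]0, u] with ratio 4 *)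
Lemma gi0_le u : 0 < u -> (gi 0 u <= (4 * Num.sqrt u)%:E)%E.
Proof.
move=> u0; pose F n : set R := `]u / 4 ^+ n, u]%classic.
have p4 n : 0 < 4 ^+ n :> R by rewrite exprn_gt0.
have un n : 0 < u / 4 ^+ n by rewrite divr_gt0.
have uS n : u / 4 ^+ n.+1 <= u / 4 ^+ n.
  by rewrite ler_pM2l// lef_pV2 ?posrE// exprS ler_peMl ?ltW//; lra.
have ule n : u / 4 ^+ n <= u.
  by rewrite ler_pdivrMr// ler_peMr ?(ltW u0)// exprn_ege1//; lra.
have Fn n : (gi (u / 4 ^+ n) u <= (4 * Num.sqrt u * (1 - (1 / 2) ^+ n))%:E)%E.
  elim: n => [|n ih].
    rewrite !expr0 divr1 subrr mulr0 /gi set_itv_ge ?integral_set0//.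
    by rewrite bnd_simp ltxx.
  rewrite (gi_split (uS n) (ule n)).
  have h : (gi (u / 4 ^+ n.+1) (u / 4 ^+ n) <= (4 * Num.sqrt u * (1 / 2) ^+ n.+1)%:E)%E.
    apply: le_trans (gi_le (un _) (uS n)) _; rewrite lee_fin gfE//.
    have sE : Num.sqrt (u / 4 ^+ n.+1) = Num.sqrt u / 2 ^+ n.+1.
      have -> : u / 4 ^+ n.+1 = (Num.sqrt u / 2 ^+ n.+1) ^+ 2.
        rewrite expr_div_n sqr_sqrtr ?(ltW u0)// -exprM mulnC exprM.
        by rewrite (_ : 2 ^+ 2 = 4)//; ring.
      by rewrite sqrtr_sqr ger0_norm// divr_ge0 ?sqrtr_ge0 ?exprn_ge0.
    rewrite sE; set s := Num.sqrt u.
    have s0 : 0 < s by rewrite sqrtr_gt0.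
    have us : u = s ^+ 2 by rewrite sqr_sqrtr// ltW.
    have q0 : 0 < 2 ^+ n :> R by rewrite exprn_gt0.
    have e1 : expR (- (u / 4 ^+ n.+1)) <= 1.
      by rewrite -[leRHS]expR0 ler_expR oppr_le0 (ltW (un _)).
    set ee := expR _ in e1 *.
    have e4 : 4 ^+ n = (2 ^+ n) ^+ 2 :> R.
      by rewrite -exprM mulnC exprM (_ : 2 ^+ 2 = 4)//; ring.
    rewrite [4 ^+ n.+1]exprS e4 [2 ^+ n.+1]exprS [(1 / 2) ^+ n.+1]exprS.
    rewrite [(1 / 2) ^+ n]expr_div_n expr1n {1 2}us; set q := 2 ^+ n in q0 *.
    have -> : (s ^+ 2 / q ^+ 2 - s ^+ 2 / (4 * q ^+ 2)) * ((s / (2 * q))^-1 * ee) =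
       3 / 2 * (s / q) * ee by field; rewrite !gt_eqF.
    have -> : 4 * s * (1 / 2 * (1 / q)) = 2 * (s / q) by field; rewrite gt_eqF.
    have sq : 0 < s / q by rewrite divr_gt0.
    have : s / q * ee <= s / q * 1 by rewrite ler_wpM2l// ltW.
    by lra.
  apply: le_trans (leeD h ih) _; rewrite -EFinD lee_fin exprS.
  by set q := (1 / 2) ^+ n; lra.
have cvF : (\int[mu]_(x in F n) (gf x)%:E @[n --> \oo] -->
    \int[mu]_(x in \bigcup_n F n) (gf x)%:E)%E.
  apply: ge0_nondecreasing_set_cvg_integral => //.
  - apply/nondecreasing_seqP => n; rewrite subsetEset => x; rewrite /F /= !in_itv /=.
    by move=> /andP[h ->]; rewrite andbT; exact: le_lt_trans h.
  - by move=> n; rewrite /F.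
  - by move=> n; apply/measurable_funTS/measurable_EFinP; exact: measurable_gf.
  - by move=> n x _; rewrite lee_fin gf_ge0.
have FE : \bigcup_n F n = `]0, u]%classic.
  apply/seteqP; split => x.
    move=> [n _]; rewrite /F /= !in_itv /= => /andP[h ->]; rewrite andbT.
    exact: lt_trans h.
  rewrite /= in_itv /= => /andP[x0 xu].
  have cv : u * (1 / 4) ^+ n @[n --> \oo] --> 0.
    rewrite -(mulr0 u); apply: cvgMr; apply: cvg_expr.
    by rewrite ger0_norm; lra.
  move/cvgrPdist_lt: cv => /(_ _ x0) [N _ /(_ N (leqnn N))] /=.
  rewrite sub0r normrN => /(le_lt_trans (ler_norm _)) h.
  exists N => //; rewrite /F /= in_itv /= xu andbT.
  by rewrite expr_div_n expr1n mul1r in h.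
rewrite FE in cvF; apply: (lee_cvg_to cvF (cvg_cst _)); apply: nearW => n.
apply: le_trans (Fn n) _; rewrite lee_fin.
have : 0 <= 4 * Num.sqrt u * (1 / 2) ^+ n.
  by rewrite !mulr_ge0 ?sqrtr_ge0 ?exprn_ge0.
by lra.
Qed.

(** From [exp 1 >= 2]; a crude geometric decay that makes the integral at infinity finite. *)
Lemma gf_le_pow n : gf n.+1%:R <= (1 / 2) ^+ n.+1.
Proof.
have n1 : 1 <= n.+1%:R :> R by rewrite ler1n.
rewrite gfE// (@le_trans _ _ (1 * expR (- n.+1%:R)))//.
  rewrite ler_wpM2r ?expR_ge0// invf_le1 ?sqrtr_gt0//.
  by rewrite -[leLHS]sqrtr1 ler_wsqrtr.
rewrite mul1r expRN -[X in expR X]mulr1 expRM_natl div1r exprVn lef_pV2 ?posrE ?exprn_gt0 ?expR_gt0//.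
rewrite lerXn2r ?nnegrE ?expR_ge0//.
by have := @expR_ge1Dx R 1; lra.
Qed.

Lemma gi1_le n : (gi 1 n.+1%:R <= (1 - (1 / 2) ^+ n)%:E)%E.
Proof.
elim: n => [|n ih].
  by rewrite expr0 subrr /gi set_itv_ge ?integral_set0// bnd_simp ltxx.
have n1 : 1 <= n.+1%:R :> R by rewrite ler1n.
have nn : n.+1%:R <= n.+2%:R :> R by rewrite ler_nat.
rewrite (gi_split n1 nn); apply: le_trans (leeD ih (gi_le _ nn)) _; first by rewrite ltr0n.
rewrite -EFinD lee_fin -(natr1 n.+1).
have := gf_le_pow n; rewrite exprS; set q := (1 / 2) ^+ n; set g := gf _.
have -> : n.+1%:R + 1 - n.+1%:R = 1 :> R by ring.
by lra.
Qed.

Lemma gi_cvg : gi 0 n.+1%:R @[n --> \oo] --> (\int[mu]_(x in `]0%R, +oo[) (gf x)%:E)%E.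
Proof.
pose F n : set R := `]0, n.+1%:R]%classic.
have -> : `]0, +oo[%classic = \bigcup_n F n.
  apply/seteqP; split => x.
    rewrite /= in_itv /= andbT => x0; exists (Num.trunc x) => //.
    by rewrite /F /= in_itv /= x0 /=; have /andP[_ /ltW] := truncn_itv (ltW x0).
  by move=> [n _]; rewrite /F /= !in_itv /= andbT => /andP[].
apply: ge0_nondecreasing_set_cvg_integral => //.
- apply/nondecreasing_seqP => n; rewrite subsetEset => x; rewrite /F /= !in_itv /=.
  by move=> /andP[-> h] /=; apply: le_trans h _; rewrite ler_nat.
- by move=> n; apply/measurable_funTS/measurable_EFinP; exact: measurable_gf.
- by move=> n x _; rewrite lee_fin gf_ge0.
Qed.

Lemma gi_le5 u : 0 < u -> (gi 0 u <= 5%:E)%E.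
Proof.
move=> u0; pose n := Num.trunc u.
have un : u <= n.+1%:R by have /andP[_ /ltW] := truncn_itv (ltW u0).
have n1 : 1 <= n.+1%:R :> R by rewrite ler1n.
apply: (@le_trans _ _ (gi 0 n.+1%:R)).
  by rewrite (gi_split (ltW u0) un) leeDl ?gi_ge0.
rewrite (gi_split ler01 n1); apply: le_trans (leeD (gi0_le ltr01) (gi1_le n)) _.
rewrite -EFinD lee_fin sqrtr1; have : 0 <= (1 / 2) ^+ n :> R by rewrite exprn_ge0.
by lra.
Qed.

Definition gphi u : R := fine (gi 0 u).

Lemma gphiE u : 0 < u -> gi 0 u = (gphi u)%:E.
Proof.
move=> u0; rewrite fineK// ge0_fin_numE ?gi_ge0//.
by apply: le_lt_trans (gi_le5 u0) _; rewrite ltry.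
Qed.

Lemma GammaE : (\int[mu]_(x in `]0%R, +oo[) (gf x)%:E)%E = (Gamma (1 / 2) : R)%:E.
Proof.
rewrite /Gamma /Rintegral fineK// ge0_fin_numE; last first.
  by apply: integral_ge0 => x _; rewrite lee_fin gf_ge0.
apply: (@le_lt_trans _ _ 5%:E); last by rewrite ltry.
apply: (lee_cvg_to gi_cvg (cvg_cst _)); apply: nearW => n.
by apply: gi_le5; rewrite ltr0n.
Qed.

Lemma gphi_cvg : gphi n.+1%:R @[n --> \oo] --> (Gamma (1 / 2) : R).
Proof. by apply: fine_cvg; rewrite -GammaE; exact: gi_cvg. Qed.

Lemma gphi_nd u v : 0 < u -> u <= v -> gphi u <= gphi v.
Proof.
move=> u0 uv; have v0 := lt_le_trans u0 uv; rewrite -lee_fin -!gphiE//.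
by rewrite (gi_split (ltW u0) uv) leeDl ?gi_ge0.
Qed.

Lemma gphi_le_Gamma u : 0 < u -> gphi u <= Gamma (1 / 2).
Proof.
move=> u0; apply: (ler_cvg_to (cvg_cst (gphi u)) gphi_cvg).
near=> n; apply: gphi_nd => //.
apply: (@le_trans _ _ n%:R); last by rewrite ler_nat.
near: n; exact: nbhs_infty_ger.
Unshelve. all: by end_near. Qed.

Lemma gphi_le_sqrt u : 0 < u -> gphi u <= 4 * Num.sqrt u.
Proof. by move=> u0; rewrite -lee_fin -gphiE// gi0_le. Qed.

Lemma gphi_ge u : 0 < u -> u * gf u <= gphi u.
Proof.
by move=> u0; rewrite -lee_fin -gphiE//; have := gi_ge (lexx 0) (ltW u0); rewrite subr0.
Qed.

Lemma gphi_diff u v : 0 < u -> u <= v -> (v - u) * gf v <= gphi v - gphi u <= (v - u) * gf u.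
Proof.
move=> u0 uv; have v0 := lt_le_trans u0 uv.
have e : gi u v = (gphi v - gphi u)%:E.
  have := gi_split (ltW u0) uv; rewrite !gphiE//.
  have := gi_ge0 u v; case: (gi u v) => [r|//|//] _.
    by rewrite -EFinD => -[->]; congr EFin; ring.
by rewrite -!lee_fin -e gi_ge ?gi_le// ltW.
Qed.

Lemma Gamma_gt0 : 0 < Gamma (1 / 2) :> R.
Proof.
apply: lt_le_trans (gphi_le_Gamma ltr01); apply: lt_le_trans (gphi_ge ltr01).
by rewrite mul1r gfE// mulr_gt0 ?expR_gt0// invr_gt0 sqrtr_gt0.
Qed.

(** [gf] is decreasing, so right-endpoint sums lie below the integral from 0 and above the integral
    started one cell later; the singular first cell costs [gphi e]. *)
Lemma riemann_bounds e n : 0 < e ->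
  gphi (e * n.+1%:R) - gphi e <= \sum_(t < n) e * gf (e * t.+1%:R) <= Gamma (1 / 2).
Proof.
move=> e0; have en k : 0 < e * k.+1%:R by rewrite mulr_gt0// ltr0n.
have enn k : e * k.+1%:R <= e * k.+2%:R by rewrite ler_pM2l// ler_nat.
have ee k : e * k.+2%:R - e * k.+1%:R = e by rewrite -(natr1 k.+1); ring.
apply/andP; split.
  elim: n => [|n ih]; first by rewrite big_ord0 mulr1 subrr.
  rewrite big_ord_recr /=; have /andP[_] := gphi_diff (en n) (enn n).
  by rewrite ee; lra.
case: n => [|n]; first by rewrite big_ord0 ltW ?Gamma_gt0.
apply: le_trans (gphi_le_Gamma (en n)).
elim: n => [|n ih].
  by rewrite big_ord1 /= mulr1; have := gphi_ge e0.
rewrite big_ord_recr /=; have /andP[+ _] := gphi_diff (en n) (enn n).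
by rewrite ee; lra.
Qed.

Lemma riemann_gamma e : 0 < e -> exists2 l,
  series (fun t => e * gf (e * t.+1%:R)) @ \oo --> l &
  Gamma (1 / 2) - 4 * Num.sqrt e <= l <= Gamma (1 / 2).
Proof.
move=> e0; pose s := series (fun t => e * gf (e * t.+1%:R)).
have sE n : s n = \sum_(t < n) e * gf (e * t.+1%:R) by rewrite /s /series /= big_mkord.
have cs : cvgn s.
  apply: nondecreasing_is_cvgn.
    apply/nondecreasing_seqP => n; rewrite !sE big_ord_recr /= lerDl.
    by rewrite mulr_ge0 ?gf_ge0// ltW.
  by exists (Gamma (1 / 2)) => _ [n _ <-]; rewrite sE; case/andP: (riemann_bounds n e0).
exists (limn s) => //; apply/andP; split; last first.
  by apply: limr_le => //; apply: nearW => n; rewrite sE; case/andP: (riemann_bounds n e0).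
rewrite lerBlDr; apply: (ler_cvg_to gphi_cvg (cvg_cst _)); apply: nearW => k.
pose n := Num.trunc (k.+1%:R / e).
have kn : k.+1%:R <= e * n.+1%:R.
  have k0 : 0 <= k.+1%:R / e by rewrite divr_ge0 ?ler0n// ltW.
  by have /andP[_] := truncn_itv k0; rewrite ltr_pdivrMr// mulrC => /ltW.
apply: le_trans (gphi_nd _ kn) _; first by rewrite ltr0n.
have h : s n <= limn s.
  apply: nondecreasing_cvgn_le => //; apply/nondecreasing_seqP => i; rewrite !sE big_ord_recr /= lerDl.
  by rewrite mulr_ge0 ?gf_ge0// ltW.
have /andP[+ _] := riemann_bounds n e0; rewrite -sE; have := gphi_le_sqrt e0.
by lra.
Qed.

End gamma_half.

(** * Karamata's theorem for nonincreasing coefficients *)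

Section tauberian.
Context {R : realType}.
Variables (p : nat -> R) (S : R -> R) (kap : R).
Hypothesis p_noninc : forall s t, (s <= t)%N -> p t <= p s.
Hypothesis p_ge0 : forall t, 0 <= p t.
Hypothesis kap_gt0 : 0 < kap.
Hypothesis S_series : forall z, 0 <= z < 1 -> series (fun t => p t * z ^+ t) @ \oo --> S z.
Hypothesis S_asymp : S z * Num.sqrt (1 - z) @[z --> 1^'-] --> kap.

Local Notation G := (Gamma (1 / 2) : R).
Let G0 : 0 < G := Gamma_gt0.

(* the expected asymptotics of [p]; the junk value at [t = 0] is [0] as [0^-1 = 0] *)
Definition tref (t : nat) : R := kap / G * (Num.sqrt t%:R)^-1.
Definition tdiff t := p t - tref t.
Definition tE (m t : nat) : R := expR (- (t%:R / m%:R)).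

Lemma tref_ge0 t : 0 <= tref t.
Proof. by rewrite mulr_ge0 ?divr_ge0 ?invr_ge0 ?sqrtr_ge0 ?ltW. Qed.

Lemma tE_gt0 m t : 0 < tE m t. Proof. exact: expR_gt0. Qed.

Lemma tE_le1 m t : tE m t <= 1.
Proof. by rewrite -[leRHS]expR0 ler_expR oppr_le0 divr_ge0. Qed.

Lemma tE_expz m t k : tE m t ^+ k = expR (- (k%:R / m%:R)) ^+ t.
Proof. by rewrite /tE -!expRM_natl; congr expR; ring. Qed.

(** At [z = exp (- k / m)] the series of [t^(-1/2) z^t] is, up to a power of the mesh, the Riemann
    sum of [gf] with mesh [k / m]. *)
Lemma tref_series m k : (0 < m)%N -> (0 < k)%N -> exists2 l,
  series (fun t => tref t * tE m t ^+ k) @ \oo --> kap / G / Num.sqrt (k%:R / m%:R) * l &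
  G - 4 * Num.sqrt (k%:R / m%:R) <= l <= G.
Proof.
move=> m0 k0; pose e : R := k%:R / m%:R.
have e0 : 0 < e by rewrite divr_gt0 ?ltr0n.
have [l sl lb] := riemann_gamma e0; exists l => //.
rewrite -cvg_shiftS /=.
rewrite (_ : (fun n => _) = fun n => kap / G / Num.sqrt e * series (fun t => e * gf (e * t.+1%:R)) n).
  by apply: cvgMr.
apply/funext => n; rewrite /series /= big_nat_recl//= big_mkord mulr_sumr.
rewrite {1}/tref sqrtr0 invr0 mulr0 mul0r add0r big_mkord; apply: eq_bigr => t _.
have t0 : 0 < t.+1%:R :> R by rewrite ltr0n.
have et : 0 < e * t.+1%:R by rewrite mulr_gt0.
have se : Num.sqrt (e * t.+1%:R) = Num.sqrt e * Num.sqrt t.+1%:R.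
  by rewrite (@sqrtrM _ e) ?(ltW e0).
rewrite gfE// se /tref tE_expz -expRM_natl.
have s0 : 0 < Num.sqrt e by rewrite sqrtr_gt0.
have st : 0 < Num.sqrt t.+1%:R :> R by rewrite sqrtr_gt0.
rewrite -[X in _ = _ * (X * _)](@sqr_sqrtr _ e) ?(ltW e0)//.
have -> : t.+1%:R * - (k%:R / m%:R) = - (e * t.+1%:R) by rewrite /e; ring.
by field; rewrite !gt_eqF.
Qed.

Lemma exp_lt1 m k : (0 < m)%N -> (0 < k)%N -> 0 <= expR (- (k%:R / m%:R) : R) < 1.
Proof.
move=> m0 k0; rewrite expR_ge0 -[ltRHS]expR0 ltr_expR oppr_lt0.
by rewrite divr_gt0 ?ltr0n.
Qed.

Lemma cvg_invn : (m%:R : R)^-1 @[m --> \oo] --> (0 : R).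
Proof.
apply/cvgrPdist_lt => e e0; near=> m.
rewrite sub0r normrN ger0_norm ?invr_ge0//.
have me : e^-1 < m%:R by near: m; exact: nbhs_infty_gtr.
have m0 : 0 < m%:R :> R by apply: lt_trans me; rewrite invr_gt0.
by rewrite -[ltRHS]invrK ltf_pV2 ?posrE ?invr_gt0.
Unshelve. all: by end_near. Qed.

Lemma cvg_exp_rate k : (0 < k)%N ->
  m%:R * (1 - expR (- (k%:R / m%:R))) @[m --> \oo] --> (k%:R : R).
Proof.
move=> k0; have k0' : 0 < k%:R :> R by rewrite ltr0n.
apply: (@squeeze_cvgr _ _ _ _ (fun m => k%:R * (1 + k%:R * m%:R^-1)^-1) (fun=> k%:R)).
- near=> m; have m0 : 0 < m%:R :> R by rewrite ltr0n; near: m; exact: nbhs_infty_gt.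
  have e0 : 0 < k%:R / m%:R :> R by rewrite divr_gt0.
  set e := k%:R / m%:R in e0 *.
  have kE : k%:R = m%:R * e by rewrite /e mulrC divfK// gt_eqF.
  rewrite -/e {1 2}kE -mulrA !ler_pM2l//; apply/andP; split.
    rewrite -[leLHS](_ : 1 - (1 + e)^-1 = _); last by field; rewrite gt_eqF// addr_gt0.
    rewrite lerD2l lerN2 expRN lef_pV2 ?posrE ?expR_gt0 ?addr_gt0//.
    exact: expR_ge1Dx.
  by have := @expR_ge1Dx R (- e); lra.
- have h : k%:R * (1 + k%:R * m%:R^-1)^-1 @[m --> \oo] --> (k%:R * (1 + k%:R * 0)^-1 : R).
    apply: cvgMr; apply: cvgV; first by rewrite mulr0 addr0 oner_eq0.
    by apply: cvgD; [exact: cvg_cst|apply: cvgMr; exact: cvg_invn].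
  by rewrite mulr0 addr0 invr1 mulr1 in h.
- exact: cvg_cst.
Unshelve. all: by end_near. Qed.

(** The assumption on [S] along [z = exp (- k / m)], where [m (1 - z)] tends to [k]. The reference
    sequence has the same limit, so the transforms of [tdiff] vanish asymptotically. *)
Lemma p_laplace k : (0 < k)%N ->
  (Num.sqrt m%:R)^-1 * S (expR (- (k%:R / m%:R))) @[m --> \oo] --> kap / Num.sqrt k%:R.
Proof.
move=> k0; have k0' : 0 < k%:R :> R by rewrite ltr0n.
pose z m := expR (- (k%:R / m%:R)) : R.
have h1 : S (z m.+1) * Num.sqrt (1 - z m.+1) @[m --> \oo] --> kap.
  move/cvg_at_leftP : S_asymp; apply; split=> [m|].
    by have /andP[] := exp_lt1 (ltn0Sn m) k0.
  have kl0 : - (k%:R / m.+1%:R) @[m --> \oo] --> (0 : R).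
    rewrite -(@oppr0 R) -(@mulr0 R k%:R); apply: cvgN; apply: cvgMr.
    by have : (n%:R^-1 : R) @[n --> \oo] --> (0 : R) by [exact: cvg_invn]; rewrite -cvg_shiftS.
  rewrite -(@expR0 R).
  exact: (@continuous_cvg _ _ _ _ _ _ (@expR R) _ (@continuous_expR R 0) kl0).
rewrite -cvg_shiftS.
have h2 : (Num.sqrt (m.+1%:R * (1 - z m.+1)))^-1 @[m --> \oo] --> (Num.sqrt k%:R)^-1.
  apply: cvgV; first by rewrite gt_eqF// sqrtr_gt0.
  apply: continuous_cvg; first exact: sqrt_continuous.
  by have := cvg_exp_rate k0; rewrite -cvg_shiftS.
have h3 : S (z m.+1) * Num.sqrt (1 - z m.+1) * (Num.sqrt (m.+1%:R * (1 - z m.+1)))^-1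
    @[m --> \oo] --> kap / Num.sqrt k%:R by exact: cvgM.
apply: cvg_trans h3; apply: near_eq_cvg; apply: nearW => m /=.
have /andP[_ z1] := exp_lt1 (ltn0Sn m) k0; rewrite -/(z _) in z1 *.
have s1 : 0 < Num.sqrt (1 - z m.+1) by rewrite sqrtr_gt0 subr_gt0.
have s2 : 0 < Num.sqrt m.+1%:R :> R by rewrite sqrtr_gt0.
by rewrite sqrtrM//; field; rewrite !gt_eqF.
Unshelve. all: by end_near. Qed.

Definition rlap k m : R := (Num.sqrt m%:R)^-1 * limn (series (fun t => tref t * tE m t ^+ k)).
Definition plap k m : R := (Num.sqrt m%:R)^-1 * S (expR (- (k%:R / m%:R))).

Lemma r_laplace k : (0 < k)%N -> rlap k m @[m --> \oo] --> kap / Num.sqrt k%:R.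
Proof.
move=> k0; have k0' : 0 < k%:R :> R by rewrite ltr0n.
have sk : 0 < Num.sqrt k%:R :> R by rewrite sqrtr_gt0.
pose c := kap / G / Num.sqrt k%:R.
have c0 : 0 < c by rewrite !divr_gt0.
have cG : c * G = kap / Num.sqrt k%:R by rewrite /c; field; rewrite !gt_eqF.
apply: (@squeeze_cvgr _ _ _ _ (fun m => c * (G - 4 * Num.sqrt (k%:R * m%:R^-1))) (fun=> c * G)).
- near=> m; have m0 : (0 < m)%N by near: m; exact: nbhs_infty_gt.
  have m0' : 0 < m%:R :> R by rewrite ltr0n.
  have [l sl /andP[l1 l2]] := tref_series m0 k0.
  have sm : 0 < Num.sqrt m%:R :> R by rewrite sqrtr_gt0.
  rewrite /rlap (cvg_lim _ sl)//.
  have -> : (Num.sqrt m%:R)^-1 * (kap / G / Num.sqrt (k%:R / m%:R) * l) = c * l.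
    rewrite sqrtrM ?ler0n// sqrtrV ?ler0n// /c; field; rewrite !gt_eqF//.
  by rewrite !ler_pM2l// l1.
- rewrite -cG; have h : c * (G - 4 * Num.sqrt (k%:R * m%:R^-1)) @[m --> \oo] --> c * (G - 4 * Num.sqrt (k%:R * 0)).
    apply: cvgMr; apply: cvgB; first exact: cvg_cst.
    apply: cvgMr; apply: continuous_cvg; first exact: sqrt_continuous.
    by apply: cvgMr; exact: cvg_invn.
  by rewrite mulr0 sqrtr0 mulr0 subr0 in h.
- by rewrite cG; exact: cvg_cst.
Unshelve. all: by end_near. Qed.

Lemma sqrtn_gt0 m : (0 < m)%N -> 0 < Num.sqrt m%:R :> R.
Proof. by move=> m0; rewrite sqrtr_gt0 ltr0n. Qed.

Lemma p_series m k : (0 < m)%N -> (0 < k)%N ->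
  series (fun t => p t * tE m t ^+ k) @ \oo --> Num.sqrt m%:R * plap k m.
Proof.
move=> m0 k0; rewrite /plap mulrA divff ?gt_eqF ?sqrtn_gt0// mul1r.
rewrite (_ : (fun t => p t * tE m t ^+ k) = (fun t => p t * expR (- (k%:R / m%:R)) ^+ t)).
  exact: S_series (exp_lt1 m0 k0).
by apply/funext => t; rewrite tE_expz.
Qed.

Lemma r_series m k : (0 < m)%N -> (0 < k)%N ->
  series (fun t => tref t * tE m t ^+ k) @ \oo --> Num.sqrt m%:R * rlap k m.
Proof.
move=> m0 k0; rewrite /rlap mulrA divff ?gt_eqF ?sqrtn_gt0// mul1r.
have [l sl _] := tref_series m0 k0.
by apply/cvg_ex; eexists; exact: sl.
Qed.

Lemma tdiff_series m k : (0 < m)%N -> (0 < k)%N ->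
  series (fun t => tdiff t * tE m t ^+ k) @ \oo -->
    Num.sqrt m%:R * (plap k m - rlap k m).
Proof.
move=> m0 k0; rewrite mulrBr.
rewrite (_ : series _ = series (fun t => p t * tE m t ^+ k) \- series (fun t => tref t * tE m t ^+ k)).
  by apply: cvgB; [exact: p_series|exact: r_series].
apply/funext => n; rewrite /series /= -sumrB; apply: eq_bigr => t _.
by rewrite /tdiff mulrBl.
Qed.

(** The scaled sum of [tdiff] against [x q(x)] at [x = tE m t]. The exponents start at 1, as the
    series would not converge against a constant. *)
Definition polylap (q : {poly R}) m : R := \sum_(i < size q) q`_i * (plap i.+1 m - rlap i.+1 m).

Lemma polylap_cvg q : polylap q m @[m --> \oo] --> 0.
Proof.
rewrite -[X in _ --> X](_ : \sum_(i < size q) q`_i * 0 = _); last first.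
  by rewrite big1// => i _; rewrite mulr0.
apply: cvgr_sum => i; apply: cvgMr.
rewrite -(subrr (kap / Num.sqrt i.+1%:R)).
by apply: cvgB; [exact: p_laplace|exact: r_laplace].
Qed.

Lemma poly_series q m : (0 < m)%N ->
  series (fun t => tdiff t * (tE m t * q.[tE m t])) @ \oo --> Num.sqrt m%:R * polylap q m.
Proof.
move=> m0; rewrite (_ : series _ = fun n => \sum_(i < size q) q`_i *
    series (fun t => tdiff t * tE m t ^+ i.+1) n); last first.
  apply/funext => n; rewrite /series /=.
  under [RHS]eq_bigr do rewrite mulr_sumr.
  rewrite exchange_big /=; apply: eq_bigr => t _.
  rewrite horner_coef !mulr_sumr; apply: eq_bigr => i _.
  by rewrite exprS; ring.
rewrite /polylap mulr_sumr; apply: cvgr_sum => i.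
by rewrite mulrCA; apply: cvgMr; exact: tdiff_series.
Qed.

(** A tent on [A, B]; being Lipschitz, it is uniformly close to polynomials, as an indicator is
    not. *)
Definition hat (A B x : R) : R := Num.max 0 (Num.min (x - A) (B - x)).

Lemma hat_ge0 A B x : 0 <= hat A B x. Proof. by rewrite le_max lexx. Qed.

Lemma hat_lip A B x y : `|hat A B x - hat A B y| <= `|x - y|.
Proof.
have aux a b : hat A B a <= hat A B b + `|a - b|.
  have h1 : a - b <= `|a - b| by exact: ler_norm.
  have h2 : b - a <= `|a - b| by rewrite distrC; exact: ler_norm.
  rewrite {1}/hat ge_max; apply/andP; split; first by rewrite addr_ge0 ?hat_ge0.
  rewrite -lerBlDr le_max; apply/orP; right; rewrite le_min; apply/andP; split.
    rewrite lerBlDr ge_min; apply/orP; left; lra.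
  by rewrite lerBlDr ge_min; apply/orP; right; lra.
rewrite ler_norml; apply/andP; split.
  by have := aux y x; rewrite distrC; lra.
by have := aux x y; lra.
Qed.

Section bump.
Variables u v : R.
Hypothesis u0 : 0 < u.
Hypothesis uv : u < v.
Hypothesis v2 : v <= 2.

(** A tent in the variable [exp (- t / m)]: it lives on [u m < t < v m], inside [t < 2 m] as
    [v <= 2]. The factor [tE] is split off so that the uniform error of the polynomial approximation
    is multiplied by a summable weight. *)
Definition bump m t : R := tE m t * hat (expR (- v)) (expR (- u)) (tE m t).

Lemma bump_ge0 m t : 0 <= bump m t.
Proof. by rewrite mulr_ge0 ?hat_ge0// ltW ?tE_gt0. Qed.

Lemma bump_lt0 m t : (0 < m)%N -> t%:R <= u * m%:R -> bump m t = 0.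
Proof.
move=> m0 tu; have m0' : 0 < m%:R :> R by rewrite ltr0n.
rewrite /bump /hat max_l ?mulr0// ge_min; apply/orP; right.
by rewrite subr_le0 ler_expR lerN2 ler_pdivrMr.
Qed.

Lemma bump_gt0 m t : (0 < m)%N -> v * m%:R <= t%:R -> bump m t = 0.
Proof.
move=> m0 tu; have m0' : 0 < m%:R :> R by rewrite ltr0n.
rewrite /bump /hat max_l ?mulr0// ge_min; apply/orP; left.
by rewrite subr_le0 ler_expR lerN2 ler_pdivlMr.
Qed.

Definition tT m := \sum_(t < 2 * m) tdiff t * bump m t.
Definition tF m := \sum_(t < 2 * m) bump m t.

Lemma tT_extend m n : (0 < m)%N -> (2 * m <= n)%N ->
  \sum_(t < n) tdiff t * bump m t = tT m.
Proof.
move=> m0 mn; rewrite /tT (big_ord_widen _ (fun t => tdiff t * bump m t) mn).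
rewrite [RHS]big_mkcond /=; apply: eq_bigr => t _; case: ifPn => //.
rewrite -leqNgt => mt; rewrite bump_gt0 ?mulr0//.
apply: (@le_trans _ _ (2 * m%:R)); first by rewrite ler_wpM2r.
by rewrite -natrM ler_nat.
Qed.

Lemma partial_le (a : nat -> R) l n : (forall t, 0 <= a t) ->
  series a @ \oo --> l -> \sum_(t < n) a t <= l.
Proof.
move=> a0 al; have e : \sum_(t < n) a t = series a n by rewrite /series /= big_mkord.
rewrite e -(cvg_lim _ al)//; apply: nondecreasing_cvgn_le; last by apply/cvg_ex; exists l.
by apply/nondecreasing_seqP => k; rewrite /series /= big_nat_recr//= lerDl.
Qed.

Lemma tT_bound q e m : (0 < m)%N -> 0 <= e ->
  (forall x, 0 <= x <= 1 -> `|hat (expR (- v)) (expR (- u)) x - q.[x]| <= e) ->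
  `|tT m - Num.sqrt m%:R * polylap q m| <= e * (Num.sqrt m%:R * (plap 1 m + rlap 1 m)).
Proof.
move=> m0 e0 hq.
have cv : `|tT m - series (fun t => tdiff t * (tE m t * q.[tE m t])) n| @[n --> \oo] -->
    `|tT m - Num.sqrt m%:R * polylap q m|.
  by apply: cvg_norm; apply: cvgB; [exact: cvg_cst|exact: poly_series].
apply: (ler_cvg_to cv (cvg_cst _)); near=> n.
have mn : (2 * m <= n)%N by near: n; exact: nbhs_infty_ge.
rewrite -(tT_extend m0 mn) /series /= big_mkord -sumrB.
apply: (@le_trans _ _ (\sum_(t < n) e * (p t * tE m t ^+ 1 + tref t * tE m t ^+ 1))).
  apply: le_trans (ler_norm_sum _ _ _) _; apply: ler_sum => t _.
  have -> : tdiff t * bump m t - tdiff t * (tE m t * q.[tE m t]) =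
      tdiff t * tE m t * (hat (expR (- v)) (expR (- u)) (tE m t) - q.[tE m t]).
    by rewrite /bump; ring.
  have E0 := tE_gt0 m t; have E1 := tE_le1 m t.
  rewrite normrM mulrC; apply: ler_pM => //.
    by apply: hq; rewrite ltW.
  rewrite normrM (ger0_norm (ltW E0)) !expr1 -mulrDl ler_wpM2r ?(ltW E0)//.
  rewrite /tdiff; apply: le_trans (ler_normB _ _) _.
  by rewrite !ger0_norm ?p_ge0 ?tref_ge0.
rewrite -mulr_sumr ler_wpM2l// big_split /= mulrDr; apply: lerD.
  apply: (@partial_le (fun t => p t * tE m t ^+ 1) _ n _ (p_series m0 (ltn0Sn 0))) => t.
  by rewrite mulr_ge0 ?exprn_ge0 ?p_ge0// ltW ?tE_gt0.
apply: (@partial_le (fun t => tref t * tE m t ^+ 1) _ n _ (r_series m0 (ltn0Sn 0))) => t.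
by rewrite mulr_ge0 ?exprn_ge0 ?tref_ge0// ltW ?tE_gt0.
Unshelve. all: by end_near. Qed.

Lemma tT_cvg : (Num.sqrt m%:R)^-1 * tT m @[m --> \oo] --> 0.
Proof.
apply/cvgrPdist_lt => e e0.
pose K := 2 * kap + 1; have K0 : 0 < K by rewrite addr_gt0// mulr_gt0.
pose e1 := e / 2 / K; have e10 : 0 < e1 by rewrite !divr_gt0.
have [q hq] := weierstrass e10 (fun x y _ _ => hat_lip (expR (- v)) (expR (- u)) x y).
have cv : plap 1 m + rlap 1 m @[m --> \oo] --> kap / Num.sqrt 1%:R + kap / Num.sqrt 1%:R.
  by apply: cvgD; [exact: p_laplace|exact: r_laplace].
have e20 : 0 < e / 2 by rewrite divr_gt0.
near=> m; have m0 : (0 < m)%N by near: m; exact: nbhs_infty_gt.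
have sm := sqrtn_gt0 m0.
have h1 : `|polylap q m| < e / 2.
  by rewrite -normrN -sub0r; near: m; move/cvgrPdist_lt: (polylap_cvg q); exact.
have h2 : plap 1 m + rlap 1 m <= K.
  near: m; apply: cvgr_le cv _ _.
  by rewrite sqrtr1 divr1 /K; lra.
rewrite sub0r normrN normrM ger0_norm ?invr_ge0 ?(ltW sm)//.
rewrite mulrC ltr_pdivrMr//.
have h3 := tT_bound m0 (ltW e10) hq.
have h4 : `|tT m| <= `|tT m - Num.sqrt m%:R * polylap q m| + `|Num.sqrt m%:R * polylap q m|.
  by have := ler_normD (tT m - Num.sqrt m%:R * polylap q m) (Num.sqrt m%:R * polylap q m); rewrite subrK.
have h5 : `|Num.sqrt m%:R * polylap q m| < Num.sqrt m%:R * (e / 2).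
  by rewrite normrM (ger0_norm (ltW sm)) ltr_pM2l.
have h6 : e1 * (Num.sqrt m%:R * (plap 1 m + rlap 1 m)) <= Num.sqrt m%:R * (e / 2).
  have -> : Num.sqrt m%:R * (e / 2) = e1 * (Num.sqrt m%:R * K).
    by rewrite /e1; field; rewrite gt_eqF.
  by rewrite ler_wpM2l ?(ltW e10)// ler_wpM2l ?(ltW sm).
by lra.
Unshelve. all: by end_near. Qed.

(** In the middle third of the window the bump is bounded below, and of order [m] integers lie
    there. *)
Lemma tF_lower : exists2 c, 0 < c & \forall m \near \oo, c * m%:R <= tF m.
Proof.
have uv' : u < v := uv; have u0' : 0 < u := u0; have v2' : v <= 2 := v2; pose u' : R := (2 * u + v) / 3; pose v' : R := (u + 2 * v) / 3.
have uu' : u < u' by rewrite /u'; lra.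
have u'v' : u' < v' by rewrite /u' /v'; lra.
have v'v : v' < v by rewrite /v'; lra.
pose c0 := expR (- 2) * Num.min (expR (- v') - expR (- v)) (expR (- u) - expR (- u')).
have c00 : 0 < c0.
  by rewrite mulr_gt0 ?expR_gt0// lt_min !subr_gt0 !ltr_expR !ltrN2 v'v.
have low m t : (0 < m)%N -> u' * m%:R <= t%:R <= v' * m%:R -> c0 <= bump m t.
  move=> m0 /andP[t1 t2]; have m0' : 0 < m%:R :> R by rewrite ltr0n.
  have q1 : tE m t <= expR (- u') by rewrite ler_expR lerN2 ler_pdivlMr.
  have q2 : expR (- v') <= tE m t by rewrite ler_expR lerN2 ler_pdivrMr.
  apply: ler_pM; first exact: expR_ge0.
  - by rewrite le_min !subr_ge0 !ler_expR !lerN2 !ltW.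
  - by apply: le_trans q2; rewrite ler_expR lerN2; lra.
  - rewrite /hat le_max; apply/orP; right; rewrite le_min !ge_min; apply/andP; split.
      by rewrite lerD2r q2.
    by rewrite lerD2l lerN2 q1 orbT.
pose c := c0 * ((v' - u') / 2); exists c; first by rewrite mulr_gt0// divr_gt0// subr_gt0.
near=> m.
have m0 : (0 < m)%N by near: m; exact: nbhs_infty_gt.
have m0' : 0 < m%:R :> R by rewrite ltr0n.
have mL : 2 / (v' - u') <= m%:R by near: m; exact: nbhs_infty_ger.
pose n1 := Num.trunc (u' * m%:R); pose n2 := Num.trunc (v' * m%:R).
have /andP[a1 a2] : n1%:R <= u' * m%:R < n1.+1%:R by apply: truncn_itv; rewrite mulr_ge0 ?ltW//; lra.
have /andP[b1 b2] : n2%:R <= v' * m%:R < n2.+1%:R by apply: truncn_itv; rewrite mulr_ge0 ?ltW//; lra.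
have n12 : (n1 <= n2)%N.
  rewrite -ltnS -(@ltr_nat R); apply: le_lt_trans a1 _; apply: lt_trans b2.
  by rewrite ltr_pM2r.
have n2m : (n2 < 2 * m)%N.
  rewrite -(@ltr_nat R) natrM; apply: le_lt_trans b1 _; rewrite ltr_pM2r//; lra.
apply: (@le_trans _ _ (\sum_(n1.+1 <= t < n2.+1) bump m t)).
  apply: (@le_trans _ _ (\sum_(n1.+1 <= t < n2.+1) c0)); last first.
    rewrite big_nat [leRHS]big_nat; apply: ler_sum => t /andP[t1 t2]; apply: low => //.
    apply/andP; split.
      by apply: ltW; apply: lt_le_trans a2 _; rewrite ler_nat.
    by apply: le_trans b1; rewrite ler_nat -ltnS.
  rewrite sumr_const_nat subSS -[leRHS]mulr_natr /c -mulrA ler_wpM2l ?(ltW c00)//.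
  rewrite natrB//; move: a2 b2; rewrite -(natr1 n1) -(natr1 n2) => a2 b2.
  have : 2 <= (v' - u') * m%:R by rewrite mulrC -ler_pdivrMr// subr_gt0.
  have -> : (v' - u') / 2 * m%:R = (v' * m%:R - u' * m%:R) / 2 by ring.
  by rewrite mulrBl; lra.
rewrite /tF -(big_mkord xpredT (bump m)) (@big_cat_nat _ _ _ n1.+1 0 (2 * m))//=; last first.
  by apply: leq_ltn_trans n12 _.
rewrite (@big_cat_nat _ _ _ n2.+1 n1.+1 (2 * m))//=.
have s1 : 0 <= \sum_(0 <= t < n1.+1) bump m t by apply: sumr_ge0 => t _; exact: bump_ge0.
have s2 : 0 <= \sum_(n2.+1 <= t < 2 * m) bump m t by apply: sumr_ge0 => t _; exact: bump_ge0.
by lra.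
Unshelve. all: by end_near. Qed.

Lemma tT_small e : 0 < e -> \forall m \near \oo, `|tT m| * Num.sqrt m%:R <= e * tF m.
Proof.
move=> e0; have [c c0 hc] := tF_lower; have ec : 0 < e * c by rewrite mulr_gt0.
near=> m; have m0 : (0 < m)%N by near: m; exact: nbhs_infty_gt.
have sm := sqrtn_gt0 m0.
have h1 : `|(Num.sqrt m%:R)^-1 * tT m| < e * c.
  by rewrite -normrN -sub0r; near: m; move/cvgrPdist_lt: tT_cvg; exact.
have h2 : c * m%:R <= tF m by near: m.
apply: (@le_trans _ _ (e * (c * m%:R))); last by rewrite ler_wpM2l// ltW.
rewrite -[X in c * X](@sqr_sqrtr _ m%:R)// mulrA expr2 mulrA ler_wpM2r ?(ltW sm)//.
move: h1; rewrite normrM ger0_norm ?invr_ge0 ?(ltW sm)// mulrC ltr_pdivrMr// => /ltW.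
by [].
Unshelve. all: by end_near. Qed.

End bump.

Lemma tF_gt0 u v : 0 < u -> u < v -> v <= 2 -> \forall m \near \oo, 0 < tF u v m.
Proof.
move=> u0 uv v2; have [c c0 hc] := tF_lower u0 uv v2; near=> m.
have m0 : (0 < m)%N by near: m; exact: nbhs_infty_gt.
apply: (@lt_le_trans _ _ (c * m%:R)); first by rewrite mulr_gt0// ltr0n.
by near: m.
Unshelve. all: by end_near. Qed.

Lemma tT_split u v m : \sum_(t < 2 * m) p t * bump u v m t =
  \sum_(t < 2 * m) tref t * bump u v m t + tT u v m.
Proof.
rewrite /tT -big_split /=; apply: eq_bigr => t _; rewrite /tdiff; ring.
Qed.

(** By monotonicity [p m] is at most the bump average of [p] over a window ending at [m] and at
    least the one over a window starting at [m]. These averages differ from those of [tref] by the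
    negligible [tT], and [tref] is nearly constant on a narrow window. *)
Theorem tauberian : p m * Num.sqrt m%:R @[m --> \oo] --> kap / G.
Proof.
pose a := kap / G; have a0 : 0 < a by rewrite divr_gt0.
apply/cvgrPdist_le => e e0.
pose et := Num.min (1 / 4) (e / (4 * a)).
have et0 : 0 < et by rewrite lt_min; apply/andP; split; [lra|rewrite divr_gt0// mulr_gt0].
have et4 : et <= 1 / 4 by rewrite ge_min lexx.
have eta : a * et <= e / 4.
  have -> : e / 4 = a * (e / (4 * a)) by field; rewrite gt_eqF.
  by rewrite ler_pM2l// ge_min lexx orbT.
(* Squares, so that [tref] at the outer ends of the windows is [tref m] divided by [1 - et] or by
   [1 + et]. *)
pose u := (1 - et) ^+ 2; pose v := (1 + et) ^+ 2.
have u0 : 0 < u by rewrite exprn_gt0//; lra.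
have u1 : u < 1 by rewrite /u expr2; nra.
have v1 : 1 < v by rewrite /v expr2; nra.
have v2 : v <= 2 by rewrite /v expr2; nra.
have e40 : 0 < e / 4 by lra.
have l12 : 1 <= 2 :> R by lra.
near=> m.
have m0 : (0 < m)%N by near: m; exact: nbhs_infty_gt.
have m0' : 0 < m%:R :> R by rewrite ltr0n.
have sm := sqrtn_gt0 m0; set s := Num.sqrt m%:R in sm *.
have F1 : 0 < tF u 1 m by near: m; exact: tF_gt0.
have F2 : 0 < tF 1 v m by near: m; exact: tF_gt0.
have T1 : `|tT u 1 m| * s <= e / 4 * tF u 1 m by rewrite /s; near: m; exact: tT_small.
have T2 : `|tT 1 v m| * s <= e / 4 * tF 1 v m by rewrite /s; near: m; exact: tT_small.
have up : p m * s <= a / (1 - et) + e / 4.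
  rewrite -(ler_pM2r F1).
  have h1 : p m * tF u 1 m <= \sum_(t < 2 * m) p t * bump u 1 m t.
    rewrite /tF mulr_sumr; apply: ler_sum => t _.
    have [tm|mt] := leqP t m; first by rewrite ler_wpM2r ?bump_ge0// p_noninc.
    by rewrite bump_gt0 ?mulr0// mul1r ler_nat ltnW.
  have h2 : \sum_(t < 2 * m) tref t * bump u 1 m t <= a / (1 - et) / s * tF u 1 m.
    rewrite /tF mulr_sumr; apply: ler_sum => t _.
    have [tu|ut] := leP t%:R (u * m%:R); first by rewrite bump_lt0// !mulr0.
    rewrite ler_wpM2r ?bump_ge0// /tref -/a -mulrA ler_wpM2l ?(ltW a0)//.
    rewrite -invfM lef_pV2 ?posrE.
    - have -> : (1 - et) * s = Num.sqrt (u * m%:R).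
        by rewrite sqrtrM ?(ltW u0)// /u sqrtr_sqr ger0_norm//; lra.
      by rewrite ler_wsqrtr// ltW.
    - by rewrite sqrtr_gt0; apply: lt_trans ut; rewrite mulr_gt0.
    - by rewrite mulr_gt0//; lra.
  rewrite tT_split in h1.
  have h3 : p m * tF u 1 m <= a / (1 - et) / s * tF u 1 m + `|tT u 1 m|.
    by apply: le_trans h1 _; apply: lerD => //; exact: ler_norm.
  have h4 : p m * tF u 1 m * s <= (a / (1 - et) / s * tF u 1 m + `|tT u 1 m|) * s.
    by rewrite ler_wpM2r ?(ltW sm).
  have e5 : (a / (1 - et) / s * tF u 1 m + `|tT u 1 m|) * s =
    a / (1 - et) * tF u 1 m + `|tT u 1 m| * s.
    have et1 : 1 - et != 0 by rewrite gt_eqF//; lra.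
    by field; rewrite (gt_eqF sm) et1.
  have -> : p m * s * tF u 1 m = p m * tF u 1 m * s by ring.
  apply: le_trans h4 _; rewrite e5 mulrDl; exact: lerD.
have lo : a / (1 + et) - e / 4 <= p m * s.
  rewrite -(ler_pM2r F2).
  have h1 : \sum_(t < 2 * m) p t * bump 1 v m t <= p m * tF 1 v m.
    rewrite /tF mulr_sumr; apply: ler_sum => t _.
    have [mt|tm] := leqP m t; first by rewrite ler_wpM2r ?bump_ge0// p_noninc.
    by rewrite bump_lt0 ?mulr0// mul1r ler_nat ltnW.
  have h2 : a / (1 + et) / s * tF 1 v m <= \sum_(t < 2 * m) tref t * bump 1 v m t.
    rewrite /tF mulr_sumr; apply: ler_sum => t _.
    have [tu|ut] := leP (v * m%:R) t%:R; first by rewrite bump_gt0// !mulr0.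
    have [t1|t1] := leP t%:R (1 * m%:R : R); first by rewrite bump_lt0// !mulr0.
    rewrite ler_wpM2r ?bump_ge0// /tref -/a -mulrA ler_wpM2l ?(ltW a0)//.
    rewrite -invfM lef_pV2 ?posrE.
    - have -> : (1 + et) * s = Num.sqrt (v * m%:R).
        by rewrite sqrtrM ?sqr_ge0// /v sqrtr_sqr ger0_norm//; lra.
      by rewrite ler_wsqrtr// ltW.
    - by rewrite mulr_gt0//; lra.
    - by rewrite sqrtr_gt0; apply: lt_trans t1; rewrite mul1r.
  rewrite tT_split in h1.
  have h3 : a / (1 + et) / s * tF 1 v m - `|tT 1 v m| <= p m * tF 1 v m.
    apply: le_trans h1; apply: lerD => //.
    by rewrite lerNl -normrN ler_norm.
  have h4 : (a / (1 + et) / s * tF 1 v m - `|tT 1 v m|) * s <= p m * tF 1 v m * s.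
    by rewrite ler_wpM2r ?(ltW sm).
  have e5 : (a / (1 + et) / s * tF 1 v m - `|tT 1 v m|) * s =
    a / (1 + et) * tF 1 v m - `|tT 1 v m| * s.
    have et1 : 1 + et != 0 by rewrite gt_eqF//; lra.
    by field; rewrite (gt_eqF sm) et1.
  have -> : p m * s * tF 1 v m = p m * tF 1 v m * s by ring.
  apply: le_trans h4; rewrite e5 mulrBl; exact: lerB.
have a1 : a / (1 - et) <= a + e / 2.
  rewrite ler_pdivrMr; last by lra.
  by rewrite mulrDl !mulrDr mulrN mulr1; nra.
have a2 : a - e / 2 <= a / (1 + et).
  rewrite ler_pdivlMr; last by lra.
  by nra.
by rewrite -/a ler_norml; apply/andP; split; lra.
Unshelve. all: by end_near. Qed.

End tauberian.

(** * Critical asymptotics *)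

Lemma cvgr_dist_le {R : realType} {T : Type} {F : set_system T} {FF : Filter F}
  (f g : T -> R) (l : R) : (\forall x \near F, `|f x - l| <= g x) ->
  g x @[x --> F] --> 0 -> f x @[x --> F] --> l.
Proof.
move=> fg g0; apply: (@squeeze_cvgr _ _ _ _ (fun x => l - g x) (fun x => l + g x)).
- by apply: filterS fg => x; rewrite ler_distl.
- by rewrite -[X in _ --> X](subr0 l); apply: cvgB => //; exact: cvg_cst.
- by rewrite -[X in _ --> X](addr0 l); apply: cvgD => //; exact: cvg_cst.
Qed.

Section critical_limits.
Context {R : realType} (d : nat).
Hypothesis hd : (2 <= d)%N.
Local Notation mu := (@lebesgue_measure R).
Variables (hs lam : R) (chi : R -> R).
Hypothesis lam_gt0 : 0 < lam.
Hypothesis chi_L2 : L2nu d chi.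
Hypothesis chi_ge0 : forall x, 0 <= chi x.
Hypothesis chi_norm : nu_int d (fun x => chi x ^+ 2) = 1.
Hypothesis chi_eig : forall a, Lop d hs chi a = lam * chi a.
Hypothesis lam1 : lam = 1.
Variables (w : R -> R -> R).
Hypothesis w_spec : forall z, 0 <= z < 1 -> is_w d hs hs z (w z).
Variables (a : R).
Hypothesis ha : hs <= a.
Local Notation J := (J d hs chi).
Local Notation c z := (J (w z)).
Local Notation y z := (Lop d hs (w z) a / d%:R).

Let d0 : 0 < d%:R :> R := d_gt0 hd.

Lemma near_one_left (z0 : R) : z0 < 1 -> \forall z \near (1 : R)^'-, z0 <= z < 1.
Proof.
move=> z01; near=> z; apply/andP; split; last by near: z; exact: nbhs_left_lt.
by apply: ltW; near: z; exact: nbhs_left_gt.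
Unshelve. all: by end_near. Qed.

Lemma cvg_at_left_sub1 : 1 - z @[z --> (1 : R)^'-] --> (0 : R).
Proof.
rewrite -(@subrr R 1); apply: cvgB; first exact: cvg_cst.
exact: cvg_at_left_filter.
Qed.

Lemma crit_near : exists2 K : R, 0 < K & \forall z \near (1 : R)^'-,
  [/\ 0 < z < 1, 0 < c z <= K * Num.sqrt (1 - z), 1 - z <= K * c z ^+ 2 &
   [/\ `|w z a - c z * chi a| <= K * c z ^+ 2, 0 <= y z <= 1, y z <= K * c z,
      w z a = (1 - z) + z * (d%:R * y z - rem2 d (y z)) &
   `|(1 - z) * J (cst 1) - (d%:R - 1) / (2 * d%:R) * J (fun x => chi x ^+ 2) * c z ^+ 2|
      <= K * c z ^+ 3]].
Proof.
have [K1 [z1 [K10 /andP[z1h z11] H1]]] :=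
  crit_asymp1 hd lam_gt0 chi_L2 chi_ge0 chi_norm chi_eig lam1.
have [K2 [z2 [K20 /andP[z2h z21] H2]]] :=
  crit_asymp2 hd lam_gt0 chi_L2 chi_ge0 chi_norm chi_eig lam1.
have [K3 K30 H3] := Lw_bound hd lam_gt0 chi_L2 chi_ge0 chi_norm chi_eig (lexx hs).
pose K := K1 + K1 * vexp 2 a + K2 + K3 * vexp 1 a.
have v1 : 0 < vexp 1 a :> R by exact: expR_gt0.
have v2 : 0 < vexp 2 a :> R by exact: expR_gt0.
have p1 : 0 < K1 * vexp 2 a by rewrite mulr_gt0.
have p2 : 0 < K3 * vexp 1 a by rewrite mulr_gt0.
have KK1 : K1 <= K by rewrite /K; lra.
have KK2 : K1 * vexp 2 a <= K by rewrite /K; lra.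
have KK3 : K2 <= K by rewrite /K; lra.
have KK4 : K3 * vexp 1 a <= K by rewrite /K; lra.
exists K; first by apply: lt_le_trans KK1.
near=> z.
have /andP[zz1 zlt] : z1 <= z < 1 by near: z; exact: near_one_left.
have /andP[zz2 _] : z2 <= z < 1 by near: z; exact: near_one_left.
have zgt : 0 < z by lra.
have zz : 0 <= z < 1 by rewrite zlt (ltW zgt).
have Hw := w_spec zz.
have [c0 cK zK wK] := H1 z (w z) ltac:(by rewrite zz1 zlt) Hw.
have cc0 : 0 <= c z ^+ 2 by rewrite exprn_ge0 ?(ltW c0).
have cc3 : 0 <= c z ^+ 3 by rewrite exprn_ge0 ?(ltW c0).
have yy := y01 hd lam_gt0 chi_L2 chi_ge0 chi_norm chi_eig Hw a.
split.
- by rewrite zgt.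
- by rewrite c0 /=; apply: le_trans cK _; rewrite ler_wpM2r ?sqrtr_ge0.
- by apply: le_trans zK _; rewrite ler_wpM2r.
split.
- apply: le_trans (wK a ha) _; rewrite mulrAC; exact: ler_wpM2r.
- exact: yy.
- have h : Lop d hs (w z) a <= K3 * c z * vexp 1 a by exact: H3 zz Hw a ha.
  have L0 : 0 <= Lop d hs (w z) a.
    by case/andP: yy => + _; rewrite pmulr_lge0 ?invr_gt0.
  apply: (@le_trans _ _ (Lop d hs (w z) a)).
    by rewrite ler_pdivrMr// ler_peMr//; have := @d_ge2 R d hd; lra.
  by apply: le_trans h _; rewrite mulrAC; apply: ler_wpM2r => //; exact: ltW.
- have [_ _ _ /(_ a ha) we] := Hw; rewrite {1}we /rem2.
  set P := (1 - _) ^+ d; ring.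
- apply: le_trans (H2 z (w z) _ Hw) _; first by rewrite zz2 zlt.
  exact: ler_wpM2r.
Unshelve. all: by end_near. Qed.

Lemma J_cst1_gt0 : 0 < J (cst 1).
Proof.
apply: (J_gt0 hd lam_gt0 chi_L2 chi_ge0 chi_norm chi_eig) => //.
exact: inD_cst.
Qed.

Lemma J_chi2_gt0 : 0 < J (fun x => chi x ^+ 2).
Proof.
apply: (J_gt0 hd lam_gt0 chi_L2 chi_ge0 chi_norm chi_eig).
  exact: (inD_chi2 hd lam_gt0 chi_L2 chi_ge0 chi_norm chi_eig lam1).
move=> x hx; apply: exprn_gt0.
exact: (chi_gt0 hd lam_gt0 chi_L2 chi_ge0 chi_norm chi_eig hx).
Qed.

Lemma c_cvg0 : c z @[z --> (1 : R)^'-] --> 0.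
Proof.
have [K K0 H] := crit_near.
apply: (@cvgr_dist_le _ _ _ _ _ (fun z => K * Num.sqrt (1 - z))).
  by apply: filterS H => z [_ /andP[c0 cK] _ _]; rewrite subr0 ger0_norm// ltW.
rewrite -(@mulr0 R K) -(@sqrtr0 R); apply: cvgM; first exact: cvg_cst.
exact: (@continuous_cvg _ _ _ _ _ _ (@Num.sqrt R) _ (@sqrt_continuous R 0) cvg_at_left_sub1).
Qed.

(** The limit of [c_z^2 / (1 - z)]. *)
Definition kap2 := (2 * d%:R / (d%:R - 1)) * (J (cst 1) / J (fun x => chi x ^+ 2)).

Lemma kap2_gt0 : 0 < kap2.
Proof.
have J1 := J_cst1_gt0; have J2 := J_chi2_gt0; have d2 := @d_ge2 R d hd.
by rewrite /kap2; apply: mulr_gt0; apply: divr_gt0 => //; lra.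
Qed.

Lemma c2_cvg : c z / Num.sqrt (1 - z) @[z --> (1 : R)^'-] --> Num.sqrt kap2.
Proof.
have J1 := J_cst1_gt0; have J2 := J_chi2_gt0; have d2 := @d_ge2 R d hd.
have [K K0 H] := crit_near.
have k0 := kap2_gt0.
have lim : (1 - z) / c z ^+ 2 @[z --> (1 : R)^'-] --> kap2^-1.
  apply: (@cvgr_dist_le _ _ _ _ _ (fun z => K / J (cst 1) * c z)).
    apply: filterS H => z [_ /andP[c0 _] _ [_ _ _ _ h]].
    have c2 : 0 < c z ^+ 2 by rewrite exprn_gt0.
    have -> : (1 - z) / c z ^+ 2 - kap2^-1 = ((1 - z) * J (cst 1) -
       (d%:R - 1) / (2 * d%:R) * J (fun x => chi x ^+ 2) * c z ^+ 2) / (J (cst 1) * c z ^+ 2).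
      have dd : d%:R - 1 != 0 :> R by rewrite gt_eqF//; lra.
      by rewrite /kap2; field; rewrite dd !gt_eqF.
    have j0 : 0 < J (cst 1) * c z ^+ 2 by rewrite mulr_gt0.
    rewrite normrM normfV (gtr0_norm j0) ler_pdivrMr//.
    apply: le_trans h _; rewrite le_eqVlt; apply/orP; left; apply/eqP.
    by field; rewrite gt_eqF.
  rewrite -(@mulr0 R (K / J (cst 1))); apply: cvgM; [exact: cvg_cst|exact: c_cvg0].
have lim2 : ((1 - z) / c z ^+ 2)^-1 @[z --> (1 : R)^'-] --> kap2.
  rewrite -[X in _ --> X]invrK; apply: cvgV => //; by rewrite invr_neq0// gt_eqF.
have lim3 : Num.sqrt ((1 - z) / c z ^+ 2)^-1 @[z --> (1 : R)^'-] --> Num.sqrt kap2.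
  exact: (@continuous_cvg _ _ _ _ _ _ (@Num.sqrt R) _ (@sqrt_continuous R kap2) lim2).
apply: cvg_trans lim3; apply: near_eq_cvg.
apply: filterS H => z [/andP[_ z1] /andP[c0 _] _ _].
rewrite /= invfM invrK mulrC sqrtrM ?exprn_ge0 ?(ltW c0)// sqrtr_sqr gtr0_norm//.
by rewrite sqrtrV// subr_ge0 ltW.
Qed.

(** [y] is recovered from the equation at [a]: [d y] is [(w - (1 - z)) / z] plus the remainder, and
    the corrections are of order [c^2]. The root needs [y] and not [w] because its number of
    children may differ from [d]. *)
Lemma y_cvg : y z / c z @[z --> (1 : R)^'-] --> chi a / d%:R.
Proof.
have [K K0 H] := crit_near; have [C C0 hC] := @rem2_taylor R d.
pose B := d%:R * (d%:R - 1) / 2 * K ^+ 2 : R.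
have dd0 : 0 <= d%:R * (d%:R - 1) / 2 :> R.
  by rewrite divr_ge0// mulr_ge0// subr_ge0 ler1n ltnW.
have zc : (1 - z) / c z @[z --> (1 : R)^'-] --> 0.
  apply: (@cvgr_dist_le _ _ _ _ _ (fun z => K * c z)).
    apply: filterS H => z [/andP[_ z1] /andP[c0 _] h _].
    rewrite subr0 ger0_norm; last by apply: divr_ge0; [lra|exact: ltW].
    by rewrite ler_pdivrMr// -mulrA -expr2.
  by rewrite -(@mulr0 R K); apply: cvgM; [exact: cvg_cst|exact: c_cvg0].
have wc : w z a / c z @[z --> (1 : R)^'-] --> chi a.
  apply: (@cvgr_dist_le _ _ _ _ _ (fun z => K * c z)).
    apply: filterS H => z [_ /andP[c0 _] _ [h _ _ _ _]].
    have -> : w z a / c z - chi a = (w z a - c z * chi a) / c z by field; rewrite gt_eqF.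
    by rewrite normrM normfV (gtr0_norm c0) ler_pdivrMr// -mulrA -expr2.
  by rewrite -(@mulr0 R K); apply: cvgM; [exact: cvg_cst|exact: c_cvg0].
have rc : rem2 d (y z) / c z @[z --> (1 : R)^'-] --> 0.
  apply: (@cvgr_dist_le _ _ _ _ _ (fun z => B * c z)).
    apply: filterS H => z [_ /andP[c0 _] _ [_ yy yK _ _]].
    have r0 : 0 <= rem2 d (y z) by apply: le_trans (rem2_ge_sqr hd yy); exact: sqr_ge0.
    rewrite subr0 ger0_norm; last by apply: divr_ge0 => //; exact: ltW.
    rewrite ler_pdivrMr// -mulrA -expr2; case/andP: (hC _ yy) => _ h; apply: le_trans h _.
    have y2 : y z ^+ 2 <= K ^+ 2 * c z ^+ 2.
      rewrite -exprMn lerXn2r ?nnegrE//; first by case/andP: yy.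
      by apply: mulr_ge0; exact: ltW.
    by rewrite /B -[leRHS]mulrA; apply: ler_wpM2l.
  by rewrite -(@mulr0 R B); apply: cvgM; [exact: cvg_cst|exact: c_cvg0].
have zl : z^-1 @[z --> (1 : R)^'-] --> (1 : R).
  rewrite -[X in _ --> X]invr1; apply: cvgV; first exact: oner_neq0.
  exact: cvg_at_left_filter.
have L : ((w z a / c z - (1 - z) / c z) * z^-1 + rem2 d (y z) / c z) / d%:R
    @[z --> (1 : R)^'-] --> ((chi a - 0) * 1 + 0) / d%:R.
  apply: cvgM; last exact: cvg_cst.
  by apply: cvgD => //; apply: cvgM => //; exact: cvgB.
rewrite subr0 mulr1 addr0 in L.
apply: cvg_trans L; apply: near_eq_cvg.
apply: filterS H => z [/andP[zp _] /andP[c0 _] _ [_ _ _ we _]].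
rewrite {1}we; set r := rem2 d _.
by field; rewrite !gt_eqF.
Qed.

Lemma crit_limit k : (0 < k)%N ->
  (1 - z * (1 - y z) ^+ k) / (1 - z) * Num.sqrt (1 - z) @[z --> (1 : R)^'-] -->
  Num.sqrt kap2 * (k%:R / d%:R * chi a).
Proof.
move=> k0; have [K K0 H] := crit_near; have [C C0 hC] := @rem2_taylor R k.
pose B := k%:R * (k%:R - 1) / 2 * K ^+ 2 + C * K ^+ 2 : R.
have zc : (1 - z) / c z @[z --> (1 : R)^'-] --> 0.
  apply: (@cvgr_dist_le _ _ _ _ _ (fun z => K * c z)).
    apply: filterS H => z [/andP[_ z1] /andP[c0 _] h _].
    rewrite subr0 ger0_norm; last by apply: divr_ge0; [lra|exact: ltW].
    by rewrite ler_pdivrMr// -mulrA -expr2.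
  by rewrite -(@mulr0 R K); apply: cvgM; [exact: cvg_cst|exact: c_cvg0].
have k1 : 0 <= k%:R * (k%:R - 1) / 2 :> R.
  by rewrite divr_ge0// mulr_ge0// subr_ge0 ler1n.
have rc : rem2 k (y z) / c z @[z --> (1 : R)^'-] --> 0.
  apply: (@cvgr_dist_le _ _ _ _ _ (fun z => B * c z)).
    apply: filterS H => z [_ /andP[c0 _] _ [_ yy yK _ _]].
    rewrite subr0 normrM normfV (gtr0_norm c0) ler_pdivrMr// -mulrA -expr2.
    case/andP: (hC _ yy) => h1 h2; have /andP[y0 y1] := yy.
    have y2 : y z ^+ 2 <= K ^+ 2 * c z ^+ 2.
      by rewrite -exprMn lerXn2r ?nnegrE//; apply: mulr_ge0; exact: ltW.
    have y3 : y z ^+ 3 <= y z ^+ 2.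
      by rewrite exprS -[leRHS]mul1r ler_wpM2r ?sqr_ge0.
    have y30 : 0 <= y z ^+ 3 by rewrite exprn_ge0.
    have s1 : k%:R * (k%:R - 1) / 2 * y z ^+ 2 <= k%:R * (k%:R - 1) / 2 * (K ^+ 2 * c z ^+ 2).
      exact: ler_wpM2l.
    have s2 : C * y z ^+ 3 <= C * (K ^+ 2 * c z ^+ 2).
      by apply: ler_wpM2l => //; exact: le_trans y2.
    have s3 : 0 <= C * y z ^+ 3 by rewrite mulr_ge0.
    have s4 : 0 <= k%:R * (k%:R - 1) / 2 * y z ^+ 2 by rewrite mulr_ge0 ?sqr_ge0.
    have -> : B * c z ^+ 2 = k%:R * (k%:R - 1) / 2 * (K ^+ 2 * c z ^+ 2) + C * (K ^+ 2 * c z ^+ 2).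
      by rewrite /B; ring.
    by rewrite ler_norml; apply/andP; split; lra.
  by rewrite -(@mulr0 R B); apply: cvgM; [exact: cvg_cst|exact: c_cvg0].
have zl : z @[z --> (1 : R)^'-] --> (1 : R) by exact: cvg_at_left_filter.
have L : (c z / Num.sqrt (1 - z)) * ((1 - z) / c z + z * (k%:R * (y z / c z) - rem2 k (y z) / c z))
    @[z --> (1 : R)^'-] --> Num.sqrt kap2 * (0 + 1 * (k%:R * (chi a / d%:R) - 0)).
  apply: cvgM; first exact: c2_cvg.
  apply: cvgD => //; apply: cvgM => //; apply: cvgB => //.
  by apply: cvgM; [exact: cvg_cst|exact: y_cvg].
rewrite subr0 mul1r add0r in L.
have -> : k%:R / d%:R * chi a = k%:R * (chi a / d%:R) by ring.
apply: cvg_trans L; apply: near_eq_cvg.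
apply: filterS H => z [/andP[_ z1] /andP[c0 _] _ _].
have z10 : 0 < 1 - z by rewrite subr_gt0.
have s0 : 0 < Num.sqrt (1 - z) by rewrite sqrtr_gt0.
have -> : 1 - z * (1 - y z) ^+ k = (1 - z) + z * (k%:R * y z - rem2 k (y z)).
  by rewrite /rem2; set P := (1 - _) ^+ k; ring.
set r := rem2 k _; set q := y z.
rewrite -[in X in _ = _ / X * _](sqr_sqrtr (ltW z10)).
by field; rewrite !gt_eqF.
Qed.

End critical_limits.

Lemma trunc_cvgy (R : realType) : Num.trunc (t : R) @[t --> +oo] --> \oo.
Proof.
apply/cvgnyPge => A; near=> t.
have At : A%:R <= t by near: t; apply: nbhs_pinfty_ge; exact: num_real.
have /andP[_ t2] := trunc_itv (le_trans (ler0n R A) At).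
by rewrite -ltnS -(ltr_nat R); exact: le_lt_trans t2.
Unshelve. all: by end_near. Qed.

Lemma cvg_sqrt_trunc (R : realType) (p : nat -> R) (k : R) :
  p m * Num.sqrt m%:R @[m --> \oo] --> k ->
  p (Num.trunc (t : R)) * Num.sqrt t @[t --> +oo] --> k.
Proof.
move=> pk; have tr := @trunc_cvgy R.
have pt : p (Num.trunc (t : R)) * Num.sqrt (Num.trunc t)%:R @[t --> +oo] --> k.
  exact: (@cvg_comp _ _ _ (@Num.trunc R) (fun m => p m * Num.sqrt m%:R) _ _ _ tr pk).
have it : (Num.trunc (t : R))%:R^-1 @[t --> +oo] --> (0 : R).
  have i0 : (n%:R^-1 : R) @[n --> \oo] --> (0 : R) by exact: cvg_invn.
  exact: (@cvg_comp _ _ _ (@Num.trunc R) (fun n => n%:R^-1) _ _ _ tr i0).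
have qt : (t : R) / (Num.trunc t)%:R @[t --> +oo] --> (1 : R).
  apply: cvgr_dist_le it; near=> t.
  have t1 : 1 <= t by near: t; apply: nbhs_pinfty_ge; exact: num_real.
  have t0 : 0 <= t by apply: le_trans t1.
  have /andP[n1 n2] := trunc_itv t0.
  have n0 : 0 < (Num.trunc t)%:R :> R by rewrite ltr0n trunc_gt0.
  have -> : t / (Num.trunc t)%:R - 1 = (t - (Num.trunc t)%:R) / (Num.trunc t)%:R.
    by field; rewrite gt_eqF.
  rewrite ger0_norm; last by rewrite divr_ge0 ?subr_ge0// ltW.
  rewrite ler_pdivrMr// mulVf ?gt_eqF//; move: n2; rewrite -natr1; lra.
have st : Num.sqrt ((t : R) / (Num.trunc t)%:R) @[t --> +oo] --> Num.sqrt (1 : R).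
  exact: (@continuous_cvg _ _ _ _ _ _ (@Num.sqrt R) _ (@sqrt_continuous R 1) qt).
rewrite sqrtr1 in st.
have L : p (Num.trunc (t : R)) * Num.sqrt (Num.trunc t)%:R * Num.sqrt (t / (Num.trunc t)%:R)
    @[t --> +oo] --> k * 1 by exact: cvgM.
rewrite mulr1 in L; apply: cvg_trans L; apply: near_eq_cvg; near=> t.
have t1 : 1 <= t by near: t; apply: nbhs_pinfty_ge; exact: num_real.
have t0 : 0 <= t by apply: le_trans t1.
have n0 : 0 < (Num.trunc t)%:R :> R by rewrite ltr0n trunc_gt0.
have -> : Num.sqrt t = Num.sqrt (Num.trunc t)%:R * Num.sqrt (t / (Num.trunc t)%:R).
  by rewrite -sqrtrM ?(ltW n0)// mulrCA divff ?mulr1// gt_eqF.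
by rewrite mulrA.
Unshelve. all: by end_near. Qed.

Lemma asymp_powR (R : realType) (Q : R -> \bar R) (p : nat -> R) (C : R) : 0 < C ->
  (forall t, 0 <= t -> Q t = (p (Num.trunc t))%:E) ->
  p m * Num.sqrt m%:R @[m --> \oo] --> C ->
  exists eps : R -> R, eps t @[t --> +oo] --> 0 /\
    \forall t \near +oo, Q t = (C * t `^ (- (1 / 2)) * (1 + eps t))%:E.
Proof.
move=> C0 Qp pC; exists (fun t => p (Num.trunc t) * Num.sqrt t / C - 1); split.
  rewrite -(@subrr R 1); apply: cvgB; last exact: cvg_cst.
  have -> : 1 = C / C :> R by rewrite divff// gt_eqF.
  by apply: cvgM; [exact: cvg_sqrt_trunc|exact: cvg_cst].
near=> t; have t0 : 0 < t by near: t; apply: nbhs_pinfty_gt; exact: num_real.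
rewrite (Qp _ (ltW t0)) powRN mul1r powR12_sqrt ?(ltW t0)//; congr EFin.
have s0 : 0 < Num.sqrt t by rewrite sqrtr_gt0.
by rewrite addrC subrK; field; rewrite !gt_eqF.
Unshelve. all: by end_near. Qed.

Section critical_tail.
Context {R : realType} (d : nat) {dT : measure_display} {Omega : measurableType dT}.
Hypothesis hd : (2 <= d)%N.
Variables (P : probability Omega R) (W : seq nat -> Omega -> R).
Hypothesis W_meas : forall x, measurable_fun setT (W x).
Hypothesis W_Y : forall x, vtx d x -> x != [::] -> forall B, measurable B ->
  P (W x @^-1` B) = normal_prob 0 (sigma_Y d) B.
Hypothesis W_indep : mutually_independent P (vtx d) W.

Lemma is_w_wlim (hs h z : R) : 0 <= z <= 1 -> hs <= h -> is_w d hs h z (wlim d h z).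
Proof.
move=> z01 hh; split.
- exact: measurable_wlim.
- exact: wlim_in01.
- by move=> x; exact: wlim_lt.
move=> x hx; suff -> : Lop d hs (wlim d h z) x = Lop d h (wlim d h z) x by exact: wlim_eq.
rewrite /Lop hx (le_trans hh hx) /Rintegral; congr (_ * fine _).
rewrite integral_mkcond [RHS]integral_mkcond; apply: eq_integral => u _; rewrite /patch.
have [hu|uh] := leP h u.
  by rewrite !mem_set//= in_itv /= andbT ?(le_trans hh).
rewrite [in RHS]memNset; last by rewrite /= in_itv /= andbT leNgt uh.
by case: ifPn => // _; rewrite wlim_lt ?mul0r.
Qed.

Lemma prob_vcard_gt (h : R) (root : Omega -> R) rc (mroot : measurable_fun setT root)
    (rc_uniq : uniq rc) t : 0 <= t ->
  P [set om | (t%:E < vcard (R:=R) (tvertices rc d (path_above d h (root om) (W ^~ om))))%E] =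
  (tail P (vcount d W h root rc) (Num.trunc t))%:E.
Proof.
move=> t0; rewrite /tail fineK; last first.
  by apply: fin_num_measure; apply: mtail => n k; exact: measurable_vcount.
congr (P _); apply/seteqP; split => om /=.
  by move=> /(vcard_tail d rc_uniq _ (trunc_itv t0)) [m hm]; exists m.
by move=> [m _ hm]; apply/(vcard_tail d rc_uniq _ (trunc_itv t0)); exists m.
Qed.

Variables (hs lam : R) (chi : R -> R).
Hypothesis lam_gt0 : 0 < lam.
Hypothesis chi_L2 : L2nu d chi.
Hypothesis chi_ge0 : forall x, 0 <= chi x.
Hypothesis chi_norm : nu_int d (fun x => chi x ^+ 2) = 1.
Hypothesis chi_eig : forall a, Lop d hs chi a = lam * chi a.
Hypothesis lam1 : lam = 1.
Variable a : R.
Hypothesis ha : hs <= a.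
Variable rc : seq nat.
Hypothesis rc_uniq : uniq rc.
Hypothesis rc_lt : all (fun i => i < d.+1)%N rc.
Hypothesis rc_gt0 : (0 < size rc)%N.

Lemma C1E : C1 d chi = Num.sqrt (kap2 d hs chi) / Gamma (1 / 2).
Proof.
rewrite /C1 mulrC /kap2 -!(nu_int_J lam_gt0 chi_eig); congr (Num.sqrt (_ * (_ / _)) / _).
  by congr nu_int; apply/funext => x; rewrite mul1r.
by congr nu_int; apply/funext => x; rewrite -exprSr.
Qed.

Lemma C1_gt0 : 0 < C1 d chi.
Proof.
rewrite C1E divr_gt0 ?Gamma_gt0// sqrtr_gt0.
exact: (kap2_gt0 hd lam_gt0 chi_L2 chi_ge0 chi_norm chi_eig lam1).
Qed.

Lemma chi_a_gt0 : 0 < chi a.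
Proof. exact: (chi_gt0 hd lam_gt0 chi_L2 chi_ge0 chi_norm chi_eig ha). Qed.

Lemma critical_tail : tail P (vcount d W hs (fun=> a) rc) m * Num.sqrt m%:R @[m --> \oo] -->
  C1 d chi * ((size rc)%:R / d%:R) * chi a.
Proof.
pose S z : R := (1 - z * (1 - Lop d hs (wlim d hs z) a / d%:R) ^+ size rc) / (1 - z).
pose kap := Num.sqrt (kap2 d hs chi) * ((size rc)%:R / d%:R * chi a).
have -> : C1 d chi * ((size rc)%:R / d%:R) * chi a = kap / Gamma (1 / 2).
  by rewrite C1E /kap; ring.
have k0 : 0 < kap.
  rewrite mulr_gt0// ?sqrtr_gt0; last first.
    by rewrite mulr_gt0 ?chi_a_gt0// divr_gt0 ?ltr0n// ltnW.
  exact: (kap2_gt0 hd lam_gt0 chi_L2 chi_ge0 chi_norm chi_eig lam1).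
have mN := measurable_vcount d W_meas hs (measurable_cst a : measurable_fun [set: Omega] _) rc.
apply: (@tauberian R _ S) => //.
- by move=> s t st; exact: tail_noninc.
- by move=> t; exact: tail_ge0.
- move=> z z01.
  have mr' (k : seq nat) : k != [::] -> measurable_fun setT
      ((fun=> a) : g_sigma_algebraType (cylinders (vtx d) W k) -> R).
    by move=> _; exact: measurable_cst.
  have -> : S z = (1 - Rintegral P setT (fun _ : Omega => gfun d hs z (size rc) a)) / (1 - z).
    have PT : fine (P setT) = 1 by rewrite probability_setT.
    by rewrite Rintegral_cst// (_ : fine _ = 1)// mulr1 /gfun ha.
  exact: (cluster_tail_series hd W_meas W_Y W_indep
    (measurable_cst a : measurable_fun [set: Omega] _) mr' rc_uniq rc_lt z01).
- apply: (crit_limit hd lam_gt0 chi_L2 chi_ge0 chi_norm chi_eig lam1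
    (w := fun z => wlim d hs z)) => // z /andP[z0 z1].
  by apply: is_w_wlim => //; rewrite z0 ltW.
Qed.

End critical_tail.

(** * The critical eigenvalue *)

Section positivity.
Context {R : realType} (d : nat).
Hypothesis hd : (2 <= d)%N.
Local Notation mu := (@lebesgue_measure R).
Local Notation rY := (@rho_Y R d).
Local Notation rN := (@rho_nu R d).

Let d0 : 0 < d%:R :> R := d_gt0 hd.
Let m1 : measurable_fun setT (cst 1 : R -> R). Proof. exact: measurable_cst. Qed.
Let i1 (x : R) : 0 <= (cst 1 : R -> R) x <= 1. Proof. by rewrite /= ler01 lexx. Qed.

Lemma integrable_rho_nu : mu.-integrable setT (fun x => (1 * rN x)%:E).
Proof.
rewrite (_ : (fun x => _) = (fun x => (vexp 0 x * rN x)%:E)); last first.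
  by apply/funext => x; rewrite /vexp mul0r expR0.
exact: integrable_vexp_rho_nu.
Qed.

Lemma integral_rho_nu : (\int[mu]_x (1 * rN x)%:E = 1)%E.
Proof.
transitivity (\int[mu]_x (vexp 0 x * rN x)%:E)%E.
  by apply: eq_integral => x _; rewrite /vexp mul0r expR0.
by rewrite integral_vexp_rho_nu// expr0n /= !mul0r expR0.
Qed.

Lemma Lop1_gt0 (h a : R) : h <= a -> 0 < Lop d h (cst 1) a.
Proof.
move=> ha; rewrite -lte_fin Lop_EFin// mule_gt0 ?lte_fin//.
apply: (@lt_le_trans _ _ (\int[mu]_(x in `[h, (h + 1)%R]) (cst 1 x * rY (x - a / d%:R))%:E)%E).
  apply: integral_itv_gt0; first by lra.
    by apply: measurable_funM => //; exact: measurable_rho_Y_shift.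
  by move=> x _; rewrite /= mul1r rho_Y_gt0.
apply: ge0_subset_integral => //.
- by apply/measurable_funTS/measurable_EFinP/measurable_funM => //; exact: measurable_rho_Y_shift.
- by move=> x _; rewrite lee_fin /= mul1r rho_Y_ge0.
- by move=> x /=; rewrite !in_itv /= andbT => /andP[].
Qed.

(** The constant 1 is a unit vector of [L^2] of [nu], and its image is positive on [h, oo). *)
Lemma lambda_gt0 (h lam : R) : lambda d h = lam%:E -> 0 < lam.
Proof.
move=> lE; rewrite -lte_fin -lE.
have mL : measurable_fun setT (fun a : R => Lop d h (cst 1) a ^+ 2 * rN a).
  apply: measurable_funM; last exact: measurable_rho_nu.
  by apply: measurable_funX; exact: measurable_Lop.
have Lb (a : R) : 0 <= Lop d h (cst 1) a ^+ 2 * rN a <= d%:R ^+ 2 * (1 * rN a).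
  have /andP[l0 l1] := Lop_bounds hd h m1 i1 a.
  rewrite mulr_ge0 ?exprn_ge0 ?rho_nu_ge0//= mul1r ler_wpM2r ?rho_nu_ge0//.
  by rewrite lerXn2r ?nnegrE ?(ltW d0).
have iL : mu.-integrable setT (fun a => (Lop d h (cst 1) a ^+ 2 * rN a)%:E).
  apply: (@le_integrableR _ _ _ _ (fun a => d%:R ^+ 2 * (1 * rN a))) => //.
    by move=> a _; case/andP: (Lb a) => l0 l1; rewrite ger0_norm.
  by apply: integrableZR => //; exact: integrable_rho_nu.
apply: (@lt_le_trans _ _ (Num.sqrt (nu_int d (fun a => Lop d h (cst 1) a ^+ 2)))%:E).
  rewrite lte_fin sqrtr_gt0 -lte_fin /nu_int /Rintegral fineK; last exact: integrable_fin_num iL.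
  apply: (@lt_le_trans _ _ (\int[mu]_(x in `[h, (h + 1)%R]) (Lop d h (cst 1) x ^+ 2 * rN x)%:E)%E).
    apply: integral_itv_gt0 => //; first by lra.
    move=> x; rewrite in_itv /= => /andP[hx _].
    by rewrite mulr_gt0 ?rho_nu_gt0// exprn_gt0// Lop1_gt0.
  apply: ge0_subset_integral => //.
    exact/measurable_EFinP.
  by move=> x _; rewrite lee_fin; case/andP: (Lb x).
apply: ereal_sup_ubound; exists (cst 1) => //; split.
  split => //; rewrite (_ : (fun x => _) = (fun x => (1 * rN x)%:E)); last first.
    by apply/funext => x; rewrite /= expr1n.
  exact: integrable_rho_nu.
rewrite /nu_int /Rintegral (_ : \int[mu]_x _ = 1)%E//.
by rewrite -integral_rho_nu; apply: eq_integral => x _; rewrite /= expr1n.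
Qed.

End positivity.

(** * Percolation probability and power series *)

Section percolation.
Context {R : realType} (d : nat) {dT : measure_display} {Omega : measurableType dT}.
Hypothesis hd : (2 <= d)%N.
Variables (P : probability Omega R) (W : seq nat -> Omega -> R).
Hypothesis W_meas : forall x, measurable_fun setT (W x).
Hypothesis W_root : forall B, measurable B ->
  P (W [::] @^-1` B) = normal_prob 0 (sigma_nu d) B.
Hypothesis W_Y : forall x, vtx d x -> x != [::] -> forall B, measurable B ->
  P (W x @^-1` B) = normal_prob 0 (sigma_Y d) B.
Hypothesis W_indep : mutually_independent P (vtx d) W.
Local Notation mu := (@lebesgue_measure R).
Local Notation rN := (@rho_nu R d).

Let d0 : 0 < d%:R :> R := d_gt0 hd.

Lemma integral_root (f : R -> R) : measurable_fun setT f -> in01 f ->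
  (\int[P]_w (f (W [::] w))%:E = \int[mu]_x (f x * rN x)%:E)%E.
Proof.
move=> mf f01.
transitivity (\int[normal_prob 0 (sigma_nu d)]_x (f x)%:E)%E; last first.
  by rewrite ge0_integral_normal_prob//; exact/measurable_EFinP.
have mX : measurable_fun setT (W [::] : Omega -> measurableTypeR R) := W_meas [::].
pose X : {mfun Omega >-> measurableTypeR R} :=
  HB.pack (W [::]) (isMeasurableFun.Build _ _ _ _ _ mX).
transitivity (\int[distribution P X]_x (f x)%:E)%E.
  rewrite ge0_integral_distribution//; first exact/measurable_EFinP.
  by move=> x; rewrite lee_fin; case/andP: (f01 x).
by apply: eq_measure_integral => A mA _; exact: W_root.
Qed.

Variable h : R.
Local Notation N := (vcount d W h (W [::]) (iota 0 d.+1)).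

Definition infcl := [set om | vcard (R:=R) (tcluster d h (W [::] om) (W ^~ om)) = +oo%E].

Let mN n t : measurable [set w | (t < N n w)%N].
Proof. exact: measurable_vcount. Qed.

Lemma infclE : infcl = \bigcap_t \bigcup_n [set w | (t < N n w)%N].
Proof.
apply/seteqP; split => w.
  rewrite /infcl /= tcluster_tvertices => /(vcard_infP (R := R) d (iota_uniq 0 d.+1)) H t _.
  by have [m hm] := H t; exists m.
move=> H; rewrite /infcl /= tcluster_tvertices.
apply/(vcard_infP (R := R) d (iota_uniq 0 d.+1)) => n.
by have [m _ hm] := H n I; exists m.
Qed.

Lemma measurable_infcl : measurable infcl.
Proof.
rewrite infclE; apply: bigcap_measurable => // t _; exact: bigcup_measurable.
Qed.

Lemma infcl_le_tail t : fine (P infcl) <= tail P N t.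
Proof.
apply: fine_P_le; [exact: measurable_infcl|exact: mtail|].
by rewrite infclE => w /(_ t I).
Qed.

Lemma tail_cvg_infcl : tail P N t @[t --> \oo] --> fine (P infcl).
Proof.
apply: fine_cvg; rewrite fineK; last exact: (fin_num_measure P _ measurable_infcl).
rewrite infclE; apply: nonincreasing_cvg_mu.
- by rewrite (le_lt_trans (probability_le1 P (mtail mN 0)))// ltry.
- exact: mtail.
- by rewrite -infclE; exact: measurable_infcl.
- move=> s t st; rewrite subsetEset => w [n _ /= tn]; exists n => //=.
  exact: leq_ltn_trans tn.
Qed.

Section weight.
Variable z : R.
Hypothesis z01 : 0 <= z < 1.

Let z0 : 0 <= z. Proof. by case/andP: z01. Qed.
Let z1 : z < 1. Proof. by case/andP: z01. Qed.
Let z01' : 0 <= z <= 1. Proof. by rewrite z0 ltW. Qed.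

(** [1 - E z^N] for the full tree under [P]. It lies between the probability of an infinite cluster
    and [(1 - z) T + tail T] for every [T], so it tends to that probability as [z] tends to 1. *)
Definition vroot := 1 - Rintegral P setT (fun w => gfun d h z d.+1 (W [::] w)).

Lemma vroot_series : series (fun t => tail P N t * z ^+ t) @ \oo --> vroot / (1 - z).
Proof.
rewrite /vroot -{2}(size_iota 0 d.+1).
apply: cluster_tail_series => //; [|exact: iota_uniq|exact: all_iota0].
by move=> k k0; apply: measurable_peel => //; rewrite eq_sym.
Qed.

Lemma infcl_le_vroot : fine (P infcl) <= vroot.
Proof.
have z10 : 0 < 1 - z by rewrite subr_gt0.
have zi : 0 < (1 - z)^-1 by rewrite invr_gt0.
rewrite -(ler_pM2r zi).
have g := @cvg_geometric_series R (fine (P infcl)) z.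
rewrite ger0_norm// in g.
apply: (ler_cvg_to (g z1) vroot_series); near=> n.
rewrite /series /=; apply: ler_sum => t _; rewrite /geometric /= ler_wpM2r ?exprn_ge0//.
exact: infcl_le_tail.
Unshelve. all: by end_near. Qed.

(** The first [T] terms of the series are at most 1 each, and the later coefficients at most
    [tail T]. *)
Lemma vroot_le_tail T : vroot <= (1 - z) * T%:R + tail P N T.
Proof.
have z10 : 0 < 1 - z by rewrite subr_gt0.
have g := @cvg_geometric_series R (tail P N T) z; rewrite ger0_norm// in g.
suff : vroot / (1 - z) <= T%:R + tail P N T / (1 - z).
  rewrite ler_pdivrMr// => /le_trans; apply.
  rewrite le_eqVlt; apply/orP; left; apply/eqP; field; rewrite gt_eqF//.
have g2 : T%:R + series (geometric (tail P N T) z) n @[n --> \oo] -->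
    T%:R + tail P N T / (1 - z) by apply: cvgD; [exact: cvg_cst|exact: g].
apply: (ler_cvg_to vroot_series g2); near=> n.
have Tn : (T <= n)%N by near: n; exact: nbhs_infty_ge.
rewrite /series /= (@big_cat_nat _ _ _ T 0 n)//=; apply: lerD.
  rewrite -[leRHS](_ : \sum_(0 <= i < T) 1 = _); last by rewrite sumr_const_nat subn0.
  by apply: ler_sum => t _; apply: mulr_ile1; rewrite ?tail_ge0 ?tail_le1 ?exprn_ge0 ?exprn_ile1// ltW.
rewrite [leRHS](@big_cat_nat _ _ _ T 0 n)//=; apply: ler_wpDl.
  by apply: sumr_ge0 => t _; rewrite /geometric /= mulr_ge0 ?tail_ge0 ?exprn_ge0.
rewrite big_nat [leRHS]big_nat; apply: ler_sum => t /andP[Tt _].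
by rewrite /geometric /= ler_wpM2r ?exprn_ge0//; exact: tail_noninc.
Unshelve. all: by end_near. Qed.

Let gm := measurable_gfun hd h z01' d.+1.
Let gi := gfun_in01 hd h z01' d.+1.
Local Notation w := (wlim d h z).
Let wm : measurable_fun setT w. Proof. exact: measurable_wlim. Qed.
Let wi x : 0 <= w x <= 1. Proof. exact: wlim_in01. Qed.

Lemma integrable_in01_nu (f : R -> R) : measurable_fun setT f -> in01 f ->
  mu.-integrable setT (fun x => (f x * rN x)%:E).
Proof.
move=> mf f01; apply: (@le_integrableR _ _ _ _ (fun x => 1 * rN x)) => //.
- by apply: measurable_funM => //; exact: measurable_rho_nu.
- move=> x _; case/andP: (f01 x) => f0 f1.
  by rewrite ger0_norm ?mulr_ge0 ?rho_nu_ge0// ler_wpM2r ?rho_nu_ge0.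
- exact: integrable_rho_nu.
Qed.

Lemma vrootE : vroot = Rintegral mu setT (fun x => (1 - gfun d h z d.+1 x) * rN x).
Proof.
have i2 := integrable_in01_nu gm gi.
rewrite /vroot (_ : Rintegral P _ _ = Rintegral mu setT (fun x => gfun d h z d.+1 x * rN x)).
  have {1}-> : 1 = Rintegral mu setT (fun x => 1 * rN x) :> R.
    by rewrite /Rintegral integral_rho_nu.
  rewrite -RintegralB//; last exact: integrable_rho_nu.
  by apply: eq_Rintegral => x _; rewrite mulrBl.
by rewrite /Rintegral integral_root.
Qed.

Lemma Lop_w_frac x : 0 <= Lop d h w x / d%:R <= 1.
Proof. by have /andP[? ?] := Lop_frac01 hd h x wm wi; apply/andP; split; lra. Qed.

Lemma one_sub_gfun k x : h <= x ->
  1 - gfun d h z k x <= (1 - z) + k%:R / d%:R * Lop d h w x.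
Proof.
move=> hx; rewrite /gfun hx; have y01 := Lop_w_frac x.
have b := bernoulli_le k y01.
have -> : k%:R / d%:R * Lop d h w x = k%:R * (Lop d h w x / d%:R) by ring.
move: b y01; set y := Lop d h w x / d%:R => b /andP[y0 y1].
have : z * (1 - k%:R * y) <= z * (1 - y) ^+ k by rewrite ler_wpM2l.
have : z * (k%:R * y) <= 1 * (k%:R * y) by apply: ler_wpM2r; [rewrite mulr_ge0|exact: ltW].
by rewrite mulrBr; lra.
Qed.

Lemma wlim_le x : h <= x -> w x <= (1 - z) + Lop d h w x.
Proof.
move=> hx; have := one_sub_gfun d hx.
by rewrite /gfun hx -(wlim_eq hd z01' hx) divff ?gt_eqF// mul1r.
Qed.

(** One more child at the root only enlarges the cluster. *)
Lemma wlim_le_gfun x : w x <= 1 - gfun d h z d.+1 x.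
Proof.
have [hx|xh] := leP h x; last by rewrite wlim_lt// /gfun (lt_geF xh) subrr.
have /andP[s0 s1] := Lop_frac01 hd h x wm wi.
rewrite (wlim_eq hd z01' hx) /gfun hx lerD2l lerN2 ler_wpM2l//.
by rewrite exprS ler_piMl ?exprn_ge0.
Qed.

Lemma vroot_ge : Rintegral mu setT (fun x => w x * rN x) <= vroot.
Proof.
rewrite vrootE; apply: le_Rintegral => //.
- exact: integrable_in01_nu.
- apply: integrable_in01_nu; first exact: measurable_funB.
  by move=> x; case/andP: (gi x) => g0 g1; apply/andP; split; lra.
- by move=> x _; rewrite ler_wpM2r ?rho_nu_ge0 ?wlim_le_gfun.
Qed.

(** A union bound over the [d + 1] children gives [(d + 1) / d * L w]; integrated against [nu], [L]
    contributes at most a factor [d] by symmetry. *)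
Lemma vroot_le : vroot <= (1 - z) + (d%:R + 1) * Rintegral mu `[h, +oo[ (fun x => w x * rN x).
Proof.
have i1 : mu.-integrable `[h, +oo[ (fun x => (1 * rN x)%:E).
  by apply: integrableS (integrable_rho_nu hd).
have gk (x : R) : h <= x -> (\int[mu]_(a in `[h, +oo[)
    ((fun=> 1 : R) a * rho_Y d (a - x / d%:R))%:E <= (1 * (fun=> 1) x)%:E)%E.
  by move=> _; rewrite mulr1; exact: rho_Y_integral_le1.
have m1 : measurable_fun setT (fun _ : R => 1 : R) by exact: measurable_cst.
have Lle := Lop_weighted_le hd wm wi m1 (fun=> ler01) i1 gk.
have iL := integrable_Lop_weighted hd wm wi m1 (fun=> ler01) i1.
rewrite mulr1 in Lle.
have e1 : Rintegral mu `[h, +oo[ (fun x => w x * (1 * rN x)) =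
    Rintegral mu `[h, +oo[ (fun x => w x * rN x).
  by apply: eq_Rintegral => x _; rewrite mul1r.
rewrite e1 in Lle.
have cut : vroot = Rintegral mu `[h, +oo[ (fun x => (1 - gfun d h z d.+1 x) * rN x).
  rewrite vrootE /Rintegral [in RHS]integral_mkcond; congr fine.
  apply: eq_integral => x _; rewrite /patch; have [hx|xh] := leP h x.
    by rewrite mem_set//= in_itv /= hx.
  rewrite memNset; last by rewrite /= in_itv /= andbT leNgt xh.
  by rewrite /gfun (lt_geF xh) subrr mul0r.
have iz : mu.-integrable `[h, +oo[ (fun x => ((1 - z) * (1 * rN x))%:E).
  by apply: integrableZR => //; exact: measurable_itv.
have iLk : mu.-integrable `[h, +oo[ (fun x => (d.+1%:R / d%:R * (Lop d h w x * (1 * rN x)))%:E).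
  by apply: integrableZR => //; exact: measurable_itv.
have ig : mu.-integrable `[h, +oo[ (fun x => ((1 - gfun d h z d.+1 x) * rN x)%:E).
  apply: (@integrableS _ _ _ mu setT) => //.
  apply: integrable_in01_nu; first exact: measurable_funB.
  by move=> x; case/andP: (gi x) => g0 g1; apply/andP; split; lra.
have step : vroot <= Rintegral mu `[h, +oo[ (fun x => (1 - z) * (1 * rN x) +
    d.+1%:R / d%:R * (Lop d h w x * (1 * rN x))).
  rewrite cut; apply: le_Rintegral; [exact: measurable_itv|exact: ig| |].
    by apply: integrableDR => //; exact: measurable_itv.
  move=> x /=; rewrite in_itv /= andbT => hx; rewrite mul1r mulrA -mulrDl.
  by rewrite ler_wpM2r ?rho_nu_ge0// one_sub_gfun.
apply: le_trans step _.
rewrite RintegralD; [|exact: measurable_itv|exact: iz|exact: iLk].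
rewrite (RintegralZl _ _ i1) ?(RintegralZl _ _ iL); try exact: measurable_itv.
apply: lerD.
  rewrite -[leRHS]mulr1 ler_wpM2l ?subr_ge0 ?(ltW z1)//.
  rewrite -lee_fin /Rintegral fineK; last exact: (integrable_fin_num _ i1).
  rewrite -(integral_rho_nu hd); apply: ge0_subset_integral => //.
  - by apply/measurable_EFinP/measurable_funM => //; exact: measurable_rho_nu.
  - by move=> x _; rewrite lee_fin mul1r rho_nu_ge0.
apply: le_trans (ler_wpM2l _ Lle) _; first by rewrite divr_ge0// ltW.
by rewrite mulrA divfK ?gt_eqF// -natr1.
Qed.

End weight.

End percolation.

Section critical_level.
Context {R : realType} (d : nat) {dT : measure_display} {Omega : measurableType dT}.
Hypothesis hd : (2 <= d)%N.
Variables (P : probability Omega R) (W : seq nat -> Omega -> R).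
Hypothesis W_meas : forall x, measurable_fun setT (W x).
Hypothesis W_root : forall B, measurable B ->
  P (W [::] @^-1` B) = normal_prob 0 (sigma_nu d) B.
Hypothesis W_Y : forall x, vtx d x -> x != [::] -> forall B, measurable B ->
  P (W x @^-1` B) = normal_prob 0 (sigma_Y d) B.
Hypothesis W_indep : mutually_independent P (vtx d) W.
Variables (hs lam : R) (chi : R -> R).
Hypothesis hs_def : hs%:E = ereal_inf [set h%:E | h in [set h : R | P (infcl d W h) = 0%E]].
Hypothesis lam_gt0 : 0 < lam.
Hypothesis chi_L2 : L2nu d chi.
Hypothesis chi_ge0 : forall x, 0 <= chi x.
Hypothesis chi_norm : nu_int d (fun x => chi x ^+ 2) = 1.
Hypothesis chi_eig : forall a, Lop d hs chi a = lam * chi a.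

Lemma lam_le1 : lam <= 1.
Proof.
rewrite leNgt; apply/negP => l1.
have [dl dl0 Hdl] := supercritical hd lam_gt0 chi_L2 chi_ge0 chi_norm chi_eig l1.
have fin : ereal_inf [set h%:E | h in [set h : R | P (infcl d W h) = 0%E]] \is a fin_num.
  by rewrite -hs_def.
(* The infimum [hs] is approached by levels without infinite cluster, one of which lies within
   [dl]. *)
have [_ [h Ph <-]] := lb_ereal_inf_adherent dl0 fin.
rewrite -hs_def -EFinD lte_fin => hdl.
have hh : hs <= h by rewrite -lee_fin hs_def; apply: ereal_inf_lbound; exists h.
have [|e [z0 [e0 /andP[z00 z01] He]]] := Hdl h; first by rewrite hh ltW.
have tl : tail P (vcount d W h (W [::]) (iota 0 d.+1)) t @[t --> \oo] --> 0.
  have p0 : fine (P (infcl d W h)) = 0 by rewrite (Ph : P (infcl d W h) = 0%E).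
  by rewrite -p0; exact: tail_cvg_infcl.
have e20 : 0 < e / 2 by rewrite divr_gt0.
have [T _ hT] : \forall t \near \oo, tail P (vcount d W h (W [::]) (iota 0 d.+1)) t < e / 2.
  exact: cvgr_lt tl _ e20.
have {}hT := hT T (leqnn T).
(* Close enough to 1 for the lower bound [e] and for [(1 - z) * T <= e / 2], while [tail T < e / 2];
   this yields [e <= vroot < e]. *)
pose z := Num.max z0 (1 - e / (2 * (T%:R + 1))).
have T1 : 0 < T%:R + 1 :> R by rewrite ltr_wpDl.
have z1 : z < 1 by rewrite gt_max z01 /= ltrBlDr ltrDl divr_gt0// mulr_gt0.
have zz0 : z0 <= z by rewrite le_max lexx.
have zz : 0 <= z < 1 by rewrite z1 andbT; exact: le_trans zz0.
have zz' : 0 <= z <= 1 by case/andP: zz => -> /ltW.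
have h1 := He z (wlim d h z) ltac:(by rewrite zz0 z1) (is_w_wlim hd zz' hh).
have h2 := vroot_ge hd W_meas W_root h zz.
have h3 := vroot_le_tail hd W_meas W_Y W_indep h zz T.
have h4 : (1 - z) * T%:R <= e / 2.
  have : 1 - z <= e / (2 * (T%:R + 1)) by rewrite lerBlDl -lerBlDr le_max lexx orbT.
  move=> hz; apply: (@le_trans _ _ (e / (2 * (T%:R + 1)) * (T%:R + 1))).
    by apply: ler_pM => //; [rewrite subr_ge0 ltW|rewrite lerDl].
  by rewrite le_eqVlt; apply/orP; left; apply/eqP; field; rewrite gt_eqF.
have h5 : fine (\int[lebesgue_measure]_(x in (`[hs, +oo[%classic : set R)) (wlim d h z x * rho_nu d x)%:E)%E
    = Rintegral lebesgue_measure setT (fun x => wlim d h z x * rho_nu d x).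
  rewrite /Rintegral [in LHS]integral_mkcond; congr fine; apply: eq_integral => x _.
  rewrite /patch; case: ifPn => //; rewrite notin_setE /= in_itv /= andbT => /negP.
  rewrite -ltNge => xh.
  by rewrite wlim_lt ?mul0r//; exact: lt_le_trans hh.
rewrite h5 in h1.
by have := le_lt_trans (le_trans h1 (le_trans h2 h3)) (ler_ltD h4 hT); rewrite -splitr ltxx.
Qed.

(** If [lam < 1], some level below [hs] already has no infinite cluster, the probability being at
    most [vroot], which is arbitrarily small; this contradicts the infimum. *)
Lemma lam_ge1 : 1 <= lam.
Proof.
rewrite leNgt; apply/negP => l1.
have [h hh H] := subcritical hd lam_gt0 chi_L2 chi_ge0 chi_norm chi_eig l1.
suff P0 : P (infcl d W h) = 0%E.
  have : hs <= h by rewrite -lee_fin hs_def; apply: ereal_inf_lbound; exists h.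
  by rewrite leNgt hh.
have fin : P (infcl d W h) \is a fin_num.
  exact: (fin_num_measure P _ (measurable_infcl d W_meas h)).
rewrite -(fineK fin); congr EFin; apply/eqP; rewrite eq_le fine_ge0// andbT.
apply/ler_addgt0Pr => e e0; rewrite add0r.
have d1 : 0 < d%:R + 1 :> R by rewrite ltr_wpDl.
have e1 : 0 < e / (2 * (d%:R + 1)) by rewrite divr_gt0// mulr_gt0.
have [z0 /andP[z00 z01] Hz] := H _ e1.
pose z := Num.max z0 (1 - e / 2).
have z1 : z < 1 by rewrite gt_max z01 /= ltrBlDr ltrDl divr_gt0.
have zz0 : z0 <= z by rewrite le_max lexx.
have zz : 0 <= z < 1 by rewrite z1 andbT; exact: le_trans zz0.
have zz' : 0 <= z <= 1 by case/andP: zz => -> /ltW.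
have h1 := Hz z (wlim d h z) ltac:(by rewrite zz0 z1) (measurable_wlim hd h zz')
  (wlim_in01 hd h zz') (wlim_le hd zz).
have h2 := infcl_le_vroot hd W_meas W_Y W_indep h zz.
have h3 := vroot_le hd W_meas W_root h zz.
apply: le_trans h2 (le_trans h3 _).
have h4 : (d%:R + 1) * Rintegral lebesgue_measure `[h, +oo[ (fun x => wlim d h z x * rho_nu d x) <= e / 2.
  have -> : e / 2 = (d%:R + 1) * (e / (2 * (d%:R + 1))) by field; rewrite gt_eqF.
  by apply: ler_wpM2l; [exact: ltW|exact: h1].
have h5 : 1 - z <= e / 2 by rewrite lerBlDl -lerBlDr le_max lexx orbT.
by rewrite (splitr e); exact: lerD.
Qed.

Lemma lam_eq1 : lam = 1.
Proof. by apply/eqP; rewrite eq_le lam_le1 lam_ge1. Qed.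

End critical_level.

Theorem theorem2p3
  (R : realType) (d : nat) (hd : (2 <= d)%N)
  (* a probability space carrying W: W [::] is phi_o ~ nu under P, and
     W x = Y_x ~ N(0, (d+1)/d) for x <> o; all independent *)
  (dT : measure_display) (Omega : measurableType dT) (P : probability Omega R)
  (W : seq nat -> Omega -> R)
  (W_meas : forall x, measurable_fun setT (W x))
  (W_root : forall B, measurable B ->
     P (W [::] @^-1` B) = normal_prob 0 (sigma_nu d) B)
  (W_Y : forall x, vtx d x -> x != [::] -> forall B, measurable B ->
     P (W x @^-1` B) = normal_prob 0 (sigma_Y d) B)
  (W_indep : mutually_independent P (vtx d) W)
  (* h^* = inf { h : P[ |C_o^h| = oo ] = 0 } *)
  (hs : R)
  (hs_def : hs%:E = ereal_inf [set h%:E | h in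
     [set h : R | P [set om | vcard (R:=R) (tcluster d h (W [::] om) (W ^~ om)) = +oo%E] = 0%E]])
  (* chi = chi_{h^*}: nonnegative unit-norm eigenfunction of L_{h^*} for
     the eigenvalue lambda_{h^*} = ||L_{h^*}|| *)
  (lam : R) (lam_def : lambda d hs = lam%:E)
  (chi : R -> R) (chi_L2 : L2nu d chi) (chi_ge0 : forall x, 0 <= chi x)
  (chi_norm : nu_int d (fun x => chi x ^+ 2) = 1)
  (chi_eig : forall a, Lop d hs chi a = lam * chi a) :
  forall a : R, hs <= a ->
  (* under P_a : phi_o = a, phi_x = phi_{parent}/d + Y_x *)
    (exists eps : R -> R, eps t @[t --> +oo] --> 0 /\
      \forall t \near +oo,
        P [set om | (t%:E < vcard (R:=R) (tcluster d hs a (W ^~ om) `&` Tplus))%E]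
        = (C1 d chi * chi a * t `^ (- (1 / 2)) * (1 + eps t))%:E)
  /\
    (exists eps : R -> R, eps t @[t --> +oo] --> 0 /\
      \forall t \near +oo,
        P [set om | (t%:E < vcard (R:=R) (tcluster d hs a (W ^~ om)))%E]
        = (C1 d chi * ((d%:R + 1) / d%:R) * chi a * t `^ (- (1 / 2)) * (1 + eps t))%:E).
Proof.
move=> a ha; have lam0 := lambda_gt0 hd lam_def.
have lam1 := lam_eq1 hd W_meas W_root W_Y W_indep hs_def lam0 chi_L2 chi_ge0 chi_norm chi_eig.
have C10 := C1_gt0 hd lam0 chi_L2 chi_ge0 chi_norm chi_eig lam1.
have chi0 := chi_a_gt0 hd lam0 chi_L2 chi_ge0 chi_norm chi_eig ha.
have d0 := @d_gt0 R d hd.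
(* Both claims are this one statement for two lists of first steps, with factor [size rc / d]. *)
have T rc := critical_tail hd W_meas W_Y W_indep lam0 chi_L2 chi_ge0 chi_norm chi_eig
  lam1 ha (rc := rc).
split.
- apply: (@asymp_powR _ _ (tail P (vcount d W hs (fun=> a) (iota 1 d)))).
  + by rewrite mulr_gt0.
  + move=> t t0; rewrite -(prob_vcard_gt d P W_meas hs (measurable_cst a) (iota_uniq 1 d) t0).
    by congr (P _); apply/funext => om; rewrite /= tcluster_Tplus_tvertices.
  + have := T _ (iota_uniq 1 d) (all_iota1 d).
    by rewrite size_iota divff ?gt_eqF// mulr1; apply; exact: ltnW.
- apply: (@asymp_powR _ _ (tail P (vcount d W hs (fun=> a) (iota 0 d.+1)))).
  + by rewrite mulr_gt0// mulr_gt0// divr_gt0// ltr_wpDl.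
  + move=> t t0; rewrite -(prob_vcard_gt d P W_meas hs (measurable_cst a) (iota_uniq 0 d.+1) t0).
    by congr (P _); apply/funext => om; rewrite /= tcluster_tvertices.
  + have := T _ (iota_uniq 0 d.+1) (all_iota0 d).
    by rewrite size_iota natr1; apply.
Qed.
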